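(* Let $a\in\mathbb{R}$ satisfy $\frac35<a<\frac95$, and let $M_a\subset\mathbb{C}^2$ be the hypersurface defined, in coordinates $z$ and $w=u+iv$, by $$v=|z|^8+\big(|z|^6+a|z|^2\,\mathrm{Re}\,z^4\big)u^2+|z|^2u^8 .$$ Then, in a neighbourhood of the origin, $M_a$ is pseudoconvex, and $M_a$ is not locally convexifiable at the origin. On the other hand, the model hypersurface to $M_a$ at the origin is the convex hypersurface $v=|z|^8$, and all other points of $M_a$ in a neighbourhood of the origin are strongly pseudoconvex, so that the models at these points are also convex.
   Context: Pseudoconvexity of $M_a$ refers to the side $\{v>F\}$, where $F$ is the right-hand side of the defining equation. **Model hypersurface.** If $M$ is a smooth hypersurface in $\mathbb{C}^2$ bounding a pseudoconvex domain and $p\in M$ is a point of finite type $k$ (the type being the maximal order of contact of $M$ with complex curves through $p$; strongly pseudoconvex points are the points of type two), there are local holomorphic coordinates $(z,w)$, $w=u+iv$, centered at $p$, with the positive $v$-axis in the inner normal direction, in which $M$ is given by $v=P_1(z,\bar z)+o(|z|^k,u)$, where $P_1(z,\bar z)=a_0|z|^k+\sum_{j=2,\dots,k}|z|^{k-j}\,\mathrm{Re}(a_jz^j)$ with $a_j\in\mathbb{C}$, $a_0>0$. The hypersurface $v=P_1(z,\bar z)$ is the model hypersurface to $M$ at $p$; it is determined uniquely up to a linear change of variables and addition of a harmonic term $\mathrm{Re}\,\alpha z^k$, $\alpha\in\mathbb{C}$. **Local convexifiability.** $M$ is locally convexifiable at $p$ if there exist local holomorphic coordinates in a full neighbourhood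 of $p$ such that $M$ is convex with respect to the underlying linear space. *)

(* Defs.v *)
From Stdlib Require Import Reals.
From Coquelicot Require Import Coquelicot.

Open Scope R_scope.

(* A hypersurface of C^2 is given by a defining function rho : C * C -> R; it is
   {rho = 0}, and {rho < 0} is its pseudoconvex side. *)

(* Holomorphic means locally the sum of a convergent power series. In two
   variables the absolute convergence is stated explicitly, so that the order
   of summation is irrelevant. *)
Definition holomorphic1_at (f : C -> C) (t0 : C) : Prop :=
  exists (c : nat -> C) (r : posreal), forall h : C, Cmod h < r ->
    is_series (fun n => c n * h ^ n)%C (f (t0 + h)%C).

Definition holomorphic2_at (f : C * C -> C) (p : C * C) : Prop :=
  exists (c : nat -> nat -> C) (r : posreal),
    forall h1 h2 : C, Cmod h1 < r -> Cmod h2 < r ->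
      (exists B : R, forall N : nat,
         sum_n (fun m => sum_n (fun n =>
           Cmod (c m n) * Cmod h1 ^ m * Cmod h2 ^ n) N) N <= B) /\
      filterlim
        (fun N : nat => sum_n (fun m => sum_n (fun n =>
           (c m n * h1 ^ m * h2 ^ n)%C) N) N)
        eventually (locally (f ((fst p + h1)%C, (snd p + h2)%C))).

Definition holomorphic_on (U : C * C -> Prop) (Phi : C * C -> C * C) : Prop :=
  forall p, U p -> holomorphic2_at (fun q => fst (Phi q)) p /\
                   holomorphic2_at (fun q => snd (Phi q)) p.

Definition image (Phi : C * C -> C * C) (U : C * C -> Prop) : C * C -> Prop :=
  fun q => exists p, U p /\ Phi p = q.

Definition local_coordinates
    (p : C * C) (U : C * C -> Prop) (Phi : C * C -> C * C) : Prop :=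
  open U /\ U p /\ holomorphic_on U Phi /\ open (image Phi U) /\
  exists Psi : C * C -> C * C,
    holomorphic_on (image Phi U) Psi /\ forall q, U q -> Psi (Phi q) = q.

Definition dir_derive (e : C * C) (f : C * C -> C) (p : C * C) : C :=
  let q (t : R) := ((fst p + t * fst e)%C, (snd p + t * snd e)%C) in
  (Derive (fun t => Re (f (q t))) 0, Derive (fun t => Im (f (q t))) 0).

Definition e1 : C * C := (RtoC 1, RtoC 0).
Definition e2 : C * C := (RtoC 0, RtoC 1).
Definition imul (e : C * C) : C * C := ((Ci * fst e)%C, (Ci * snd e)%C).

(* [d_hol ej] is d/dz_j = (d/dx_j - i d/dy_j)/2 and [d_bar ej] is d/dzbar_j. *)
Definition d_hol (e : C * C) (f : C * C -> C) (p : C * C) : C :=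
  ((dir_derive e f p - Ci * dir_derive (imul e) f p) / 2)%C.
Definition d_bar (e : C * C) (f : C * C -> C) (p : C * C) : C :=
  ((dir_derive e f p + Ci * dir_derive (imul e) f p) / 2)%C.

Definition complex_tangent (rho : C * C -> R) (p t : C * C) : Prop :=
  let f q := RtoC (rho q) in
  (d_hol e1 f p * fst t + d_hol e2 f p * snd t)%C = RtoC 0.

(* The sum is real; [Re] only fixes the type. *)
Definition levi_form (rho : C * C -> R) (p t : C * C) : R :=
  let f q := RtoC (rho q) in
  Re (d_hol e1 (d_bar e1 f) p * fst t * Cconj (fst t)
      + d_hol e1 (d_bar e2 f) p * fst t * Cconj (snd t)
      + d_hol e2 (d_bar e1 f) p * snd t * Cconj (fst t)
      + d_hol e2 (d_bar e2 f) p * snd t * Cconj (snd t))%C.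

Definition pseudoconvex_at (rho : C * C -> R) (p : C * C) : Prop :=
  forall t, complex_tangent rho p t -> 0 <= levi_form rho p t.

Definition strongly_pseudoconvex_at (rho : C * C -> R) (p : C * C) : Prop :=
  forall t, complex_tangent rho p t -> t <> (RtoC 0, RtoC 0) ->
    0 < levi_form rho p t.

(* t |-> (g1 t, g2 t) parametrizes a nonsingular complex curve through p. *)
Definition complex_curve_at (p : C * C) (g1 g2 : C -> C) : Prop :=
  holomorphic1_at g1 (RtoC 0) /\ holomorphic1_at g2 (RtoC 0) /\
  (g1 (RtoC 0), g2 (RtoC 0)) = p /\
  exists l1 l2 : C,
    is_derive (K := C_AbsRing) (V := C_NormedModule) g1 (RtoC 0) l1 /\
    is_derive (K := C_AbsRing) (V := C_NormedModule) g2 (RtoC 0) l2 /\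
    (l1, l2) <> (RtoC 0, RtoC 0).

Definition contact_order_ge (rho : C * C -> R) (g1 g2 : C -> C) (k : nat) : Prop :=
  exists K delta : R, 0 < delta /\
    forall t : C, Cmod t < delta -> Rabs (rho (g1 t, g2 t)) <= K * Cmod t ^ k.

(* The maximal order of contact with complex curves through p equals k. *)
Definition finite_type (rho : C * C -> R) (p : C * C) (k : nat) : Prop :=
  (exists g1 g2, complex_curve_at p g1 g2 /\ contact_order_ge rho g1 g2 k) /\
  (forall g1 g2, complex_curve_at p g1 g2 -> ~ contact_order_ge rho g1 g2 (S k)).

Definition model_function (k : nat) (a0 : R) (a : nat -> C) (z : C) : R :=
  a0 * Cmod z ^ k +
  sum_n_m (fun j => Cmod z ^ (k - j) * Re (a j * z ^ j)%C) 2 k.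

(* v = P(z) is a model hypersurface at p, a point of finite type k. In the
   coordinates Phi centered at p, the hypersurface is v = G(z,u) with
   G = P + o(|z|^k + |u|), and the side rho < 0 is the side v > G, i.e. the
   positive v-axis is the inner normal direction. The model is only determined
   up to a linear change of variables and addition of Re (alpha z^k), so this is
   a relation. *)
Definition model_at (rho : C * C -> R) (p : C * C) (k : nat) (P : C -> R) : Prop :=
  finite_type rho p k /\
  (exists (a0 : R) (a : nat -> C), 0 < a0 /\
     forall z, P z = model_function k a0 a z) /\
  exists (U : C * C -> Prop) (Phi : C * C -> C * C) (G : C -> R -> R),
    local_coordinates p U Phi /\
    Phi p = (RtoC 0, RtoC 0) /\
    (forall q, U q ->
       let z := fst (Phi q) in let w := snd (Phi q) in
       (rho q = 0 <-> Im w = G z (Re w)) /\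
       (rho q < 0 <-> Im w > G z (Re w))) /\
    (forall eps : R, 0 < eps -> exists delta : R, 0 < delta /\
       forall (z : C) (u : R), Cmod z < delta -> Rabs u < delta ->
         Rabs (G z u - P z) <= eps * (Cmod z ^ k + Rabs u)).

Definition convex_set (A : C * C -> Prop) : Prop :=
  forall p q, A p -> A q -> forall t : R, 0 <= t <= 1 ->
    A ((t * fst p + (1 - t) * fst q)%C, (t * snd p + (1 - t) * snd q)%C).

Definition convex_model (P : C -> R) : Prop :=
  convex_set (fun p => Im (snd p) > P (fst p)).

(* Convexity of the hypersurface in the coordinates Phi: one of its two sides is
   mapped to a convex set. *)
Definition locally_convexifiable (rho : C * C -> R) (p : C * C) : Prop :=
  exists (U : C * C -> Prop) (Phi : C * C -> C * C),
    local_coordinates p U Phi /\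
    (convex_set (image Phi (fun q => U q /\ rho q < 0)) \/
     convex_set (image Phi (fun q => U q /\ rho q > 0))).

Definition F (a : R) (z : C) (u : R) : R :=
  Cmod z ^ 8
  + (Cmod z ^ 6 + a * Cmod z ^ 2 * Re (z ^ 4)%C) * u ^ 2
  + Cmod z ^ 2 * u ^ 8.

Definition rho_M (a : R) (p : C * C) : R :=
  F a (fst p) (Re (snd p)) - Im (snd p).

Definition M (a : R) (p : C * C) : Prop :=
  Im (snd p) = F a (fst p) (Re (snd p)).

Definition origin : C * C := (RtoC 0, RtoC 0).

(* Main.v *)
Require Import Defs.
From Stdlib Require Import Reals Lra Lia Psatz FunctionalExtensionality ClassicalEpsilon.
From Coquelicot Require Import Coquelicot.

Open Scope R_scope.

(** Write rho = F(z,u) - v. All statements rest on the second order Taylor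
    expansion of rho at a point p: half the real Hessian of rho at a vector x is
    Re A(x) + L(x), with A complex quadratic and L the Levi form.

    Pseudoconvexity. On the tangent vector (1, tau) the form L differs from
    F_{z zbar} = 16|z|^6 + (9|z|^4 + 5a Re z^4) u^2 + u^8 by at most a multiple of
    |z| m, where m = |z|^6 + |z|^4 u^2 + u^8 ([tangent_second_order]), because F_z is
    already of this size. As 5a < 9, the main term is at least a multiple of m, so
    that L > 0 near the origin, except where z = u = 0 ([levi_pos]).

    Models. At the origin F - |z|^8 = o(u), so |z|^8 is the model. That no regular
    curve has higher contact follows by averaging over a circle: the holomorphic part
    has mean zero and F along the curve is at least a multiple of |t|^8
    ([finite_type_8]). Near any other point p a polynomial shear removes the linear
    and the harmonic quadratic terms and leaves v = L |z|^2 + o(|z|^2 + |u|); the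
    equation is solved for v by the intermediate value theorem
    ([model_strongly_pseudoconvex]).

    Non-convexifiability. Suppose that coordinates Phi = (f, g) make one side convex.
    The real tangent hyperplane of the image at Phi(p) then misses the interior of the
    image of that side ([support_inequality]). Its pull-back is {Re s_p = 0} for a holomorphic s_p
    with d s_p = 2 d' rho at p, and comparing rho with Re s_p to second order in the
    tangent directions gives |A - s_p''/2| <= L on (1, tau) if the side rho < 0 is
    convex, and L <= 0 if the side rho > 0 is ([support_second_order]). The latter is
    impossible at strongly pseudoconvex points ([outer_side_not_convex]).

    In the former case s_p''/2 equals i N / J up to negligible terms, where
    J = f_z g_w - f_w g_z and N = (f_z g_zz - g_z f_zz)/2 are holomorphic in p
    ([support_estimate]). Use the four points of M with z = x, ix, -x, -ix and the same
    u. They have the same w, since F depends on |z| and Re z^4 only. Along them F_zz is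
    12 x^6 + (6 + 10a) x^4 u^2 with alternating sign, whereas F_{z zbar} has the
    constant value 16 x^6 + (9 + 5a) x^4 u^2 + u^8. The alternating sum of N is
    4 c(w) x^2 + O(x^6), so that
      4 |J| (6 + 10a) x^4 u^2 <= 4 |J| (9 + 5a) x^4 u^2 + 4 |c(w)| x^2 + errors.
    Take u = t^4. The scale x = t^6, where x^4 u^2 and u^8 balance, gives
    c(w) = O(t^20); at x = t^5 the term x^4 u^2 = t^28 dominates x^6, u^8 and c x^2, all
    O(t^30). As t -> 0 this yields 6 + 10a <= 9 + 5a, that is a <= 3/5
    ([inner_side_not_convex]). *)

(** * Second order jets and the Taylor expansion of the defining function *)

Definition size2 (h : C * C) : R := Cmod (fst h) + Cmod (snd h).

Lemma size2_ge0 h : 0 <= size2 h.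
Proof. unfold size2; generalize (Cmod_ge_0 (fst h)) (Cmod_ge_0 (snd h)); lra. Qed.

(** Closes sign conditions on products, powers, sums and quotients of nonnegative
    quantities. *)
Ltac pos :=
  solve [ repeat first
    [ assumption | apply Cmod_ge_0 | apply size2_ge0 | apply Rabs_pos | apply pos_INR
    | match goal with
      | |- 0 <= ?x ^ _ => apply pow_le
      | |- 0 < ?x ^ _ => apply pow_lt
      | |- 0 <= _ * _ => apply Rmult_le_pos
      | |- 0 < _ * _ => apply Rmult_lt_0_compat
      | |- 0 < / _ => apply Rinv_0_lt_compat
      | |- 0 < _ / _ => apply Rdiv_lt_0_compat
      | |- 0 < Rmin _ _ => apply Rmin_pos
      | |- 0 <= _ + _ => apply Rplus_le_le_0_compat
      end
    | lra ] ].

(** The constant c, the linear part l and the quadratic part q describe phi up to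
    third order; l and q are only required to have the right size, which is enough
    for the Leibniz rule. *)
Definition jet2 (phi : C * C -> R) (c : R) (l q : C * C -> R) : Prop :=
  exists K, 0 <= K /\ forall h, size2 h <= 1 ->
    Rabs (l h) <= K * size2 h /\ Rabs (q h) <= K * size2 h ^ 2 /\
    Rabs (phi h - c - l h - q h) <= K * size2 h ^ 3.

Lemma jet2_ext phi phi' c c' l l' q q' :
  jet2 phi c l q -> (forall h, phi h = phi' h) -> c = c' ->
  (forall h, l h = l' h) -> (forall h, q h = q' h) -> jet2 phi' c' l' q'.
Proof.
  intros (K & HK & H) E <- E1 E2. exists K; split; auto.
  intros h Hh. rewrite <- E, <- E1, <- E2. auto.
Qed.

Lemma jet2_const c : jet2 (fun _ => c) c (fun _ => 0) (fun _ => 0).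
Proof.
  exists 0; split; [lra|]. intros h _.
  replace (c - c - 0 - 0) with 0 by ring. rewrite Rabs_R0. lra.
Qed.

Lemma jet2_add phi psi c d l m q s :
  jet2 phi c l q -> jet2 psi d m s ->
  jet2 (fun h => phi h + psi h) (c + d) (fun h => l h + m h) (fun h => q h + s h).
Proof.
  intros (K & HK & H) (K' & HK' & H'). exists (K + K'); split; [lra|].
  intros h Hh. destruct (H h Hh) as (a1 & a2 & a3), (H' h Hh) as (b1 & b2 & b3).
  repeat split; rewrite Rmult_plus_distr_r.
  - eapply Rle_trans; [apply Rabs_triang|lra].
  - eapply Rle_trans; [apply Rabs_triang|lra].
  - replace (phi h + psi h - (c + d) - (l h + m h) - (q h + s h))
      with ((phi h - c - l h - q h) + (psi h - d - m h - s h)) by ring.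
    eapply Rle_trans; [apply Rabs_triang|lra].
Qed.

Lemma Rabs_mult_le x y u v :
  Rabs x <= u -> Rabs y <= v -> Rabs (x * y) <= u * v.
Proof.
  intros. rewrite Rabs_mult. apply Rmult_le_compat; auto using Rabs_pos.
Qed.

Lemma jet2_mul phi psi c d l m q s :
  jet2 phi c l q -> jet2 psi d m s ->
  jet2 (fun h => phi h * psi h) (c * d) (fun h => c * m h + d * l h)
       (fun h => c * s h + l h * m h + d * q h).
Proof.
  intros (K & HK & H) (K' & HK' & H').
  set (a := Rabs c) in *. set (b := Rabs d).
  assert (Ha : 0 <= a) by apply Rabs_pos. assert (Hb : 0 <= b) by apply Rabs_pos.
  assert (HKK : 0 <= K * K') by nra.
  assert (HaK : 0 <= a * K') by nra. assert (HbK : 0 <= b * K) by nra.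
  exists (a * K' + b * K + 8 * (K * K')); split; [lra|].
  intros h Hh. destruct (H h Hh) as (a1 & a2 & a3), (H' h Hh) as (b1 & b2 & b3).
  assert (Hn : 0 <= size2 h) by apply size2_ge0.
  set (n := size2 h) in *.
  assert (n2 : 0 <= n ^ 2 <= n) by (simpl; nra).
  assert (n3 : 0 <= n ^ 3 <= n ^ 2) by (simpl in *; nra).
  assert (n4 : 0 <= n ^ 4 <= n ^ 3) by (simpl in *; nra).
  assert (n5 : 0 <= n ^ 5 <= n ^ 3) by (simpl in *; nra).
  assert (n6 : 0 <= n ^ 6 <= n ^ 3) by (simpl in *; nra).
  assert (Hc : Rabs c <= a) by (unfold a; lra).
  assert (Hd : Rabs d <= b) by (unfold b; lra).
  repeat split.
  - eapply Rle_trans; [apply Rabs_triang|].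
    generalize (Rabs_mult_le _ _ _ _ Hc b1) (Rabs_mult_le _ _ _ _ Hd a1).
    nra.
  - eapply Rle_trans; [apply Rabs_triang|].
    eapply Rle_trans; [apply Rplus_le_compat_r, Rabs_triang|].
    generalize (Rabs_mult_le _ _ _ _ Hc b2) (Rabs_mult_le _ _ _ _ Hd a2)
      (Rabs_mult_le _ _ _ _ a1 b1).
    replace (K * n * (K' * n)) with (K * K' * n ^ 2) by ring.
    nra.
  - replace (phi h * psi h - c * d - (c * m h + d * l h)
             - (c * s h + l h * m h + d * q h))
      with (c * (psi h - d - m h - s h) + d * (phi h - c - l h - q h)
        + (l h * s h + q h * m h + q h * s h + l h * (psi h - d - m h - s h)
           + q h * (psi h - d - m h - s h)
           + (phi h - c - l h - q h) * m h + (phi h - c - l h - q h) * s h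
           + (phi h - c - l h - q h) * (psi h - d - m h - s h))) by ring.
    generalize (Rabs_mult_le _ _ _ _ Hc b3) (Rabs_mult_le _ _ _ _ Hd a3)
      (Rabs_mult_le _ _ _ _ a1 b2) (Rabs_mult_le _ _ _ _ a1 b3)
      (Rabs_mult_le _ _ _ _ a2 b1) (Rabs_mult_le _ _ _ _ a2 b2)
      (Rabs_mult_le _ _ _ _ a2 b3) (Rabs_mult_le _ _ _ _ a3 b1)
      (Rabs_mult_le _ _ _ _ a3 b2) (Rabs_mult_le _ _ _ _ a3 b3).
    intros i1 i2 i3 i4 i5 i6 i7 i8 i9 i10.
    assert (m4 : K * K' * n ^ 4 <= K * K' * n ^ 3) by (apply Rmult_le_compat_l; lra).
    assert (m5 : K * K' * n ^ 5 <= K * K' * n ^ 3) by (apply Rmult_le_compat_l; lra).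
    assert (m6 : K * K' * n ^ 6 <= K * K' * n ^ 3) by (apply Rmult_le_compat_l; lra).
    apply Rabs_le_between in i1, i2, i3, i4, i5, i6, i7, i8, i9, i10.
    apply Rabs_le_between. simpl in *. split; lra.
Qed.

Lemma jet2_affine x (l : C * C -> R) :
  (forall h, Rabs (l h) <= size2 h) -> jet2 (fun h => x + l h) x l (fun _ => 0).
Proof.
  intros H. exists 1; split; [lra|]. intros h _.
  replace (x + l h - x - l h - 0) with 0 by ring. rewrite Rabs_R0, !Rmult_1_l.
  repeat split; auto using pow_le, size2_ge0.
Qed.

Lemma Rabs_im_le z : Rabs (Im z) <= Cmod z.
Proof.
  generalize (Rmax_Cmod z) (Rmax_r (Rabs (fst z)) (Rabs (snd z))). unfold Im; lra.
Qed.

Lemma jet2_coordinates x :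
  jet2 (fun h => x + Re (fst h)) x (fun h => Re (fst h)) (fun _ => 0) /\
  jet2 (fun h => x + Im (fst h)) x (fun h => Im (fst h)) (fun _ => 0) /\
  jet2 (fun h => x + Re (snd h)) x (fun h => Re (snd h)) (fun _ => 0) /\
  jet2 (fun h => x + Im (snd h)) x (fun h => Im (snd h)) (fun _ => 0).
Proof.
  repeat split; apply jet2_affine; intros h; unfold size2;
  generalize (re_le_Cmod (fst h)) (re_le_Cmod (snd h)) (Rabs_im_le (fst h))
    (Rabs_im_le (snd h)) (Cmod_ge_0 (fst h)) (Cmod_ge_0 (snd h)); lra.
Qed.

(** The functions [Fz] to [Fuu] are the derivatives of F with respect to z, zbar and u;
    [Fzzb] is the one in z and zbar. *)
Definition Fz (a : R) (z : C) (u : R) : C :=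
  (RtoC 4 * z ^ 3 * Cconj z ^ 4
   + (RtoC 3 * z ^ 2 * Cconj z ^ 3
      + RtoC (a / 2) * (RtoC 5 * z ^ 4 * Cconj z + Cconj z ^ 5)) * RtoC (u ^ 2)
   + Cconj z * RtoC (u ^ 8))%C.

Definition Fu (a : R) (z : C) (u : R) : R :=
  2 * (Cmod z ^ 6 + a * Cmod z ^ 2 * Re (z ^ 4)%C) * u + 8 * Cmod z ^ 2 * u ^ 7.

Definition Fzz (a : R) (z : C) (u : R) : C :=
  (RtoC 12 * z ^ 2 * Cconj z ^ 4
   + (RtoC 6 * z * Cconj z ^ 3 + RtoC (10 * a) * z ^ 3 * Cconj z) * RtoC (u ^ 2))%C.

Definition Fzzb (a : R) (z : C) (u : R) : R :=
  16 * Cmod z ^ 6 + (9 * Cmod z ^ 4 + 5 * a * Re (z ^ 4)%C) * u ^ 2 + u ^ 8.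

Definition Fzu (a : R) (z : C) (u : R) : C :=
  ((RtoC 3 * z ^ 2 * Cconj z ^ 3
      + RtoC (a / 2) * (RtoC 5 * z ^ 4 * Cconj z + Cconj z ^ 5)) * RtoC (2 * u)
   + Cconj z * RtoC (8 * u ^ 7))%C.

Definition Fuu (a : R) (z : C) (u : R) : R :=
  2 * (Cmod z ^ 6 + a * Cmod z ^ 2 * Re (z ^ 4)%C) + 56 * Cmod z ^ 2 * u ^ 6.

Definition rho_z (a : R) (p : C * C) : C := Fz a (fst p) (Re (snd p)).
Definition rho_w (a : R) (p : C * C) : C := (Fu a (fst p) (Re (snd p)) / 2, 1 / 2).

(** Twice the (1,0)-part of the differential of rho: its real part is the differential. *)
Definition drho (a : R) (p h : C * C) : C :=
  (RtoC 2 * (rho_z a p * fst h + rho_w a p * snd h))%C.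

(** With [levi], the decomposition of half the real Hessian of rho into the real part
    of a complex quadratic form and a Hermitian form. *)
Definition hess_hol (a : R) (p h : C * C) : C :=
  let z := fst p in let u := Re (snd p) in
  (Fzz a z u * fst h ^ 2 + Fzu a z u * fst h * snd h
   + RtoC (Fuu a z u / 4) * snd h ^ 2)%C.

Definition levi (a : R) (p h : C * C) : R :=
  let z := fst p in let u := Re (snd p) in
  Fzzb a z u * Cmod (fst h) ^ 2 + Re (Fzu a z u * fst h * Cconj (snd h))%C
  + Fuu a z u / 4 * Cmod (snd h) ^ 2.

Lemma Cmod_pow2 z : Cmod z ^ 2 = fst z ^ 2 + snd z ^ 2.
Proof. apply Cmod2_alt. Qed.
Lemma Cmod_pow4 z : Cmod z ^ 4 = (fst z ^ 2 + snd z ^ 2) ^ 2.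
Proof. rewrite <- Cmod_pow2; ring. Qed.
Lemma Cmod_pow6 z : Cmod z ^ 6 = (fst z ^ 2 + snd z ^ 2) ^ 3.
Proof. rewrite <- Cmod_pow2; ring. Qed.
Lemma Cmod_pow8 z : Cmod z ^ 8 = (fst z ^ 2 + snd z ^ 2) ^ 4.
Proof. rewrite <- Cmod_pow2; ring. Qed.

(** F written with sums and products of real coordinates only, the form in which jets
    are computed. *)
Definition Freal (a x y u : R) : R :=
  let s := x * x + y * y in let d := x * x + - 1 * (y * y) in
  s * s * (s * s) + (s * s * s + a * s * (d * d + -4 * (x * x * (y * y)))) * (u * u)
  + s * (u * u * (u * u) * (u * u * (u * u))).

Lemma F_real a z u : F a z u = Freal a (fst z) (snd z) u.
Proof.
  unfold F, Freal. rewrite Cmod_pow8, Cmod_pow6, Cmod_pow2.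
  destruct z as [x y]; simpl; ring.
Qed.

(** Jets of the coordinates combine by the Leibniz rule; only the comparison with the
    Wirtinger derivatives of F is computational. *)
Theorem rho_taylor a p :
  jet2 (fun h => rho_M a ((fst p + fst h)%C, (snd p + snd h)%C)) (rho_M a p)
    (fun h => Re (drho a p h)) (fun h => Re (hess_hol a p h) + levi a p h).
Proof.
  eapply jet2_ext.
  { apply (jet2_add (fun h => Freal a (fst (fst p) + Re (fst h)) (snd (fst p) + Im (fst h))
       (fst (snd p) + Re (snd h))) (fun h => -1 * (Im (snd p) + Im (snd h)))).
    2: { apply jet2_mul; [apply jet2_const|apply jet2_coordinates]. }
    unfold Freal; cbv zeta.
    repeat first [ apply jet2_coordinates | apply jet2_const | apply jet2_add | apply jet2_mul ]. }
  all: destruct p as [[x y] [u v]].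
  - intros [[h k] [s t]]. unfold rho_M. rewrite F_real. unfold Re, Im; simpl. ring.
  - unfold rho_M. rewrite F_real. unfold Re, Im, Freal; simpl. ring.
  - intros [[h k] [s t]]. unfold drho, rho_z, rho_w, Fz, Fu.
    rewrite Cmod_pow6, Cmod_pow2. simpl. field.
  - intros [[h k] [s t]]. unfold hess_hol, levi, Fzz, Fzu, Fuu, Fzzb; cbv zeta.
    rewrite !Cmod_pow6, !Cmod_pow4, !Cmod_pow2. simpl. field.
Qed.

(** * Wirtinger derivatives of the defining function and its Levi form *)

(** The real partial derivatives of F in x, y and u, for z = x + iy. *)
Definition FX (a x y u : R) : R :=
  let s := x ^ 2 + y ^ 2 in let q := x ^ 4 - 6 * x ^ 2 * y ^ 2 + y ^ 4 in
  8 * x * s ^ 3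
  + (6 * x * s ^ 2 + a * (2 * x * q + s * (4 * x ^ 3 - 12 * x * y ^ 2))) * u ^ 2
  + 2 * x * u ^ 8.
Definition FY (a x y u : R) : R :=
  let s := x ^ 2 + y ^ 2 in let q := x ^ 4 - 6 * x ^ 2 * y ^ 2 + y ^ 4 in
  8 * y * s ^ 3
  + (6 * y * s ^ 2 + a * (2 * y * q + s * (4 * y ^ 3 - 12 * x ^ 2 * y))) * u ^ 2
  + 2 * y * u ^ 8.
Definition FU (a x y u : R) : R :=
  let s := x ^ 2 + y ^ 2 in let q := x ^ 4 - 6 * x ^ 2 * y ^ 2 + y ^ 4 in
  2 * (s ^ 3 + a * s * q) * u + 8 * s * u ^ 7.

Lemma Fz_real a z u :
  Fz a z u = (FX a (fst z) (snd z) u / 2, - FY a (fst z) (snd z) u / 2).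
Proof.
  destruct z as [x y]. unfold Fz, FX, FY.
  apply injective_projections; simpl; field.
Qed.

Lemma Fu_real a z u : Fu a z u = FU a (fst z) (snd z) u.
Proof.
  destruct z as [x y]. unfold Fu, FU. rewrite Cmod_pow6, Cmod_pow2. simpl. field.
Qed.

Lemma dir_derive_eq e f p a b :
  is_derive (fun t : R => Re (f ((fst p + t * fst e)%C, (snd p + t * snd e)%C))) 0 a ->
  is_derive (fun t : R => Im (f ((fst p + t * fst e)%C, (snd p + t * snd e)%C))) 0 b ->
  dir_derive e f p = (a, b).
Proof.
  intros H1 H2. unfold dir_derive.
  now rewrite (is_derive_unique _ _ _ H1), (is_derive_unique _ _ _ H2).
Qed.

(** Computes a directional derivative of a polynomial function of the real coordinates. *)
Ltac dir_tac :=
  apply dir_derive_eq;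
  match goal with |- is_derive ?f ?x ?l =>
    let g := eval simpl in f in
    apply (is_derive_ext g); [ intros t; simpl; reflexivity | ] end;
  auto_derive; trivial; simpl; try field.

Lemma rho_real a p :
  rho_M a p = Freal a (fst (fst p)) (snd (fst p)) (fst (snd p)) - snd (snd p).
Proof. unfold rho_M. now rewrite F_real. Qed.

Lemma rho_dir_derive a p :
  let f q := RtoC (rho_M a q) in
  let FX := FX a (fst (fst p)) (snd (fst p)) (fst (snd p)) in
  let FY := FY a (fst (fst p)) (snd (fst p)) (fst (snd p)) in
  let FU := FU a (fst (fst p)) (snd (fst p)) (fst (snd p)) in
  dir_derive e1 f p = (FX, 0) /\ dir_derive (imul e1) f p = (FY, 0) /\
  dir_derive e2 f p = (FU, 0) /\ dir_derive (imul e2) f p = (-1, 0).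
Proof.
  destruct p as [[x y] [u v]]. cbv zeta.
  rewrite (functional_extensionality (fun q => RtoC (rho_M a q))
    (fun q => RtoC (Freal a (fst (fst q)) (snd (fst q)) (fst (snd q)) - snd (snd q)))).
  2: { intros q; now rewrite rho_real. }
  unfold FX, FY, FU, Freal.
  repeat split; dir_tac.
Qed.

Lemma rho_d_hol a p :
  let f q := RtoC (rho_M a q) in
  d_hol e1 f p = rho_z a p /\ d_hol e2 f p = rho_w a p.
Proof.
  cbv zeta. unfold d_hol, rho_z, rho_w.
  destruct (rho_dir_derive a p) as (-> & -> & -> & ->).
  rewrite Fz_real, Fu_real. unfold Re.
  destruct p as [[x y] [u v]].
  split; apply injective_projections; simpl; field.
Qed.

Lemma rho_d_bar a :
  let f q := RtoC (rho_M a q) in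
  d_bar e1 f = (fun p => (FX a (fst (fst p)) (snd (fst p)) (fst (snd p)) / 2,
                          FY a (fst (fst p)) (snd (fst p)) (fst (snd p)) / 2)) /\
  d_bar e2 f = (fun p => (FU a (fst (fst p)) (snd (fst p)) (fst (snd p)) / 2, - / 2)).
Proof.
  cbv zeta. split; apply functional_extensionality; intros p; unfold d_bar;
  destruct (rho_dir_derive a p) as (E1 & E2 & E3 & E4);
  rewrite ?E1, ?E2, ?E3, ?E4; destruct p as [[x y] [u v]];
  apply injective_projections; simpl; field.
Qed.

(** The mixed second derivatives are obtained from the real second derivatives of F,
    listed in the proof. *)
Lemma rho_d_hol_d_bar a p :
  let f q := RtoC (rho_M a q) in
  let z := fst p in let u := Re (snd p) in
  d_hol e1 (d_bar e1 f) p = RtoC (Fzzb a z u) /\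
  d_hol e1 (d_bar e2 f) p = (RtoC (/ 2) * Fzu a z u)%C /\
  d_hol e2 (d_bar e1 f) p = (RtoC (/ 2) * Cconj (Fzu a z u))%C /\
  d_hol e2 (d_bar e2 f) p = RtoC (Fuu a z u / 4).
Proof.
  cbv zeta.  destruct p as [[x y] [u v]].
  match goal with |- d_hol e1 _ ?p0 = _ /\ _ => set (P := p0) end.
  set (s := x ^ 2 + y ^ 2). set (q := x ^ 4 - 6 * x ^ 2 * y ^ 2 + y ^ 4).
  set (qx := 4 * x ^ 3 - 12 * x * y ^ 2). set (qy := 4 * y ^ 3 - 12 * x ^ 2 * y).
  set (FXX := 8 * s ^ 3 + 48 * x ^ 2 * s ^ 2
    + (6 * s ^ 2 + 24 * x ^ 2 * s
       + a * (2 * q + 4 * x * qx + s * (12 * x ^ 2 - 12 * y ^ 2))) * u ^ 2 + 2 * u ^ 8).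
  set (FXY := 48 * x * y * s ^ 2
    + (24 * x * y * s + a * (2 * x * qy + 2 * y * qx - 24 * x * y * s)) * u ^ 2).
  set (FYY := 8 * s ^ 3 + 48 * y ^ 2 * s ^ 2
    + (6 * s ^ 2 + 24 * y ^ 2 * s
       + a * (2 * q + 4 * y * qy - s * (12 * x ^ 2 - 12 * y ^ 2))) * u ^ 2 + 2 * u ^ 8).
  set (FXU := 2 * u * (6 * x * s ^ 2 + a * (2 * x * q + s * qx)) + 16 * x * u ^ 7).
  set (FYU := 2 * u * (6 * y * s ^ 2 + a * (2 * y * q + s * qy)) + 16 * y * u ^ 7).
  set (FUU := 2 * (s ^ 3 + a * s * q) + 56 * s * u ^ 6).
  set (f1 := fun p : C * C => (FX a (fst (fst p)) (snd (fst p)) (fst (snd p)) / 2,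
                               FY a (fst (fst p)) (snd (fst p)) (fst (snd p)) / 2) : C).
  set (f2 := fun p : C * C => (FU a (fst (fst p)) (snd (fst p)) (fst (snd p)) / 2, - / 2) : C).
  destruct (rho_d_bar a : _ = f1 /\ _ = f2) as (-> & ->).
  assert (E1 : dir_derive e1 f1 P = (FXX / 2, FXY / 2))
    by (unfold P, f1, FX, FY, FXX, FXY, qx, qy, q, s; dir_tac).
  assert (E2 : dir_derive (imul e1) f1 P = (FXY / 2, FYY / 2))
    by (unfold P, f1, FX, FY, FYY, FXY, qx, qy, q, s; dir_tac).
  assert (E3 : dir_derive e2 f1 P = (FXU / 2, FYU / 2))
    by (unfold P, f1, FX, FY, FXU, FYU, qx, qy, q, s; dir_tac).
  assert (E4 : dir_derive (imul e2) f1 P = (0, 0))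
    by (unfold P, f1, FX, FY; dir_tac).
  assert (E5 : dir_derive e1 f2 P = (FXU / 2, 0))
    by (unfold P, f2, FU, FXU, qx, q, s; dir_tac).
  assert (E6 : dir_derive (imul e1) f2 P = (FYU / 2, 0))
    by (unfold P, f2, FU, FYU, qy, q, s; dir_tac).
  assert (E7 : dir_derive e2 f2 P = (FUU / 2, 0))
    by (unfold P, f2, FU, FUU, q, s; dir_tac).
  assert (E8 : dir_derive (imul e2) f2 P = (0, 0))
    by (unfold P, f2, FU; dir_tac).
  unfold d_hol. rewrite E1, E2, E3, E4, E5, E6, E7, E8.
  unfold P, Fzzb, Fzu, Fuu. rewrite !Cmod_pow6, !Cmod_pow4, !Cmod_pow2.
  unfold FXX, FXY, FYY, FXU, FYU, FUU, qx, qy, q, s.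
  repeat split; apply injective_projections; simpl; field.
Qed.

Lemma Cmult_eq_0 b c : b <> RtoC 0 -> (b * c)%C = RtoC 0 -> c = RtoC 0.
Proof.
  intros Hb H. replace c with (/ b * (b * c))%C by (field; auto). rewrite H. ring.
Qed.

Lemma complex_tangent_rho a p t : complex_tangent (rho_M a) p t <-> drho a p t = RtoC 0.
Proof.
  unfold complex_tangent, drho. cbv zeta.
  destruct (rho_d_hol a p) as (-> & ->). split; intros H.
  - rewrite H. ring.
  - assert (E : (RtoC 2 <> RtoC 0)%C) by (intros E; apply RtoC_inj in E; lra).
    now apply (Cmult_eq_0 (RtoC 2)).
Qed.

Lemma levi_form_rho a p t : levi_form (rho_M a) p t = levi a p t.
Proof.
  unfold levi_form. cbv zeta.
  destruct (rho_d_hol_d_bar a p) as (-> & -> & -> & ->).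
  unfold levi. cbv zeta. rewrite !Cmod_pow2.
  generalize (Fzzb a (fst p) (Re (snd p))) (Fzu a (fst p) (Re (snd p)))
    (Fuu a (fst p) (Re (snd p))).
  intros A [B1 B2] D. destruct t as [[t1 t2] [t3 t4]]. simpl. field.
Qed.

(** * Size of the derivatives and positivity of the Levi form *)

(** The size of the Levi form near the origin: every error term below is compared with
    |z| times this weight. *)
Definition weight (z : C) (u : R) : R := Cmod z ^ 6 + Cmod z ^ 4 * u ^ 2 + u ^ 8.

Lemma weight_ge0 z u : 0 <= weight z u.
Proof.
  unfold weight. generalize (Cmod_ge_0 z). intros H.
  nra.
Qed.

Lemma Re_pow4_le z : Rabs (Re (z ^ 4)%C) <= Cmod z ^ 4.
Proof. rewrite <- Cmod_pow. apply re_le_Cmod. Qed.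

Lemma Cmod_R_nonneg x : 0 <= x -> Cmod (RtoC x) = x.
Proof. intros. rewrite Cmod_R. now apply Rabs_pos_eq. Qed.

Lemma Cmod_add_le x y u v : Cmod x <= u -> Cmod y <= v -> Cmod (x + y) <= u + v.
Proof. intros. generalize (Cmod_triangle x y). lra. Qed.

Lemma Cmod_mult_le x y u v : Cmod x <= u -> Cmod y <= v -> Cmod (x * y) <= u * v.
Proof.
  intros. rewrite Cmod_mult. apply Rmult_le_compat; auto using Cmod_ge_0.
Qed.

Ltac cmod_simpl :=
  rewrite ?Cmod_mult, ?Cmod_pow, ?Cmod_conj, ?Cmod_R.

Lemma pow_even_ge0 (u : R) n : 0 <= u ^ (2 * n).
Proof. rewrite pow_mult. apply pow_le. simpl; nra. Qed.

Lemma Fz_bound a z u : 0 <= a <= 2 -> Cmod (Fz a z u) <= 9 * Cmod z * weight z u.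
Proof.
  intros Ha. unfold Fz, weight.
  assert (u2 := pow_even_ge0 u 1). assert (u8 := pow_even_ge0 u 4). simpl Nat.mul in *.
  eapply Rle_trans; [apply Cmod_add_le; [apply Cmod_add_le|]; [apply Rle_refl| |apply Rle_refl]|].
  { rewrite Cmod_mult. apply Rmult_le_compat_r; [apply Cmod_ge_0|].
    apply Cmod_add_le; [apply Rle_refl|].
    rewrite Cmod_mult. apply Rmult_le_compat_l; [apply Cmod_ge_0|].
    apply Cmod_add_le; apply Rle_refl. }
  cmod_simpl. rewrite !Rabs_pos_eq by lra.
  generalize (Cmod_ge_0 z). generalize (Cmod z). intros r Hr.
  assert (0 <= r ^ 7) by pos. assert (0 <= r ^ 5 * u ^ 2) by pos.
  assert (0 <= r * u ^ 8) by pos.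
  replace ((3 * r ^ 2 * r ^ 3 + a / 2 * (5 * r ^ 4 * r + r ^ 5)) * u ^ 2)
    with (3 * (r ^ 5 * u ^ 2) + 3 * (a * (r ^ 5 * u ^ 2))) by field.
  assert (a * (r ^ 5 * u ^ 2) <= 2 * (r ^ 5 * u ^ 2)) by nra.
  replace (9 * r * (r ^ 6 + r ^ 4 * u ^ 2 + u ^ 8))
    with (9 * r ^ 7 + 9 * (r ^ 5 * u ^ 2) + 9 * (r * u ^ 8)) by ring.
  replace (4 * r ^ 3 * r ^ 4) with (4 * r ^ 7) by ring. lra.
Qed.

Lemma pow_le1 x n : 0 <= x <= 1 -> 0 <= x ^ n <= 1.
Proof.
  intros H. split; [now apply pow_le|]. rewrite <- (pow1 n). now apply pow_incr.
Qed.

Lemma Fzu_bound a z u : 0 <= a <= 2 -> Cmod z <= 1 -> Rabs u <= 1 -> Cmod (Fzu a z u) <= 26.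
Proof.
  intros Ha Hz Hu. unfold Fzu.
  eapply Rle_trans.
  { apply Cmod_add_le; [|apply Rle_refl].
    rewrite Cmod_mult. apply Rmult_le_compat_r; [apply Cmod_ge_0|].
    apply Cmod_add_le; [apply Rle_refl|].
    rewrite Cmod_mult. apply Rmult_le_compat_l; [apply Cmod_ge_0|].
    apply Cmod_add_le; apply Rle_refl. }
  cmod_simpl. rewrite !Rabs_mult, <- !RPow_abs. rewrite !(Rabs_pos_eq (_ / _)) by lra.
  rewrite !(Rabs_pos_eq 2), !(Rabs_pos_eq 3), !(Rabs_pos_eq 5), !(Rabs_pos_eq 8) by lra.
  generalize (Cmod_ge_0 z) (Rabs_pos u) Hz Hu.
  generalize (Cmod z) (Rabs u). intros r v Hr Hv Hr1 Hv1.
  replace ((3 * r ^ 2 * r ^ 3 + a / 2 * (5 * r ^ 4 * r + r ^ 5)) * (2 * v) + r * (8 * v ^ 7))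
    with (6 * (r ^ 5 * v) + 6 * (a * (r ^ 5 * v)) + 8 * (r * v ^ 7)) by field.
  assert (0 <= r ^ 5 * v <= 1).
  { generalize (pow_le1 r 5 (conj Hr Hr1)). nra. }
  assert (0 <= r * v ^ 7 <= 1).
  { generalize (pow_le1 v 7 (conj Hv Hv1)). nra. }
  nra.
Qed.

Lemma Fuu_bound a z u : 0 <= a <= 2 -> Cmod z <= 1 -> Rabs u <= 1 -> Rabs (Fuu a z u) <= 62.
Proof.
  intros Ha Hz Hu. unfold Fuu.
  generalize (Re_pow4_le z). generalize (Re (z ^ 4)%C). intros q Hq.
  apply Rabs_le_between in Hq.
  generalize (Cmod_ge_0 z) Hz Hq. generalize (Cmod z). intros r Hr Hr1 Hq'.
  assert (H2 := pow_le1 r 2 (conj Hr Hr1)). assert (Hu6 : 0 <= u ^ 6 <= 1).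
  { assert (E := pow_even_ge0 u 3). simpl Nat.mul in E. split; auto.
    rewrite <- (Rabs_pos_eq (u ^ 6)), <- RPow_abs by auto.
    now apply pow_le1; split; [apply Rabs_pos|]. }
  assert (-1 <= r ^ 2 * q <= 1) by nra.
  apply Rabs_le_between.
  replace (a * r ^ 2 * q) with (a * (r ^ 2 * q)) by ring.
  replace (56 * r ^ 2 * u ^ 6) with (56 * (r ^ 2 * u ^ 6)) by ring.
  split; nra.
Qed.

(** Here a < 9/5 enters: 9|z|^4 + 5a Re z^4 >= (9 - 5a)|z|^4. *)
Lemma Fzzb_lower a z u :
  3 / 5 < a < 9 / 5 -> Rmin 1 (9 - 5 * a) * weight z u <= Fzzb a z u.
Proof.
  intros Ha. unfold weight, Fzzb.
  simpl Nat.mul in *.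
  generalize (Re_pow4_le z). generalize (Re (z ^ 4)%C). intros q Hq.
  apply Rabs_le_between in Hq.
  assert (h1 := Rmin_l 1 (9 - 5 * a)). assert (h2 := Rmin_r 1 (9 - 5 * a)).
  set (c := Rmin 1 (9 - 5 * a)) in *.
  assert (c * Cmod z ^ 6 <= 16 * Cmod z ^ 6) by nra.
  assert (c * u ^ 8 <= u ^ 8) by nra.
  assert (c * Cmod z ^ 4 <= 9 * Cmod z ^ 4 + 5 * a * q) by nra.
  assert (c * Cmod z ^ 4 * u ^ 2 <= (9 * Cmod z ^ 4 + 5 * a * q) * u ^ 2) by nra.
  lra.
Qed.

Lemma rho_w_lower a p : / 2 <= Cmod (rho_w a p).
Proof.
  generalize (Rabs_im_le (rho_w a p)). unfold rho_w. simpl.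
  rewrite Rabs_pos_eq; lra.
Qed.

Lemma rho_w_neq0 a p : rho_w a p <> RtoC 0.
Proof. apply Cmod_gt_0. generalize (rho_w_lower a p). lra. Qed.

(** The complex tangent space at p is spanned by (1, tau) for this tau. *)
Definition tangent_slope (a : R) (p : C * C) : C := (- rho_z a p / rho_w a p)%C.

Lemma tangent_slope_spec a p t : drho a p t = RtoC 0 <-> snd t = (tangent_slope a p * fst t)%C.
Proof.
  assert (H := rho_w_neq0 a p). unfold drho, tangent_slope. split; intros E.
  - apply (Cmult_eq_0 (RtoC 2)) in E; [|intros E'; apply RtoC_inj in E'; lra].
    replace (snd t) with (((rho_z a p * fst t + rho_w a p * snd t) - rho_z a p * fst t)
      / rho_w a p)%C by (field; auto).
    rewrite E. field; auto.
  - rewrite E. field; auto.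
Qed.

Lemma weight_le3 z u : Cmod z <= 1 -> Rabs u <= 1 -> weight z u <= 3.
Proof.
  intros Hz Hu. unfold weight.
  assert (H4 := pow_le1 _ 4 (conj (Cmod_ge_0 z) Hz)).
  assert (E : forall n, 0 <= u ^ (2 * n) <= 1).
  { intros n. assert (E := pow_even_ge0 u n). split; auto.
    rewrite <- (Rabs_pos_eq (u ^ _)), <- RPow_abs by auto.
    now apply pow_le1; split; [apply Rabs_pos|]. }
  assert (E2 := E 1%nat). assert (E8 := E 4%nat). simpl Nat.mul in *. nra.
Qed.

Lemma tangent_slope_bound a p : 0 <= a <= 2 ->
  Cmod (tangent_slope a p) <= 18 * Cmod (fst p) * weight (fst p) (Re (snd p)).
Proof.
  intros Ha. unfold tangent_slope. rewrite Cmod_div by apply rho_w_neq0. rewrite Cmod_opp.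
  assert (H := Fz_bound a (fst p) (Re (snd p)) Ha). fold (rho_z a p) in H.
  assert (Hw := rho_w_lower a p).
  apply Rle_trans with (Cmod (rho_z a p) / / 2).
  - apply Rmult_le_compat_l; [apply Cmod_ge_0|]. apply Rinv_le_contravar; lra.
  - unfold Rdiv. rewrite Rinv_inv. lra.
Qed.

(** The slope tau is bounded by a multiple of |z| m (m the weight), so that replacing
    (1, tau) by (1, 0) in either form costs at most such a term. *)
Lemma tangent_second_order a p : 0 <= a <= 2 -> Cmod (fst p) <= 1 -> Rabs (Re (snd p)) <= 1 ->
  let z := fst p in let u := Re (snd p) in let h := (RtoC 1, tangent_slope a p) in
  Cmod (hess_hol a p h - Fzz a z u)%C <= 20000 * (Cmod z * weight z u) /\
  Rabs (levi a p h - Fzzb a z u) <= 20000 * (Cmod z * weight z u).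
Proof.
  intros Ha Hz Hu; cbv zeta.
  assert (H1 := Fzu_bound a _ _ Ha Hz Hu). assert (H2 := Fuu_bound a _ _ Ha Hz Hu).
  assert (H3 := tangent_slope_bound a p Ha).
  assert (H4 := weight_le3 _ _ Hz Hu). assert (H5 := weight_ge0 (fst p) (Re (snd p))).
  assert (H6 := Cmod_ge_0 (fst p)).
  set (e := Cmod (fst p) * weight (fst p) (Re (snd p))).
  assert (He : 0 <= e <= 3) by (unfold e; nra).
  replace (18 * Cmod (fst p) * weight (fst p) (Re (snd p))) with (18 * e) in H3
    by (unfold e; ring).
  assert (G1 : Cmod (Fzu a (fst p) (Re (snd p))) * Cmod (tangent_slope a p) <= 26 * (18 * e)).
  { apply Rmult_le_compat; auto using Cmod_ge_0. }
  assert (G2 : Rabs (Fuu a (fst p) (Re (snd p))) * Cmod (tangent_slope a p) ^ 2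
    <= 62 * (972 * e)).
  { apply Rmult_le_compat; auto using Rabs_pos. apply pow_le, Cmod_ge_0.
    assert (H7 := Cmod_ge_0 (tangent_slope a p)).
    apply Rle_trans with ((18 * e) ^ 2); [apply pow_incr; lra|]. simpl; nra. }
  unfold hess_hol, levi. cbv zeta. simpl fst; simpl snd. split.
  - match goal with |- Cmod ?x <= _ => replace x with
      (Fzu a (fst p) (Re (snd p)) * tangent_slope a p
       + RtoC (/ 4) * RtoC (Fuu a (fst p) (Re (snd p))) * tangent_slope a p ^ 2)%C end.
    2: { unfold Rdiv. rewrite RtoC_mult. ring. }
    eapply Rle_trans; [apply Cmod_triangle|]. rewrite !Cmod_mult, Cmod_pow, !Cmod_R.
    rewrite (Rabs_pos_eq (/ 4)) by lra. lra.
  - rewrite Cmod_1. replace (Fzu a (fst p) (Re (snd p)) * 1)%C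
      with (Fzu a (fst p) (Re (snd p))) by ring.
    match goal with |- Rabs ?x <= _ => replace x with
      (Re (Fzu a (fst p) (Re (snd p)) * Cconj (tangent_slope a p))%C
       + / 4 * (Fuu a (fst p) (Re (snd p)) * Cmod (tangent_slope a p) ^ 2)) by field end.
    eapply Rle_trans; [apply Rabs_triang|].
    generalize (re_le_Cmod (Fzu a (fst p) (Re (snd p)) * Cconj (tangent_slope a p))%C).
    rewrite Cmod_mult, Cmod_conj, !Rabs_mult, (Rabs_pos_eq (/ 4)) by lra.
    rewrite (Rabs_pos_eq (Cmod (tangent_slope a p) ^ 2)) by apply pow_le, Cmod_ge_0. lra.
Qed.

Lemma levi_scal a p c t :
  levi a p (c, (t * c)%C) = Cmod c ^ 2 * levi a p (RtoC 1, t).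
Proof.
  unfold levi; cbv zeta; simpl fst; simpl snd.
  rewrite Cmod_1, Cmod_mult, Rpow_mult_distr, !Cmod_pow2.
  generalize (Fzzb a (fst p) (Re (snd p))) (Fzu a (fst p) (Re (snd p)))
    (Fuu a (fst p) (Re (snd p))).
  intros A [b1 b2] D. destruct c as [c1 c2], t as [t1 t2]. simpl. field.
Qed.

Theorem levi_pos a : 3 / 5 < a < 9 / 5 ->
  exists d, 0 < d <= 1 /\ forall p, Cmod (fst p) < d -> Rabs (Re (snd p)) < d ->
    0 < weight (fst p) (Re (snd p)) -> 0 < levi a p (RtoC 1, tangent_slope a p).
Proof.
  intros Ha. set (c := Rmin 1 (9 - 5 * a)).
  assert (Hc : 0 < c <= 1) by (split; [apply Rmin_pos; lra|apply Rmin_l]).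
  exists (c / 20000). split; [lra|]. intros p Hz Hu Hm.
  destruct (tangent_second_order a p) as [_ H]; try lra.
  assert (H2 := Fzzb_lower a (fst p) (Re (snd p)) Ha). fold c in H2.
  apply Rabs_le_between in H.
  assert (Cmod (fst p) * weight (fst p) (Re (snd p))
    < c / 20000 * weight (fst p) (Re (snd p))) by nra.
  lra.
Qed.

(** On M the equations z = 0 and u = 0 force v = 0. *)
Lemma weight_pos p a : M a p -> p <> origin -> 0 < weight (fst p) (Re (snd p)).
Proof.
  intros HM Hp. destruct (Rle_lt_or_eq_dec _ _ (weight_ge0 (fst p) (Re (snd p)))) as [|E]; auto.
  exfalso; apply Hp. unfold weight in E.
  simpl Nat.mul in *.
  assert (E6 : Cmod (fst p) ^ 6 = 0) by nra. assert (E8 : Re (snd p) ^ 8 = 0) by nra.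
  assert (Ez : fst p = RtoC 0).
  { apply Cmod_eq_0. destruct (Req_dec (Cmod (fst p)) 0) as [|N]; auto.
    now apply pow_nonzero with (n := 6%nat) in N. }
  assert (Eu : Re (snd p) = 0).
  { destruct (Req_dec (Re (snd p)) 0) as [|N]; auto.
    now apply pow_nonzero with (n := 8%nat) in N. }
  unfold M, F in HM. rewrite Ez, Eu, Cmod_0 in HM.
  destruct p as [z [u v]]. simpl in Ez, Eu, HM. unfold origin.
  assert (Ev : v = 0) by pos. now rewrite Ez, Eu, Ev.
Qed.

(** * Neighbourhoods and power series in one variable *)

Definition shift (p h : C * C) : C * C := ((fst p + fst h)%C, (snd p + snd h)%C).

Lemma ball_C (x y : C) (e : R) : Cmod (y - x) < e -> ball (M := C_UniformSpace) x e y.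
Proof. exact (C_NormedModule_mixin_compat1 x y e). Qed.

Lemma sqrt2_le2 : sqrt 2 <= 2.
Proof.
  rewrite <- (sqrt_square 2) at 2 by lra. apply sqrt_le_1_alt. lra.
Qed.

Lemma C_ball (x y : C) (e : posreal) : ball (M := C_UniformSpace) x e y -> Cmod (y - x) < 2 * e.
Proof.
  intros H. assert (E := C_NormedModule_mixin_compat2 x y e H).
  assert (H2 := sqrt2_le2). assert (H3 := cond_pos e).
  apply Rlt_le_trans with (sqrt 2 * e); [exact E|nra].
Qed.

Lemma locally_shift (p : C * C) (P : C * C -> Prop) :
  locally p P <-> exists d, 0 < d /\ forall h, size2 h < d -> P (shift p h).
Proof.
  split.
  - intros [e H]. exists e; split; [apply cond_pos|]. intros h Hh. apply H.
    unfold size2 in Hh.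
    assert (H1 := Cmod_ge_0 (fst h)). assert (H2 := Cmod_ge_0 (snd h)).
    split; apply ball_C; simpl;
      [replace (fst p + fst h - fst p)%C with (fst h) by ring
      |replace (snd p + snd h - snd p)%C with (snd h) by ring]; lra.
  - intros (d & Hd & H). assert (Hd' : 0 < d / 4) by lra.
    exists (mkposreal _ Hd'). intros q [H1 H2]. apply C_ball in H1, H2. simpl in *.
    replace q with (shift p ((fst q - fst p)%C, (snd q - snd p)%C)).
    + apply H. unfold size2; simpl. lra.
    + destruct q; unfold shift; simpl; f_equal; ring.
Qed.

Lemma filterlim_C (u : nat -> C) (l : C) :
  filterlim u eventually (locally (T := C_UniformSpace) l) <->
  forall e, 0 < e -> exists N, forall n, (N <= n)%nat -> Cmod (u n - l) < e.
Proof.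
  split.
  - intros H e He. assert (He' : 0 < e / 2) by lra.
    destruct (H (fun y => ball (M := C_UniformSpace) l (e / 2) y)) as [N HN].
    + now exists (mkposreal _ He').
    + exists N; intros n Hn. specialize (HN n Hn).
      apply (C_ball _ _ (mkposreal _ He')) in HN. simpl in HN. lra.
  - intros H P [e HP]. destruct (H e (cond_pos e)) as [N HN].
    exists N; intros n Hn. apply HP, ball_C, HN, Hn.
Qed.

Lemma limit_in_disc (u : nat -> C) (l c : C) M N :
  filterlim u eventually (locally (T := C_UniformSpace) l) ->
  (forall n, (N <= n)%nat -> Cmod (u n - c) <= M) -> Cmod (l - c) <= M.
Proof.
  intros H HM. apply Rnot_lt_le. intros Hlt.
  destruct (proj1 (filterlim_C u l) H (Cmod (l - c) - M)) as [N' HN']; [lra|].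
  specialize (HN' (N + N')%nat ltac:(lia)). specialize (HM (N + N')%nat ltac:(lia)).
  generalize (Cmod_triangle (u (N + N')%nat - c) (- (u (N + N')%nat - l))).
  rewrite Cmod_opp.
  replace (u (N + N')%nat - c + - (u (N + N')%nat - l))%C with (l - c)%C by ring. lra.
Qed.

(** Indexed by the number of terms, so that the empty sum is included. *)
Fixpoint psum (b : nat -> C) (k : nat) (z : C) : C :=
  match k with O => RtoC 0 | S k => (psum b k z + b k * z ^ k)%C end.

Lemma sum_n_psum (b : nat -> C) z n :
  sum_n (G := C_AbelianMonoid) (fun n => (b n * z ^ n)%C) n = psum b (S n) z.
Proof.
  induction n as [|n IH].
  - rewrite sum_O. simpl. ring.
  - rewrite sum_Sn, IH. reflexivity.
Qed.

Lemma psum_increment (b : nat -> C) B q z k d :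
  (forall n, Cmod (b n) <= B * q ^ n) -> 0 <= q -> q * Cmod z <= / 2 ->
  Cmod (psum b (k + d) z - psum b k z) <= 2 * B * (q * Cmod z) ^ k * (1 - (/ 2) ^ d).
Proof.
  intros Hb Hq Hz.
  assert (HB : 0 <= B). { generalize (Hb 0%nat) (Cmod_ge_0 (b 0%nat)); simpl; lra. }
  assert (Hx : 0 <= q * Cmod z) by (apply Rmult_le_pos; auto using Cmod_ge_0).
  induction d as [|d IH].
  - rewrite Nat.add_0_r. replace (psum b k z - psum b k z)%C with (RtoC 0) by ring.
    rewrite Cmod_0. simpl. lra.
  - rewrite Nat.add_succ_r. simpl psum.
    replace (psum b (k + d) z + b (k + d)%nat * z ^ (k + d) - psum b k z)%C
      with (psum b (k + d) z - psum b k z + b (k + d)%nat * z ^ (k + d))%C by ring.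
    eapply Rle_trans; [apply Cmod_triangle|].
    assert (E : Cmod (b (k + d)%nat * z ^ (k + d)) <= B * (q * Cmod z) ^ k * (/ 2) ^ d).
    { rewrite Cmod_mult, Cmod_pow.
      apply Rle_trans with (B * q ^ (k + d) * Cmod z ^ (k + d)).
      - apply Rmult_le_compat_r; [apply pow_le, Cmod_ge_0|apply Hb].
      - replace (B * q ^ (k + d) * Cmod z ^ (k + d))
          with (B * (q * Cmod z) ^ k * (q * Cmod z) ^ d)
          by (rewrite !pow_add, !Rpow_mult_distr; ring).
        apply Rmult_le_compat_l; [apply Rmult_le_pos; auto; now apply pow_le|].
        apply pow_incr; lra. }
    simpl pow. assert (Hp : 0 <= B * (q * Cmod z) ^ k) by
      (apply Rmult_le_pos; auto; now apply pow_le).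
    nra.
Qed.

(** The partial sums beyond the k-th stay within the sum of a geometric series of
    ratio at most 1/2. *)
Lemma power_series_tail (b : nat -> C) B q z l k :
  (forall n, Cmod (b n) <= B * q ^ n) -> 0 <= q -> q * Cmod z <= / 2 ->
  is_series (K := C_AbsRing) (V := C_NormedModule) (fun n => (b n * z ^ n)%C) l ->
  Cmod (l - psum b k z) <= 2 * B * (q * Cmod z) ^ k.
Proof.
  intros Hb Hq Hz Hs.
  assert (HB : 0 <= B). { generalize (Hb 0%nat) (Cmod_ge_0 (b 0%nat)); simpl; lra. }
  assert (Hx : 0 <= q * Cmod z) by (apply Rmult_le_pos; auto using Cmod_ge_0).
  apply (limit_in_disc _ l _ _ k Hs). intros n Hn.
  change (sum_n (G := NormedModule.AbelianMonoid _ C_NormedModule) (fun n => (b n * z ^ n)%C) n)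
    with (sum_n (G := C_AbelianMonoid) (fun n => (b n * z ^ n)%C) n).
  rewrite sum_n_psum. replace (S n) with (k + (S n - k))%nat by lia.
  eapply Rle_trans; [eapply psum_increment; eauto|].
  assert (Hp : 0 <= 2 * B * (q * Cmod z) ^ k) by
      (apply Rmult_le_pos; [lra|now apply pow_le]).
  assert (0 <= (/ 2) ^ (S n - k)) by (apply pow_le; lra). nra.
Qed.

Lemma series_terms_bounded (a : nat -> C) l :
  is_series (K := C_AbsRing) (V := C_NormedModule) a l -> exists B, forall n, Cmod (a n) <= B.
Proof.
  intros H. apply (proj1 (filterlim_C _ _)) with (e := 1) in H; [|lra].
  destruct H as [N HN].
  assert (H : forall n, (S N <= n)%nat -> Cmod (a n) <= 2).
  { intros n Hn. destruct n as [|n]; [lia|].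
    generalize (HN (S n) ltac:(lia)) (HN n ltac:(lia)). rewrite sum_Sn.
    set (s := sum_n a n : C). intros H1 H2.
    change (Cmod (s + a (S n) - l) < 1) in H1. change (Cmod (s - l) < 1) in H2.
    generalize (Cmod_triangle (s + a (S n) - l) (- (s - l))).
    rewrite Cmod_opp. replace (s + a (S n) - l + - (s - l))%C with (a (S n)) by ring. lra. }
  assert (H' : forall m, exists B, forall n, (n < m)%nat -> Cmod (a n) <= B).
  { induction m as [|m [B IH]]; [exists 0; lia|].
    exists (Rmax B (Cmod (a m))). intros n Hn.
    destruct (Nat.eq_dec n m) as [->|]; [apply Rmax_r|].
    eapply Rle_trans; [apply IH; lia|apply Rmax_l]. }
  destruct (H' (S N)) as [B HB]. exists (Rmax B 2). intros n.
  destruct (Nat.lt_ge_cases n (S N)).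
  - eapply Rle_trans; [apply HB; auto|apply Rmax_l].
  - eapply Rle_trans; [apply H; auto|apply Rmax_r].
Qed.

(** Convergence at one point r/2 bounds the coefficients geometrically, which controls
    all tails on a smaller disc. *)
Theorem holomorphic1_taylor g : holomorphic1_at g (RtoC 0) ->
  exists c : nat -> C, forall k, exists K d, 0 <= K /\ 0 < d /\
    forall t, Cmod t < d -> Cmod (g t - psum c k t) <= K * Cmod t ^ k.
Proof.
  intros (c & r & H). exists c. intros k.
  assert (Hr := cond_pos r).
  destruct (series_terms_bounded _ _ (H (RtoC (r / 2))
    ltac:(rewrite Cmod_R_nonneg; lra))) as [B HB].
  set (q := 2 / r).
  assert (Hq : 0 < q) by (apply Rdiv_lt_0_compat; lra).
  assert (Hb : forall n, Cmod (c n) <= B * q ^ n).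
  { intros n. specialize (HB n). rewrite Cmod_mult, Cmod_pow, Cmod_R_nonneg in HB by lra.
    assert (Hp : 0 < (r / 2) ^ n) by (apply pow_lt; lra).
    assert (E : (r / 2) ^ n * q ^ n = 1).
    { rewrite <- Rpow_mult_distr. replace (r / 2 * q) with 1 by (unfold q; field; lra).
      apply pow1. }
    assert (0 < q ^ n) by now apply pow_lt.
    replace (Cmod (c n)) with (Cmod (c n) * (r / 2) ^ n * q ^ n) by
      (rewrite Rmult_assoc, E; ring).
    apply Rmult_le_compat_r; lra. }
  assert (HB0 : 0 <= B). { generalize (Hb 0%nat) (Cmod_ge_0 (c 0%nat)); simpl; lra. }
  exists (2 * B * q ^ k), (Rmin r (/ (2 * q))).
  split; [apply Rmult_le_pos; [lra|apply pow_le; lra]|].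
  split; [apply Rmin_pos; auto; apply Rinv_0_lt_compat; lra|].
  intros t Ht.
  assert (H1 := Rmin_l r (/ (2 * q))). assert (H2 := Rmin_r r (/ (2 * q))).
  rewrite Rmult_assoc, <- Rpow_mult_distr.
  apply power_series_tail; auto; try lra.
  - replace (/ 2) with (q * (/ (2 * q))) by (field; lra).
    apply Rmult_le_compat_l; lra.
  - assert (Hs := H t ltac:(lra)). replace (RtoC 0 + t)%C with t in Hs by ring. exact Hs.
Qed.

(** * Complex curves *)

Lemma is_derive_of_taylor (g : C -> C) l K d :
  0 < d -> 0 <= K ->
  (forall t, Cmod t < d -> Cmod (g t - (g (RtoC 0) + l * t)) <= K * Cmod t ^ 2) ->
  is_derive (K := C_AbsRing) (V := C_NormedModule) g (RtoC 0) l.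
Proof.
  intros Hd HK H. split; [apply is_linear_scal_l|].
  intros x Hx. apply (is_filter_lim_locally_unique (V := AbsRing_NormedModule C_AbsRing)) in Hx.
  subst x. intros eps.
  assert (He := cond_pos eps).
  assert (Hm : 0 < Rmin d (eps / (K + 1))).
  { apply Rmin_pos; auto. apply Rdiv_lt_0_compat; lra. }
  exists (mkposreal _ Hm).
  cut (forall t : C, Cmod (t - RtoC 0) < Rmin d (eps / (K + 1)) ->
    Cmod (g t - g (RtoC 0) - (t - RtoC 0) * l) <= eps * Cmod (t - RtoC 0));
    [intros G; exact G|].
  intros t Ht. replace (t - RtoC 0)%C with t in Ht by ring.
  assert (H1 := Rmin_l d (eps / (K + 1))). assert (H2 := Rmin_r d (eps / (K + 1))).
  replace (g t - g (RtoC 0) - (t - RtoC 0) * l)%C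
    with (g t - (g (RtoC 0) + l * t))%C by ring.
  replace (t - RtoC 0)%C with t by ring.
  eapply Rle_trans; [apply H; lra|].
  assert (H3 := Cmod_ge_0 t).
  assert (K * Cmod t <= eps).
  { apply Rle_trans with ((K + 1) * (eps / (K + 1))).
    - apply Rmult_le_compat; lra.
    - right; field; lra. }
  simpl. nra.
Qed.

(** The first coefficients are the derivatives in the definition of a nonsingular
    curve, by uniqueness of the complex derivative. *)
Lemma curve_taylor p g1 g2 : complex_curve_at p g1 g2 ->
  exists c d : nat -> C,
    (forall k, exists K e, 0 <= K /\ 0 < e /\ forall t, Cmod t < e ->
       Cmod (g1 t - psum c k t) <= K * Cmod t ^ k /\
       Cmod (g2 t - psum d k t) <= K * Cmod t ^ k) /\
    (c 0%nat, d 0%nat) = p /\ (c 1%nat, d 1%nat) <> (RtoC 0, RtoC 0).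
Proof.
  assert (Haux : forall g, holomorphic1_at g (RtoC 0) -> exists c : nat -> C,
     (forall k, exists K e, 0 <= K /\ 0 < e /\ forall t, Cmod t < e ->
       Cmod (g t - psum c k t) <= K * Cmod t ^ k) /\ c 0%nat = g (RtoC 0) /\
     forall l, is_derive (K := C_AbsRing) (V := C_NormedModule) g (RtoC 0) l -> c 1%nat = l).
  { intros g Hg. destruct (holomorphic1_taylor g Hg) as [c Hc]. exists c.
    assert (E0 : c 0%nat = g (RtoC 0)).
    { destruct (Hc 1%nat) as (K & e & HK & He & H). specialize (H (RtoC 0)).
      rewrite Cmod_0 in H. specialize (H He). simpl in H.
      replace (g 0 - (0 + c 0%nat * 1))%C with (g (RtoC 0) - c 0%nat)%C in H by ring.
      replace (c 0%nat) with (g (RtoC 0) - (g (RtoC 0) - c 0%nat))%C by ring.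
      rewrite (Cmod_eq_0 (g (RtoC 0) - c 0%nat)%C). ring.
      generalize (Cmod_ge_0 (g (RtoC 0) - c 0%nat)%C). lra. }
    split; [exact Hc|split; [exact E0|]]. intros l Hl.
    apply is_C_derive_unique in Hl. rewrite <- Hl. symmetry. apply is_C_derive_unique.
    destruct (Hc 2%nat) as (K & e & HK & He & H).
    apply (is_derive_of_taylor _ _ K e); auto. intros t Ht.
    specialize (H t Ht). simpl psum in H. rewrite <- E0.
    replace (g t - (c 0%nat + c 1%nat * t))%C
      with (g t - (0 + c 0%nat * t ^ 0 + c 1%nat * t ^ 1))%C by (simpl; ring). exact H. }
  intros (H1 & H2 & Ep & l1 & l2 & D1 & D2 & Hl).
  destruct (Haux g1 H1) as (c & Hc & Ec & Dc), (Haux g2 H2) as (d & Hd & Ed & Dd).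
  exists c, d. split; [|split].
  - intros k. destruct (Hc k) as (K & e & HK & He & H), (Hd k) as (K' & e' & HK' & He' & H').
    exists (Rmax K K'), (Rmin e e').
    split; [eapply Rle_trans; [exact HK|apply Rmax_l]|].
    split; [now apply Rmin_pos|]. intros t Ht.
    assert (G1 := Rmin_l e e'). assert (G2 := Rmin_r e e').
    assert (G3 := Rmax_l K K'). assert (G4 := Rmax_r K K').
    assert (0 <= Cmod t ^ k) by (apply pow_le, Cmod_ge_0).
    split; (eapply Rle_trans; [first [apply H; lra | apply H'; lra]|]);
      apply Rmult_le_compat_r; auto.
  - now rewrite Ec, Ed.
  - now rewrite (Dc _ D1), (Dd _ D2).
Qed.

Lemma affine_holomorphic1 b l : holomorphic1_at (fun t => b + l * t)%C (RtoC 0).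
Proof.
  exists (fun n => match n with O => b | 1%nat => l | _ => RtoC 0 end), (mkposreal 1 Rlt_0_1).
  intros h _. apply filterlim_C. intros e He. exists 1%nat. intros n Hn.
  match goal with |- Cmod (?s - _) < _ => replace s with (b + l * (RtoC 0 + h))%C end.
  - replace (b + l * (0 + h) - (b + l * (0 + h)))%C with (RtoC 0) by ring. now rewrite Cmod_0.
  - symmetry. etransitivity; [apply sum_n_psum|].
    induction n as [|n IH]; [lia|]. destruct n as [|n].
    + simpl. ring.
    + transitivity (psum (fun n => match n with O => b | 1%nat => l | _ => RtoC 0 end)
        (S (S n)) h + RtoC 0 * h ^ S (S n))%C; [reflexivity|].
      rewrite IH by lia. ring.
Qed.

Lemma affine_curve p l : l <> (RtoC 0, RtoC 0) ->
  complex_curve_at p (fun t => fst p + fst l * t)%C (fun t => snd p + snd l * t)%C.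
Proof.
  intros Hl. split; [apply affine_holomorphic1|split; [apply affine_holomorphic1|]].
  split; [destruct p; simpl; f_equal; ring|].
  exists (fst l), (snd l). split; [|split; [|now destruct l]];
  apply (is_derive_of_taylor _ _ 0 1); try lra; intros t _;
  rewrite Rmult_0_l; match goal with |- Cmod ?x <= _ => replace x with (RtoC 0) by ring end;
  rewrite Cmod_0; lra.
Qed.

(** * The defining function along parabolas *)

Definition bform (c1 c2 c3 : C) (x y : C * C) : C :=
  (c1 * fst x * fst y + c2 * fst x * snd y + c3 * snd x * snd y)%C.

Definition conj2 (x : C * C) : C * C := (Cconj (fst x), Cconj (snd x)).

Definition scal2 (c : C) (x : C * C) : C * C := ((c * fst x)%C, (c * snd x)%C).

Lemma size2_conj x : size2 (conj2 x) = size2 x.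
Proof. unfold size2; simpl. now rewrite !Cmod_conj. Qed.

Lemma size2_scal c x : size2 (scal2 c x) = Cmod c * size2 x.
Proof. unfold size2; simpl. rewrite !Cmod_mult. ring. Qed.

Lemma size2_shift x y : size2 (shift x y) <= size2 x + size2 y.
Proof.
  unfold size2; simpl. generalize (Cmod_triangle (fst x) (fst y)) (Cmod_triangle (snd x) (snd y)).
  lra.
Qed.

Lemma bform_bound c1 c2 c3 x y :
  Cmod (bform c1 c2 c3 x y) <= (Cmod c1 + Cmod c2 + Cmod c3) * size2 x * size2 y.
Proof.
  unfold bform, size2.
  eapply Rle_trans; [apply Cmod_add_le; [apply Cmod_triangle|apply Rle_refl]|].
  rewrite !Cmod_mult.
  assert (H : forall a b c d e f : R, 0 <= a -> 0 <= b -> 0 <= c -> 0 <= d -> 0 <= e -> 0 <= f ->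
    a * b * c <= a * (b + d) * (c + e)).
  { intros a b c d e f Ha Hb Hc Hd He Hf. rewrite !Rmult_assoc.
    apply Rmult_le_compat_l; auto. apply Rmult_le_compat; lra. }
  generalize (Cmod_ge_0 c1) (Cmod_ge_0 c2) (Cmod_ge_0 c3) (Cmod_ge_0 (fst x))
    (Cmod_ge_0 (snd x)) (Cmod_ge_0 (fst y)) (Cmod_ge_0 (snd y)).
  generalize (Cmod c1) (Cmod c2) (Cmod c3) (Cmod (fst x)) (Cmod (snd x)) (Cmod (fst y))
    (Cmod (snd y)).
  intros a b c x1 x2 y1 y2 Ha Hb Hc Hx1 Hx2 Hy1 Hy2.
  generalize (H a x1 y1 x2 y2 0 Ha Hx1 Hy1 Hx2 Hy2 (Rle_refl 0))
    (H b x1 y2 x2 y1 0 Hb Hx1 Hy2 Hx2 Hy1 (Rle_refl 0))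
    (H c x2 y2 x1 y1 0 Hc Hx2 Hy2 Hx1 Hy1 (Rle_refl 0)). lra.
Qed.

(** Used both with g the identity and with g the conjugation, for the two parts of the
    Hessian. *)
Lemma quad_increment c1 c2 c3 (g : C * C -> C * C) :
  (forall x, size2 (g x) = size2 x) ->
  (forall t x y, g (shift (scal2 (RtoC t) x) y) = shift (scal2 (RtoC t) (g x)) (g y)) ->
  exists D, 0 <= D /\ forall t x s,
    Cmod (bform c1 c2 c3 (shift (scal2 (RtoC t) x) s) (g (shift (scal2 (RtoC t) x) s))
          - RtoC (t ^ 2) * bform c1 c2 c3 x (g x))
      <= D * (Rabs t * size2 x * size2 s + size2 s ^ 2).
Proof.
  intros Hg Hl. set (D := Cmod c1 + Cmod c2 + Cmod c3).
  assert (HD : 0 <= D) by (unfold D; generalize (Cmod_ge_0 c1) (Cmod_ge_0 c2) (Cmod_ge_0 c3); lra).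
  exists (2 * D). split; [lra|]. intros t x s. rewrite Hl.
  match goal with |- Cmod ?e <= _ => replace e with
    (RtoC t * bform c1 c2 c3 x (g s) + RtoC t * bform c1 c2 c3 s (g x)
     + bform c1 c2 c3 s (g s))%C end.
  2: { rewrite RtoC_pow. unfold bform, shift, scal2; simpl. ring. }
  eapply Rle_trans; [apply Cmod_add_le; [apply Cmod_triangle|apply bform_bound]|].
  rewrite !Cmod_mult, Cmod_R.
  assert (H1 := bform_bound c1 c2 c3 x (g s)). assert (H2 := bform_bound c1 c2 c3 s (g x)).
  rewrite Hg in H1, H2. rewrite Hg. fold D. fold D in H1, H2.
  assert (Ht := Rabs_pos t).
  apply (Rmult_le_compat_l _ _ _ Ht) in H1. apply (Rmult_le_compat_l _ _ _ Ht) in H2.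
  assert (0 <= D * size2 s ^ 2) by pos.
  simpl in *. lra.
Qed.

Definition rho_quad (a : R) (p h : C * C) : R := Re (hess_hol a p h) + levi a p h.

Lemma Cconj_R t : Cconj (RtoC t) = RtoC t.
Proof. unfold Cconj, RtoC; simpl. now rewrite Ropp_0. Qed.

Lemma rho_quad_increment a p : exists D, 0 <= D /\ forall t x s,
  Rabs (rho_quad a p (shift (scal2 (RtoC t) x) s) - t ^ 2 * rho_quad a p x)
    <= D * (Rabs t * size2 x * size2 s + size2 s ^ 2).
Proof.
  set (z := fst p). set (u := Re (snd p)).
  destruct (quad_increment (Fzz a z u) (Fzu a z u) (RtoC (Fuu a z u / 4)) (fun x => x))
    as (D & HD & H); auto.
  destruct (quad_increment (RtoC (Fzzb a z u)) (Fzu a z u) (RtoC (Fuu a z u / 4)) conj2)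
    as (D' & HD' & H').
  { intros x; apply size2_conj. }
  { intros t x y. unfold conj2, shift, scal2; simpl.
    now rewrite !Cplus_conj, !Cmult_conj, !Cconj_R. }
  assert (E : forall h, rho_quad a p h
    = Re (bform (Fzz a z u) (Fzu a z u) (RtoC (Fuu a z u / 4)) h h)
      + Re (bform (RtoC (Fzzb a z u)) (Fzu a z u) (RtoC (Fuu a z u / 4)) h (conj2 h))).
  { intros h. unfold rho_quad, hess_hol, levi, bform. cbv zeta. fold z u.
    rewrite !Cmod_pow2.
    generalize (Fzz a z u) (Fzzb a z u) (Fzu a z u) (Fuu a z u / 4).
    intros [a1 a2] b [d1 d2] f. destruct h as [[h1 h2] [h3 h4]].
    unfold conj2, Re; simpl. ring. }
  exists (D + D'). split; [lra|]. intros t x s. rewrite !E.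
  specialize (H t x s). specialize (H' t x s).
  set (X := bform _ _ _ _ _) in H. set (Y := bform _ _ _ _ _) in H at 1.
  set (X' := bform _ _ _ _ _) in H'. set (Y' := bform _ _ _ _ _) in H' at 1.
  fold X Y X' Y'.
  assert (G := re_le_Cmod (X - RtoC (t ^ 2) * Y)%C).
  assert (G' := re_le_Cmod (X' - RtoC (t ^ 2) * Y')%C).
  assert (R1 : forall A B : C, Re (A - RtoC (t ^ 2) * B)%C = Re A - t ^ 2 * Re B).
  { intros [? ?] [? ?]. unfold Re; simpl; ring. }
  rewrite R1 in G, G'.
  replace (Re X + Re X' - t ^ 2 * (Re Y + Re Y'))
    with ((Re X - t ^ 2 * Re Y) + (Re X' - t ^ 2 * Re Y')) by ring.
  eapply Rle_trans; [apply Rabs_triang|]. lra.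
Qed.

Lemma drho_bound a p : exists D, 0 <= D /\ forall h, Cmod (drho a p h) <= D * size2 h.
Proof.
  exists (2 * (Cmod (rho_z a p) + Cmod (rho_w a p))).
  assert (H1 := Cmod_ge_0 (rho_z a p)). assert (H2 := Cmod_ge_0 (rho_w a p)).
  split; [lra|]. intros h. unfold drho, size2.
  rewrite Cmod_mult, Cmod_R_nonneg by lra. rewrite Rmult_assoc.
  apply Rmult_le_compat_l; [lra|].
  eapply Rle_trans; [apply Cmod_triangle|]. rewrite !Cmod_mult.
  generalize (Cmod_ge_0 (fst h)) (Cmod_ge_0 (snd h)). nra.
Qed.

Lemma drho_shift a p x y : drho a p (shift x y) = (drho a p x + drho a p y)%C.
Proof. unfold drho, shift; simpl. ring. Qed.

Lemma drho_scal a p c x : drho a p (scal2 c x) = (c * drho a p x)%C.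
Proof. unfold drho, scal2; simpl. ring. Qed.

(** The curve t x + t^2 y; y adjusts the second order while the direction x is fixed. *)
Definition parabola (t : R) (x y : C * C) : C * C :=
  shift (scal2 (RtoC t) x) (scal2 (RtoC (t ^ 2)) y).

(** The second order coefficient along a curve tangent to x is the Hessian at x plus
    the differential at y, half the second derivative of the curve. *)
Theorem rho_along_curve a p x y K0 : 0 <= K0 ->
  exists K d, 0 <= K /\ 0 < d /\ forall t e, 0 < t < d -> size2 e <= K0 * t ^ 3 ->
    Rabs (rho_M a (shift p (shift (parabola t x y) e)) - rho_M a p - t * Re (drho a p x)
          - t ^ 2 * (Re (drho a p y) + rho_quad a p x)) <= K * t ^ 3.
Proof.
  intros HK0.
  destruct (rho_taylor a p) as (K1 & HK1 & H1).
  destruct (rho_quad_increment a p) as (D & HD & HQ).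
  destruct (drho_bound a p) as (D1 & HD1 & HL).
  set (X := size2 x). set (Y := size2 y).
  assert (HX : 0 <= X) by pos. assert (HY : 0 <= Y) by pos.
  set (S := X + Y + K0). set (T := Y + K0).
  exists (K1 * S ^ 3 + D1 * K0 + D * (X * T + T ^ 2)), (/ (1 + S)).
  assert (HS : 0 <= S) by (unfold S; lra). assert (HT : 0 <= T) by (unfold T; lra).
  split; [|split].
  - assert (0 <= K1 * S ^ 3) by pos.
    assert (0 <= D1 * K0) by pos.
    assert (0 <= D * (X * T + T ^ 2)) by pos. lra.
  - apply Rinv_0_lt_compat; lra.
  - intros t e [Ht Htd] He.
    assert (HtS : t * (1 + S) <= 1).
    { apply Rle_trans with (/ (1 + S) * (1 + S)); [|right; field; lra].
      apply Rmult_le_compat_r; lra. }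
    assert (Ht2 : 0 < t ^ 2 <= t) by nra.
    assert (Ht3 : 0 < t ^ 3 <= t ^ 2) by nra.
    set (s := shift (scal2 (RtoC (t ^ 2)) y) e).
    assert (Eh : shift (parabola t x y) e = shift (scal2 (RtoC t) x) s).
    { unfold s, parabola, shift, scal2; simpl; f_equal; ring. }
    assert (Hs : size2 s <= T * t ^ 2).
    { unfold s. eapply Rle_trans; [apply size2_shift|].
      rewrite size2_scal, Cmod_R_nonneg by lra. fold Y. unfold T.
      assert (K0 * t ^ 3 <= K0 * t ^ 2) by nra. lra. }
    rewrite Eh. set (h := shift (scal2 (RtoC t) x) s).
    assert (Hh : size2 h <= S * t).
    { unfold h. eapply Rle_trans; [apply size2_shift|].
      rewrite size2_scal, Cmod_R_nonneg by lra. fold X.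
      assert (T * t ^ 2 <= T * t) by nra. unfold S, T in *. lra. }
    destruct (H1 h ltac:(nra)) as (_ & _ & H). fold (shift p h) in H. fold (rho_quad a p h) in H.
    assert (Q := HQ t x s). fold h X in Q. rewrite (Rabs_pos_eq t) in Q by lra.
    assert (Ed : Re (drho a p h) = t * Re (drho a p x) + t ^ 2 * Re (drho a p y)
      + Re (drho a p e)).
    { unfold h, s. rewrite !drho_shift, !drho_scal.
      generalize (drho a p x) (drho a p y) (drho a p e). intros [? ?] [? ?] [? ?].
      unfold Re; simpl; ring. }
    assert (He' : Rabs (Re (drho a p e)) <= D1 * K0 * t ^ 3).
    { eapply Rle_trans; [apply re_le_Cmod|]. eapply Rle_trans; [apply HL|].
      rewrite Rmult_assoc. apply Rmult_le_compat_l; auto. }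
    replace (rho_M a (shift p h) - rho_M a p - t * Re (drho a p x)
      - t ^ 2 * (Re (drho a p y) + rho_quad a p x))
      with ((rho_M a (shift p h) - rho_M a p - Re (drho a p h) - rho_quad a p h)
        + (Re (drho a p e) + (rho_quad a p h - t ^ 2 * rho_quad a p x))) by pos.
    eapply Rle_trans; [apply Rabs_triang|].
    assert (G1 : K1 * size2 h ^ 3 <= K1 * S ^ 3 * t ^ 3).
    { rewrite Rmult_assoc, <- Rpow_mult_distr. apply Rmult_le_compat_l; auto.
      apply pow_incr. split; [apply size2_ge0|auto]. }
    assert (G2 : D * (t * X * size2 s + size2 s ^ 2) <= D * (X * T + T ^ 2) * t ^ 3).
    { rewrite (Rmult_assoc D). apply Rmult_le_compat_l; auto.
      assert (t * X * size2 s <= t * X * (T * t ^ 2)) by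
        (apply Rmult_le_compat_l; auto; apply Rmult_le_pos; lra).
      assert (size2 s ^ 2 <= (T * t ^ 2) ^ 2) by
        (apply pow_incr; split; [apply size2_ge0|auto]).
      assert ((T * t ^ 2) ^ 2 <= T ^ 2 * t ^ 3) by nra.
      replace ((X * T + T ^ 2) * t ^ 3) with (t * X * (T * t ^ 2) + T ^ 2 * t ^ 3) by ring.
      lra. }
    generalize (Rabs_triang (Re (drho a p e)) (rho_quad a p h - t ^ 2 * rho_quad a p x)).
    intros G3. rewrite !Rmult_plus_distr_r. lra.
Qed.

Lemma zero_of_linear_bound X L e :
  0 < e -> 0 <= L -> (forall t, 0 < t < e -> Rabs X <= L * t) -> X = 0.
Proof.
  intros He HL HX. destruct (Req_dec X 0) as [|N]; auto. exfalso.
  assert (HN := Rabs_pos_lt X N).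
  set (t := Rmin (e / 2) (Rabs X / (2 * (L + 1)))).
  assert (T0 : 0 < t).
  { unfold t; apply Rmin_pos; [lra|]. apply Rdiv_lt_0_compat; lra. }
  assert (T1 : t <= e / 2) by apply Rmin_l.
  assert (T2 : t <= Rabs X / (2 * (L + 1))) by apply Rmin_r.
  specialize (HX t ltac:(lra)).
  assert ((L + 1) * t <= (L + 1) * (Rabs X / (2 * (L + 1)))) by nra.
  replace ((L + 1) * (Rabs X / (2 * (L + 1)))) with (Rabs X / 2) in * by (field; lra).
  nra.
Qed.

Lemma small_coefficients A B K d : 0 < d -> 0 <= K ->
  (forall t, 0 < t < d -> Rabs (t * A + t ^ 2 * B) <= K * t ^ 3) -> A = 0 /\ B = 0.
Proof.
  intros Hd HK H.
  assert (HA : A = 0).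
  { apply (zero_of_linear_bound A (Rabs B + K) (Rmin d 1)).
    - apply Rmin_pos; lra.
    - generalize (Rabs_pos B); lra.
    - intros t [Ht Htd]. assert (M1 := Rmin_l d 1). assert (M2 := Rmin_r d 1).
      specialize (H t ltac:(lra)).
      apply Rmult_le_reg_l with t; auto.
      replace (t * Rabs A) with (Rabs (t * A)) by (rewrite Rabs_mult, (Rabs_pos_eq t); lra).
      replace (t * A) with ((t * A + t ^ 2 * B) + - (t ^ 2 * B)) by ring.
      eapply Rle_trans; [apply Rabs_triang|]. rewrite Rabs_Ropp, Rabs_mult.
      rewrite (Rabs_pos_eq (t ^ 2)) by pos.
      assert (t ^ 3 <= t ^ 2) by nra.
      assert (K * t ^ 3 <= K * t ^ 2) by nra.
      replace (t * ((Rabs B + K) * t)) with (t ^ 2 * Rabs B + K * t ^ 2) by ring. lra. }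
  split; auto. apply (zero_of_linear_bound B K d); auto.
  intros t Ht. specialize (H t Ht). rewrite HA in H.
  replace (t * 0 + t ^ 2 * B) with (t ^ 2 * B) in H by ring.
  rewrite Rabs_mult, (Rabs_pos_eq (t ^ 2)) in H by pos.
  apply Rmult_le_reg_l with (t ^ 2); [apply pow_lt; lra|].
  replace (t ^ 2 * (K * t)) with (K * t ^ 3) by ring. auto.
Qed.

(** Multiplication by i changes the sign of A and preserves the Levi form. *)
Lemma rho_quad_rotate a p x :
  rho_quad a p x + rho_quad a p (scal2 Ci x) = 2 * levi a p x.
Proof.
  unfold rho_quad, hess_hol, levi. cbv zeta. rewrite !Cmod_pow2.
  generalize (Fzz a (fst p) (Re (snd p))) (Fzzb a (fst p) (Re (snd p)))
    (Fzu a (fst p) (Re (snd p))) (Fuu a (fst p) (Re (snd p)) / 4).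
  intros [a1 a2] b [d1 d2] f. destruct x as [[h1 h2] [h3 h4]].
  unfold Re; simpl. ring.
Qed.

(** * Type two at strongly pseudoconvex points *)

Lemma levi_tangent a p x : drho a p x = RtoC 0 ->
  levi a p x = Cmod (fst x) ^ 2 * levi a p (RtoC 1, tangent_slope a p).
Proof.
  intros H. apply tangent_slope_spec in H. rewrite <- levi_scal, <- H. now destruct x.
Qed.

(** A complex tangent line has contact two. If a curve had contact three, the expansions
    along t and it would give first that its direction is tangent, then that the Levi
    form vanishes on it. *)
Theorem finite_type_2 a p : rho_M a p = 0 -> 0 < levi a p (RtoC 1, tangent_slope a p) ->
  finite_type (rho_M a) p 2.
Proof.
  intros Hp HL. split.
  - set (l := (RtoC 1, tangent_slope a p)).
    exists (fun t => fst p + fst l * t)%C, (fun t => snd p + snd l * t)%C. split.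
    { apply affine_curve. unfold l. intros E. injection E. lra. }
    destruct (rho_taylor a p) as (K & HK & H).
    set (S := size2 l). assert (HS : 0 <= S) by apply size2_ge0.
    exists (2 * K * S ^ 2), (/ (1 + S)).
    split; [apply Rinv_0_lt_compat; lra|]. intros t Ht.
    assert (HtS : Cmod t * (1 + S) <= 1).
    { apply Rle_trans with (/ (1 + S) * (1 + S)); [|right; field; lra].
      apply Rmult_le_compat_r; lra. }
    assert (T0 := Cmod_ge_0 t).
    assert (Hn : size2 (scal2 t l) = Cmod t * S) by apply size2_scal.
    destruct (H (scal2 t l) ltac:(nra)) as (_ & H2 & H3).
    rewrite drho_scal in H3.
    replace (drho a p l) with (RtoC 0) in H3.
    2: { symmetry; apply tangent_slope_spec. unfold l; simpl. ring. }
    rewrite Hp in H3. replace (Re (t * 0)%C) with 0 in H3 by (unfold Re; simpl; ring).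
    rewrite Hn in H2, H3.
    replace ((fst p + fst l * t)%C, (snd p + snd l * t)%C)
      with ((fst p + fst (scal2 t l))%C, (snd p + snd (scal2 t l))%C)
      by (unfold scal2; simpl; f_equal; ring).
    set (X := rho_M _ _) in *. set (q := Re _ + levi _ _ _) in *.
    assert (E : (Cmod t * S) ^ 3 <= (Cmod t * S) ^ 2).
    { assert (0 <= Cmod t * S <= 1) by nra.
      assert (0 <= (Cmod t * S) ^ 2) by (apply pow_le; lra).
      replace ((Cmod t * S) ^ 3) with ((Cmod t * S) * (Cmod t * S) ^ 2) by ring. nra. }
    apply (Rmult_le_compat_l K) in E; auto.
    replace (2 * K * S ^ 2 * Cmod t ^ 2) with (2 * (K * (Cmod t * S) ^ 2)) by ring.
    apply Rabs_le_between in H2, H3. apply Rabs_le_between. lra.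
  - intros g1 g2 Hc (K & d & Hd & HK).
    destruct (curve_taylor _ _ _ Hc) as (b & c & Ht & E0 & E1).
    destruct (Ht 3%nat) as (K' & d' & HK' & Hd' & H).
    set (x := (b 1%nat, c 1%nat)) in *. set (y := (b 2%nat, c 2%nat)).
    assert (Hw : forall w, Cmod w = 1 -> Re (drho a p (scal2 w x)) = 0 /\
       Re (drho a p (scal2 (w ^ 2) y)) + rho_quad a p (scal2 w x) = 0).
    { intros w Hw.
      destruct (rho_along_curve a p (scal2 w x) (scal2 (w ^ 2) y) (2 * K'))
        as (L & e & HL' & He & HH); [lra|].
      apply (small_coefficients _ _ (L + Rabs K) (Rmin (Rmin d d') e)).
      { repeat apply Rmin_pos; auto. }
      { generalize (Rabs_pos K); lra. }
      intros t [T0 T1].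
      assert (M1 := Rmin_l (Rmin d d') e). assert (M2 := Rmin_r (Rmin d d') e).
      assert (M3 := Rmin_l d d'). assert (M4 := Rmin_r d d').
      assert (Hm : Cmod (RtoC t * w) = t) by
        (rewrite Cmod_mult, Hw, Cmod_R_nonneg; lra).
      specialize (HK (RtoC t * w)%C ltac:(lra)). destruct (H (RtoC t * w)%C ltac:(lra)) as (G1 & G2).
      rewrite Hm in HK, G1, G2.
      set (k := parabola t (scal2 w x) (scal2 (w ^ 2) y)).
      set (e' := ((g1 (RtoC t * w) - fst p - fst k)%C, (g2 (RtoC t * w) - snd p - snd k)%C)).
      specialize (HH t e' ltac:(lra)).
      replace (shift p (shift (parabola t (scal2 w x) (scal2 (w ^ 2) y)) e'))
        with (g1 (RtoC t * w)%C, g2 (RtoC t * w)%C) in HH.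
      2: { fold k. unfold shift, e'; simpl. f_equal; ring. }
      rewrite Hp in HH.
      assert (He' : size2 e' <= 2 * K' * t ^ 3).
      { unfold size2, e', k, parabola, shift, scal2, x, y. cbn [fst snd].
        rewrite <- E0. cbn [fst snd]. rewrite !RtoC_pow.
        eapply Rle_trans; [apply Rplus_le_compat|].
        3: { right. instantiate (1 := K' * t ^ 3). instantiate (1 := K' * t ^ 3). ring. }
        - eapply Rle_trans; [|exact G1]. right. f_equal. simpl. ring.
        - eapply Rle_trans; [|exact G2]. right. f_equal. simpl. ring. }
      specialize (HH He').
      assert (K * t ^ 3 <= Rabs K * t ^ 3) by
        (apply Rmult_le_compat_r; [apply pow_le; lra|apply Rle_abs]).
      rewrite Rmult_plus_distr_r.
      apply Rabs_le_between in HH, HK. apply Rabs_le_between. lra. }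
    destruct (Hw (RtoC 1) Cmod_1) as [A1 A2]. destruct (Hw Ci Cmod_Ci) as [B1 B2].
    replace (scal2 1 x) with x in A1, A2
      by (unfold x, scal2; simpl; f_equal; ring).
    assert (Hx : drho a p x = RtoC 0).
    { rewrite drho_scal in B1. revert A1 B1. generalize (drho a p x).
      intros [c1 c2]. unfold Re; simpl. intros A1 B1.
      apply injective_projections; simpl; lra. }
    assert (HLx : levi a p x = 0).
    { assert (R1 := rho_quad_rotate a p x).
      replace (scal2 (1 ^ 2) y) with y in A2 by (unfold y, scal2; simpl; f_equal; ring).
      rewrite drho_scal in B2. replace (Ci ^ 2)%C with (RtoC (-1)) in B2.
      2: { apply injective_projections; simpl; ring. }
      replace (Re (RtoC (-1) * drho a p y)%C) with (- Re (drho a p y)) in B2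
        by (generalize (drho a p y); intros [? ?]; unfold Re; simpl; ring). lra. }
    apply E1. apply tangent_slope_spec in Hx as Hx'.
    rewrite (levi_tangent _ _ _ Hx) in HLx.
    assert (Hb : b 1%nat = RtoC 0).
    { apply Cmod_eq_0. unfold x in HLx; simpl fst in HLx.
      destruct (Req_dec (Cmod (b 1%nat)) 0) as [|N]; auto.
      apply pow_nonzero with (n := 2%nat) in N. apply Rmult_integral in HLx. lra. }
    unfold x in *. simpl in Hx'. rewrite Hx', Hb. f_equal. ring.
Qed.

(** * Type eight at the origin *)

Lemma exists_eighth_root : exists w : C, Cmod w = 1 /\ (w ^ 8)%C = RtoC (-1).
Proof.
  assert (Hm : forall x n, (((cos x, sin x) : C) ^ n)%C = (cos (INR n * x), sin (INR n * x))).
  { intros x n. induction n as [|n IH].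
    - simpl. rewrite Rmult_0_l, cos_0, sin_0. reflexivity.
    - rewrite Cpow_S, IH, S_INR.
      replace ((INR n + 1) * x) with (x + INR n * x) by ring.
      rewrite cos_plus, sin_plus. apply injective_projections; simpl; ring. }
  exists (cos (PI / 8), sin (PI / 8)). split.
  - unfold Cmod. cbn [fst snd]. generalize (sin2_cos2 (PI / 8)). unfold Rsqr. intros E.
    replace (cos (PI / 8) ^ 2 + sin (PI / 8) ^ 2) with 1 by pos. apply sqrt_1.
  - rewrite Hm. replace (INR 8 * (PI / 8)) with PI by (simpl; field).
    rewrite cos_PI, sin_PI. reflexivity.
Qed.

Fixpoint csum (n : nat) (f : nat -> C) : C :=
  match n with O => RtoC 0 | S n => (csum n f + f n)%C end.

Lemma csum_add n f g : csum n (fun k => f k + g k)%C = (csum n f + csum n g)%C.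
Proof. induction n as [|n IH]; simpl; [ring|rewrite IH; ring]. Qed.

Lemma csum_scal n c f : csum n (fun k => c * f k)%C = (c * csum n f)%C.
Proof. induction n as [|n IH]; simpl; [ring|rewrite IH; ring]. Qed.

Lemma csum_ext n f g : (forall k, f k = g k) -> csum n f = csum n g.
Proof. intros H. induction n as [|n IH]; simpl; [|rewrite IH, H]; auto. Qed.

(** The sum over the 16 powers is (1+x)(1+x^2)(1+x^4)(1+x^8) with x = w^n, and one of the
    factors vanishes for each n between 1 and 8. *)
Lemma root_sum (w : C) n : (w ^ 8)%C = RtoC (-1) -> (1 <= n <= 8)%nat ->
  csum 16 (fun k => (w ^ n) ^ k)%C = RtoC 0.
Proof.
  intros Hw Hn. set (x := (w ^ n)%C).
  replace (csum 16 (fun k => x ^ k)%C)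
    with ((1 + x) * (1 + x ^ 2) * (1 + x ^ 4) * (1 + x ^ 8))%C by (simpl; ring).
  assert (H : (x ^ 8 = RtoC (-1) \/ x ^ 4 = RtoC (-1) \/ x ^ 2 = RtoC (-1) \/ x = RtoC (-1))%C).
  { unfold x. rewrite <- !Cpow_mult_r.
    assert (P : forall m, (w ^ (8 * m) = RtoC (-1) ^ m)%C) by (intros; now rewrite Cpow_mult_r, Hw).
    assert (E1 : (RtoC (-1) ^ 1 = RtoC (-1))%C) by (simpl; ring).
    assert (E3 : (RtoC (-1) ^ 3 = RtoC (-1))%C) by
      (simpl; apply injective_projections; simpl; ring).
    assert (E5 : (RtoC (-1) ^ 5 = RtoC (-1))%C) by
      (simpl; apply injective_projections; simpl; ring).
    assert (E7 : (RtoC (-1) ^ 7 = RtoC (-1))%C) by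
      (simpl; apply injective_projections; simpl; ring).
    assert (C : (n = 1 \/ n = 2 \/ n = 3 \/ n = 4 \/ n = 5 \/ n = 6 \/ n = 7 \/ n = 8)%nat) by lia.
    destruct C as [->|[->|[->|[->|[->|[->|[->| ->]]]]]]].
    - left. exact (eq_trans (P 1%nat) E1).
    - right; left. exact (eq_trans (P 1%nat) E1).
    - left. exact (eq_trans (P 3%nat) E3).
    - right; right; left. exact (eq_trans (P 1%nat) E1).
    - left. exact (eq_trans (P 5%nat) E5).
    - right; left. exact (eq_trans (P 3%nat) E3).
    - left. exact (eq_trans (P 7%nat) E7).
    - right; right; right. exact (eq_trans (P 1%nat) E1). }
  assert (E : (1 + RtoC (-1) = 0)%C) by (apply injective_projections; simpl; ring).
  destruct H as [->|[->|[->| ->]]]; rewrite E; ring.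
Qed.

(** The mean over the sixteenth roots of unity kills the powers 1 to 8, so the
    imaginary part cannot be positive at all of them. *)
Lemma exists_nonpos_on_circle (d : nat -> C) s : d 0%nat = RtoC 0 ->
  exists w, Cmod w = 1 /\ Im (psum d 9 (w * s)) <= 0.
Proof.
  intros H0. destruct exists_eighth_root as (w & Hw & H8).
  assert (H : forall m, (1 <= m <= 9)%nat -> csum 16 (fun k => psum d m (w ^ k * s)) = RtoC 0).
  { induction m as [|m IH]; [lia|]. intros Hm. destruct m as [|m].
    - simpl. rewrite H0. ring.
    - rewrite (csum_ext _ _ (fun k => psum d (S m) (w ^ k * s)
        + (d (S m) * s ^ S m) * (w ^ S m) ^ k)%C).
      + rewrite csum_add, IH, csum_scal, root_sum by (auto; lia). ring.
      + intros k. change (psum d (S (S m)) (w ^ k * s)) with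
          (psum d (S m) (w ^ k * s) + d (S m) * (w ^ k * s) ^ S m)%C.
        rewrite Cpow_mult_l, <- !(Cpow_mult_r w), Nat.mul_comm. ring. }
  specialize (H 9%nat ltac:(lia)).
  assert (P : forall n f, (forall k, 0 < Im (f k)) -> (0 < n)%nat -> 0 < Im (csum n f)).
  { intros n f Hf. induction n as [|n IH]; [lia|]. intros _. simpl.
    replace (Im (csum n f + f n)) with (Im (csum n f) + Im (f n)) by reflexivity.
    specialize (Hf n). destruct n as [|n]; [change (0 < 0 + Im (f 0%nat)); lra|].
    specialize (IH ltac:(lia)). exact (Rplus_lt_0_compat _ _ IH Hf). }
  destruct (Classical_Prop.classic (exists w, Cmod w = 1 /\ Im (psum d 9 (w * s)) <= 0)) as [|N]; auto.
  exfalso. assert (Hp : 0 < Im (csum 16 (fun k => psum d 9 (w ^ k * s)%C))).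
  { apply P; [|lia]. intros k. apply Rnot_le_lt. intros Hk. apply N.
    exists (w ^ k)%C. split; auto. now rewrite Cmod_pow, Hw, pow1. }
  rewrite H in Hp. unfold Im in Hp; simpl in Hp. lra.
Qed.

Lemma F_le_pow a z u : 0 <= a <= 2 -> Cmod z <= 1 -> Rabs u <= 1 ->
  Rabs (F a z u - Cmod z ^ 8) <= 4 * Cmod z ^ 2 * u ^ 2.
Proof.
  intros Ha Hz Hu. unfold F.
  replace (Cmod z ^ 8 + (Cmod z ^ 6 + a * Cmod z ^ 2 * Re (z ^ 4)%C) * u ^ 2
     + Cmod z ^ 2 * u ^ 8 - Cmod z ^ 8)
    with (Cmod z ^ 2 * u ^ 2 * (Cmod z ^ 4 + a * Re (z ^ 4)%C + u ^ 6)) by ring.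
  generalize (Re_pow4_le z). generalize (Re (z ^ 4)%C). intros q Hq.
  apply Rabs_le_between in Hq.
  assert (H2 := pow_le1 _ 2 (conj (Cmod_ge_0 z) Hz)). assert (E : forall n, 0 <= u ^ (2 * n) <= 1).
  { intros n. assert (E := pow_even_ge0 u n). split; auto.
    rewrite <- (Rabs_pos_eq (u ^ _)), <- RPow_abs by auto.
    now apply pow_le1; split; [apply Rabs_pos|]. }
  assert (E6 := E 3%nat). simpl Nat.mul in *.
  assert (H0 : 0 <= Cmod z ^ 2 * u ^ 2) by nra.
  rewrite Rabs_mult, (Rabs_pos_eq (_ * _)) by auto.
  replace (4 * Cmod z ^ 2 * u ^ 2) with (Cmod z ^ 2 * u ^ 2 * 4) by ring.
  apply Rmult_le_compat_l; auto. apply Rabs_le_between. split; nra.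
Qed.

Lemma F_bound a z u : 0 <= a <= 2 -> Cmod z <= 1 -> Rabs u <= 1 ->
  Rabs (F a z u) <= 5 * Cmod z ^ 2.
Proof.
  intros Ha Hz Hu. assert (H := F_le_pow a z u Ha Hz Hu).
  assert (H6 := pow_le1 _ 6 (conj (Cmod_ge_0 z) Hz)).
  assert (u ^ 2 <= 1).
  { rewrite <- (Rabs_pos_eq (u ^ 2)), <- RPow_abs by apply (pow_even_ge0 u 1).
    now apply pow_le1; split; [apply Rabs_pos|]. }
  assert (Cmod z ^ 8 <= Cmod z ^ 2) by nra.
  assert (0 <= Cmod z ^ 8) by pos.
  assert (4 * Cmod z ^ 2 * u ^ 2 <= 4 * Cmod z ^ 2) by nra.
  apply Rabs_le_between in H. apply Rabs_le_between. lra.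
Qed.

(** The extreme case is a = 2, Re z^4 = - |z|^4. *)
Lemma F_lower a z u : 0 <= a <= 2 -> Cmod z ^ 6 * (Cmod z ^ 2 - u ^ 2) <= F a z u.
Proof.
  intros Ha. unfold F.
  generalize (Re_pow4_le z). generalize (Re (z ^ 4)%C). intros q Hq.
  apply Rabs_le_between in Hq.
  assert (r2 : 0 <= Cmod z ^ 2) by (apply pow_le, Cmod_ge_0).
  assert (r4 : 0 <= Cmod z ^ 4) by (apply pow_le, Cmod_ge_0).
  assert (u2 := pow_even_ge0 u 1). assert (u8 := pow_even_ge0 u 4). simpl Nat.mul in *.
  assert (0 <= Cmod z ^ 2 * u ^ 8) by now apply Rmult_le_pos.
  assert (- (2 * Cmod z ^ 4) <= a * q) by nra.
  assert (E : 0 <= Cmod z ^ 2 * u ^ 2 * (a * q + 2 * Cmod z ^ 4)) by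
    (apply Rmult_le_pos; [apply Rmult_le_pos; auto|lra]).
  replace (Cmod z ^ 8) with (Cmod z ^ 6 * Cmod z ^ 2) by ring.
  replace (Cmod z ^ 6) with (Cmod z ^ 2 * Cmod z ^ 4) by ring. lra.
Qed.

(** If a curve (g1, g2) had contact nine, then Im g2 = O(t^2) on every ray forces
    g2'(0) = 0, so that |g1| is comparable to |t|, u = O(t^2), and F is at least a multiple
    of |t|^8 along the curve. This contradicts the sign of Im g2 at a suitable point of
    each circle. *)
Theorem finite_type_8 a : 0 <= a <= 2 -> finite_type (rho_M a) origin 8.
Proof.
  intros Ha. split.
  - exists (fun t => RtoC 0 + RtoC 1 * t)%C, (fun t => RtoC 0 + RtoC 0 * t)%C. split.
    + apply (affine_curve origin (RtoC 1, RtoC 0)). intros E; injection E; lra.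
    + exists 1, 1. split; [lra|]. intros t _. unfold rho_M. cbn [fst snd].
      replace (0 + 1 * t)%C with t by ring.
      replace (0 + 0 * t)%C with (RtoC 0) by ring. unfold F. simpl Re; simpl Im.
      match goal with |- Rabs ?x <= _ => replace x with (Cmod t ^ 8) by ring end.
      rewrite Rabs_pos_eq; [lra|apply pow_le, Cmod_ge_0].
  - intros g1 g2 Hc (K0 & e0 & He0 & HF).
    destruct (curve_taylor _ _ _ Hc) as (c & d & Ht & E0 & E1).
    injection E0 as Ec0 Ed0. change (c 0%nat = RtoC 0) in Ec0. change (d 0%nat = RtoC 0) in Ed0.
    destruct (Ht 2%nat) as (K & e & HK & He & H2).
    assert (P2 : forall b : nat -> C, b 0%nat = RtoC 0 ->
      forall t, psum b 2 t = (b 1%nat * t)%C).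
    { intros b Hb t. simpl. rewrite Hb. ring. }
    set (S := Cmod (c 1%nat) + Cmod (d 1%nat) + K).
    assert (C1 := Cmod_ge_0 (c 1%nat)). assert (D1 := Cmod_ge_0 (d 1%nat)).
    assert (HS : 0 <= S) by (unfold S; lra).
    set (m := Rmin (Rmin e0 e) (/ (1 + S))).
    assert (Hm : 0 < m).
    { unfold m. repeat apply Rmin_pos; auto. apply Rinv_0_lt_compat; lra. }
    assert (M1 : m <= e0) by (unfold m; eapply Rle_trans; [apply Rmin_l|apply Rmin_l]).
    assert (M2 : m <= e) by (unfold m; eapply Rle_trans; [apply Rmin_l|apply Rmin_r]).
    assert (M3 : m * (1 + S) <= 1).
    { apply Rle_trans with (/ (1 + S) * (1 + S)); [|right; field; lra].
      apply Rmult_le_compat_r; [lra|apply Rmin_r]. }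
    assert (Hg : forall t, Cmod t < m ->
      Cmod (g1 t - c 1%nat * t) <= K * Cmod t ^ 2 /\ Cmod (g2 t - d 1%nat * t) <= K * Cmod t ^ 2 /\
      Cmod (g1 t) <= S * Cmod t /\ Cmod (g2 t) <= S * Cmod t /\ S * Cmod t <= 1 /\ Cmod t <= 1).
    { intros t Htm. destruct (H2 t ltac:(lra)) as [G1 G2].
      rewrite !P2 in * by auto. assert (T := Cmod_ge_0 t).
      assert (T1 : Cmod t <= 1) by nra. assert (TS : S * Cmod t <= 1) by nra.
      assert (T2 : Cmod t ^ 2 <= Cmod t) by (simpl; nra).
      assert (KT : K * Cmod t ^ 2 <= K * Cmod t) by (apply Rmult_le_compat_l; auto).
      assert (C2 : 0 <= Cmod (c 1%nat) * Cmod t) by now apply Rmult_le_pos.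
      assert (D2 : 0 <= Cmod (d 1%nat) * Cmod t) by now apply Rmult_le_pos.
      repeat split; auto.
      - replace (g1 t) with ((g1 t - c 1%nat * t) + c 1%nat * t)%C by ring.
        eapply Rle_trans; [apply Cmod_triangle|]. rewrite Cmod_mult. unfold S; lra.
      - replace (g2 t) with ((g2 t - d 1%nat * t) + d 1%nat * t)%C by ring.
        eapply Rle_trans; [apply Cmod_triangle|]. rewrite Cmod_mult. unfold S; lra. }
    assert (Hd1 : d 1%nat = RtoC 0).
    { assert (Hw : forall w, Cmod w = 1 -> Im (d 1%nat * w)%C = 0).
      { intros w Hw. set (L := K + Rabs K0 + 5 * S ^ 2).
        assert (HL : 0 <= L).
        { unfold L. generalize (Rabs_pos K0) (pow_le S 2 HS). lra. }
        apply (zero_of_linear_bound _ L m Hm HL). intros t [T0 Tm].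
        assert (Tw : Cmod (RtoC t * w) = t) by (rewrite Cmod_mult, Hw, Cmod_R_nonneg; lra).
        destruct (Hg (RtoC t * w)%C ltac:(lra)) as (G1 & G2 & G3 & G4 & G5 & G6).
        specialize (HF (RtoC t * w)%C ltac:(lra)).
        rewrite Tw in *. unfold rho_M in HF. cbn [fst snd] in HF.
        assert (B := F_bound a (g1 (RtoC t * w)%C) (Re (g2 (RtoC t * w)%C)) Ha ltac:(lra)
           ltac:(eapply Rle_trans; [apply re_le_Cmod|lra])).
        assert (B2 : 5 * Cmod (g1 (RtoC t * w)%C) ^ 2 <= 5 * S ^ 2 * t ^ 2).
        { rewrite Rmult_assoc, <- Rpow_mult_distr. apply Rmult_le_compat_l; [lra|].
          apply pow_incr. split; [apply Cmod_ge_0|lra]. }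
        assert (B3 : K0 * t ^ 9 <= Rabs K0 * t ^ 2).
        { assert (t ^ 9 <= t ^ 2).
          { replace (t ^ 9) with (t ^ 2 * t ^ 7) by ring.
            assert (0 <= t ^ 2) by (apply pow_le; lra).
            generalize (pow_le1 t 7 ltac:(lra)). nra. }
          apply Rle_trans with (Rabs K0 * t ^ 9).
          - apply Rmult_le_compat_r; [apply pow_le; lra|apply Rle_abs].
          - apply Rmult_le_compat_l; [apply Rabs_pos|auto]. }
        assert (B4 := Rabs_im_le (g2 (RtoC t * w) - d 1%nat * (RtoC t * w))%C).
        apply Rmult_le_reg_l with t; auto.
        replace (t * Rabs (Im (d 1%nat * w)%C)) with (Rabs (t * Im (d 1%nat * w)%C))
          by (rewrite Rabs_mult, (Rabs_pos_eq t); lra).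
        replace (Im (g2 (RtoC t * w) - d 1%nat * (RtoC t * w))%C) with
          (Im (g2 (RtoC t * w)%C) - t * Im (d 1%nat * w)%C) in B4.
        2: { generalize (g2 (RtoC t * w)%C) (d 1%nat). intros [? ?] [? ?]. destruct w.
             unfold Im; simpl; ring. }
        replace (t * (L * t)) with (L * t ^ 2) by ring. unfold L.
        rewrite !Rmult_plus_distr_r.
        assert (B5 := Rle_trans _ _ _ B4 G2).
        apply Rabs_le_between in HF, B, B5. apply Rabs_le_between. lra. }
      assert (W1 := Hw (RtoC 1) Cmod_1). assert (W2 := Hw Ci Cmod_Ci).
      revert W1 W2. generalize (d 1%nat). intros [x y]. unfold Im; simpl. intros W1 W2.
      apply injective_projections; simpl; lra. }
    assert (Hc1 : 0 < Cmod (c 1%nat)).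
    { apply Cmod_gt_0. intros E. apply E1. now rewrite E, Hd1. }
    set (k := Cmod (c 1%nat)) in *.
    destruct (Ht 9%nat) as (K9 & e9 & HK9 & He9 & H9).
    set (m' := Rmin (Rmin m e9) (k / (4 * (K + 1)))).
    assert (Hm' : 0 < m').
    { unfold m'. apply Rmin_pos; [now apply Rmin_pos|]. apply Rdiv_lt_0_compat; lra. }
    assert (M4 : m' <= m) by (unfold m'; eapply Rle_trans; [apply Rmin_l|apply Rmin_l]).
    assert (M5 : m' <= e9) by (unfold m'; eapply Rle_trans; [apply Rmin_l|apply Rmin_r]).
    assert (M6 : m' * K <= k / 4).
    { apply Rle_trans with (k / (4 * (K + 1)) * (K + 1)); [|right; field; lra].
      apply Rmult_le_compat; try lra. apply Rmin_r. }
    cut (3 / 4 * (k / 2) ^ 8 = 0).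
    { generalize (pow_lt (k / 2) 8 ltac:(lra)). lra. }
    apply (zero_of_linear_bound _ (K9 + Rabs K0) m'); auto.
    { generalize (Rabs_pos K0); lra. }
    intros s [S0 S1].
    destruct (exists_nonpos_on_circle d (RtoC s) Ed0) as (w & Hw & Hneg).
    set (t := (w * RtoC s)%C) in *.
    assert (Ts : Cmod t = s) by (unfold t; rewrite Cmod_mult, Hw, Cmod_R_nonneg; lra).
    destruct (Hg t ltac:(lra)) as (G1 & G2 & G3 & G4 & G5 & G6).
    specialize (HF t ltac:(lra)). destruct (H9 t ltac:(lra)) as [_ G9].
    rewrite Ts in *. unfold rho_M in HF. cbn [fst snd] in HF.
    assert (Ks : K * s ^ 2 <= k / 4 * s).
    { replace (K * s ^ 2) with (s * K * s) by ring. apply Rmult_le_compat_r; [lra|].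
      apply Rle_trans with (m' * K); auto. apply Rmult_le_compat_r; lra. }
    assert (Hks : 0 < k * s) by (apply Rmult_lt_0_compat; lra).
    assert (L1 : k / 2 * s <= Cmod (g1 t)).
    { assert (T := Cmod_triangle (g1 t) (- (g1 t - c 1%nat * t))%C). rewrite Cmod_opp in T.
      replace (g1 t + - (g1 t - c 1%nat * t))%C with (c 1%nat * t)%C in T by ring.
      rewrite Cmod_mult, Ts in T. fold k in T. lra. }
    assert (L2 : Rabs (Re (g2 t)) <= Cmod (g1 t) / 2).
    { eapply Rle_trans; [apply re_le_Cmod|]. rewrite Hd1 in G2.
      replace (g2 t - 0 * t)%C with (g2 t) in G2 by ring. lra. }
    assert (L3 : Re (g2 t) ^ 2 <= Cmod (g1 t) ^ 2 / 4).
    { rewrite <- (Rabs_pos_eq (_ ^ 2)), <- RPow_abs by apply (pow_even_ge0 _ 1).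
      replace (Cmod (g1 t) ^ 2 / 4) with ((Cmod (g1 t) / 2) ^ 2) by field.
      apply pow_incr. split; [apply Rabs_pos|auto]. }
    assert (L4 := F_lower a (g1 t) (Re (g2 t)) Ha).
    assert (L5 : 3 / 4 * Cmod (g1 t) ^ 8 <= F a (g1 t) (Re (g2 t))).
    { eapply Rle_trans; [|exact L4].
      replace (3 / 4 * Cmod (g1 t) ^ 8) with (Cmod (g1 t) ^ 6 * (3 / 4 * Cmod (g1 t) ^ 2)) by ring.
      apply Rmult_le_compat_l; [apply pow_le, Cmod_ge_0|lra]. }
    assert (L6 : (k / 2 * s) ^ 8 <= Cmod (g1 t) ^ 8).
    { apply pow_incr. split; auto. apply Rmult_le_pos; lra. }
    rewrite Rpow_mult_distr in L6.
    assert (L7 := Rabs_im_le (g2 t - psum d 9 t)%C).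
    replace (Im (g2 t - psum d 9 t)%C) with (Im (g2 t) - Im (psum d 9 t)) in L7 by reflexivity.
    assert (L8 := Rle_trans _ _ _ L7 G9).
    assert (L9 : K0 * s ^ 9 <= Rabs K0 * s ^ 9) by
      (apply Rmult_le_compat_r; [apply pow_le; lra|apply Rle_abs]).
    apply Rabs_le_between in HF, L8.
    rewrite Rabs_pos_eq by (generalize (pow_lt (k / 2) 8 ltac:(lra)); lra).
    apply Rmult_le_reg_l with (s ^ 8); [apply pow_lt; lra|].
    replace (s ^ 8 * ((K9 + Rabs K0) * s)) with (K9 * s ^ 9 + Rabs K0 * s ^ 9) by ring.
    lra.
Qed.

(** * Sums of power series and their Taylor expansion *)

Definition geometric (b : nat -> C) (B q : R) : Prop := forall n, Cmod (b n) <= B * q ^ n.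

(** The sum of the power series, chosen by the epsilon operator; it is meaningful where
    the series converges. *)
Definition pser (b : nat -> C) (z : C) : C :=
  epsilon (inhabits (RtoC 0))
    (fun l => is_series (K := C_AbsRing) (V := C_NormedModule) (fun n => (b n * z ^ n)%C) l).

Lemma geometric_ge0 b B q : geometric b B q -> 0 <= B.
Proof. intros H. generalize (H 0%nat) (Cmod_ge_0 (b 0%nat)). simpl. lra. Qed.

Lemma pser_is_series b B q z : geometric b B q -> 0 <= q -> q * Cmod z <= / 2 ->
  is_series (K := C_AbsRing) (V := C_NormedModule) (fun n => (b n * z ^ n)%C) (pser b z).
Proof.
  intros Hb Hq Hz. apply (epsilon_spec (inhabits (RtoC 0))
    (fun l => is_series (K := C_AbsRing) (V := C_NormedModule) (fun n => (b n * z ^ n)%C) l)).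
  assert (H0 := Cmod_ge_0 z).
  destruct (ex_series_le (K := C_AbsRing) (V := C_CompleteNormedModule)
    (fun n => (b n * z ^ n)%C) (fun n => B * (q * Cmod z) ^ n)) as [l Hl].
  - intros n. change (Cmod (b n * z ^ n) <= B * (q * Cmod z) ^ n).
    rewrite Cmod_mult, Cmod_pow, Rpow_mult_distr, <- Rmult_assoc.
    apply Rmult_le_compat_r; [now apply pow_le|apply Hb].
  - apply (ex_series_scal (K := R_AbsRing) (V := R_NormedModule) B), ex_series_geom.
    rewrite Rabs_pos_eq; [lra|now apply Rmult_le_pos].
  - exists l. exact Hl.
Qed.

Lemma pser_tail b B q z k : geometric b B q -> 0 <= q -> q * Cmod z <= / 2 ->
  Cmod (pser b z - psum b k z) <= 2 * B * (q * Cmod z) ^ k.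
Proof. intros. eapply power_series_tail; eauto using pser_is_series. Qed.

Lemma pser_bound b B q z : geometric b B q -> 0 <= q -> q * Cmod z <= / 2 ->
  Cmod (pser b z) <= 2 * B.
Proof.
  intros. generalize (pser_tail b B q z 0 ltac:(auto) ltac:(auto) ltac:(auto)). simpl.
  replace (pser b z - 0)%C with (pser b z) by ring. lra.
Qed.

Lemma pow_half_pos N : 0 < (/ 2) ^ N.
Proof. apply pow_lt. lra. Qed.

Lemma pow_half_le x N : 0 <= x <= / 2 -> x ^ N <= (/ 2) ^ N.
Proof. intros. apply pow_incr. lra. Qed.

(** Used to pass to the limit in estimates for partial sums. *)
Lemma le_of_geometric_error X Y L : (forall N, X <= Y + L * (/ 2) ^ N) -> X <= Y.
Proof.
  intros H. apply Rnot_lt_le. intros Hlt.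
  destruct (pow_lt_1_zero (/ 2) ltac:(rewrite Rabs_pos_eq; lra)
    ((X - Y) / (Rabs L + 1))) as [N HN].
  { apply Rdiv_lt_0_compat; generalize (Rabs_pos L); lra. }
  specialize (HN N (le_n N)). specialize (H N).
  rewrite Rabs_pos_eq in HN by pos.
  assert (HL := Rabs_pos L). assert (HL' := Rle_abs L). assert (Hp := pow_half_pos N).
  apply (Rmult_lt_compat_l (Rabs L + 1)) in HN; [|lra].
  replace ((Rabs L + 1) * ((X - Y) / (Rabs L + 1))) with (X - Y) in HN by (field; lra).
  nra.
Qed.

Lemma psum_add b c k z : psum (fun n => b n + c n)%C k z = (psum b k z + psum c k z)%C.
Proof. induction k as [|k IH]; simpl; [ring|rewrite IH; ring]. Qed.

Lemma psum_scal b x k z : psum (fun n => x * b n)%C k z = (x * psum b k z)%C.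
Proof. induction k as [|k IH]; simpl; [ring|rewrite IH; ring]. Qed.

Lemma geometric_add b c B B' q :
  geometric b B q -> geometric c B' q -> geometric (fun n => b n + c n)%C (B + B') q.
Proof. intros H H' n. rewrite Rmult_plus_distr_r. apply Cmod_add_le; auto. Qed.

Lemma geometric_scal b B q x : geometric b B q -> geometric (fun n => x * b n)%C (Cmod x * B) q.
Proof.
  intros H n. rewrite Cmod_mult, Rmult_assoc.
  apply Rmult_le_compat_l; [apply Cmod_ge_0|apply H].
Qed.

Lemma pser_unique b B q z l L : geometric b B q -> 0 <= q -> q * Cmod z <= / 2 ->
  (forall N, Cmod (l - psum b N z) <= L * (/ 2) ^ N) -> l = pser b z.
Proof.
  intros Hb Hq Hz H.
  assert (HB := geometric_ge0 _ _ _ Hb).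
  assert (Hx : 0 <= q * Cmod z <= / 2) by (split; auto; apply Rmult_le_pos; auto using Cmod_ge_0).
  assert (E : Cmod (l - pser b z) <= 0).
  { apply (le_of_geometric_error _ _ (L + 2 * B)). intros N.
    replace (l - pser b z)%C with ((l - psum b N z) + - (pser b z - psum b N z))%C by ring.
    eapply Rle_trans; [apply Cmod_triangle|]. rewrite Cmod_opp.
    generalize (pser_tail b B q z N Hb Hq Hz) (H N). intros H1 H2.
    assert (2 * B * (q * Cmod z) ^ N <= 2 * B * (/ 2) ^ N) by
      (apply Rmult_le_compat_l; [lra|now apply pow_half_le]). lra. }
  replace l with ((l - pser b z) + pser b z)%C by ring.
  rewrite (Cmod_eq_0 (l - pser b z)); [ring|]. generalize (Cmod_ge_0 (l - pser b z)). lra.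
Qed.

Lemma pser_add b c B B' q z : geometric b B q -> geometric c B' q -> 0 <= q -> q * Cmod z <= / 2 ->
  pser (fun n => b n + c n)%C z = (pser b z + pser c z)%C.
Proof.
  intros Hb Hc Hq Hz. symmetry.
  apply (pser_unique _ (B + B') q _ _ (2 * (B + B'))); auto using geometric_add.
  intros N. rewrite psum_add.
  assert (HB := geometric_ge0 _ _ _ Hb). assert (HB' := geometric_ge0 _ _ _ Hc).
  replace (pser b z + pser c z - (psum b N z + psum c N z))%C
    with ((pser b z - psum b N z) + (pser c z - psum c N z))%C by ring.
  assert (Hx : 0 <= q * Cmod z <= / 2) by (split; auto; apply Rmult_le_pos; auto using Cmod_ge_0).
  assert (Hp := pow_half_le _ N Hx).
  replace (2 * (B + B') * (/ 2) ^ N) with (2 * B * (/ 2) ^ N + 2 * B' * (/ 2) ^ N) by ring.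
  apply Cmod_add_le; (eapply Rle_trans; [apply pser_tail; eauto|]);
  apply Rmult_le_compat_l; auto; lra.
Qed.

Lemma pser_scal b B q x z : geometric b B q -> 0 <= q -> q * Cmod z <= / 2 ->
  pser (fun n => x * b n)%C z = (x * pser b z)%C.
Proof.
  intros Hb Hq Hz. symmetry.
  apply (pser_unique _ (Cmod x * B) q _ _ (Cmod x * (2 * B))); auto using geometric_scal.
  intros N. rewrite psum_scal.
  replace (x * pser b z - x * psum b N z)%C with (x * (pser b z - psum b N z))%C by ring.
  assert (HB := geometric_ge0 _ _ _ Hb).
  rewrite Cmod_mult, Rmult_assoc. apply Rmult_le_compat_l; [apply Cmod_ge_0|].
  eapply Rle_trans; [apply pser_tail; eauto|]. apply Rmult_le_compat_l; [lra|].
  apply pow_half_le. split; auto. apply Rmult_le_pos; auto using Cmod_ge_0.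
Qed.

Lemma pser_ext b c z : (forall n, b n = c n) -> pser b z = pser c z.
Proof.
  intros H. f_equal. apply FunctionalExtensionality.functional_extensionality, H.
Qed.

(** Coefficients of the derivative; [dcoef2] are those of half the second derivative. *)
Definition dcoef1 (b : nat -> C) (n : nat) : C := (RtoC (INR n + 1) * b (S n))%C.
Definition dcoef2 (b : nat -> C) (n : nat) : C :=
  (RtoC ((INR n + 1) * (INR n + 2) / 2) * b (S (S n)))%C.

Lemma INR_pow2 n : INR n + 1 <= 2 ^ n.
Proof.
  induction n as [|n IH]; [simpl; lra|]. rewrite S_INR. simpl.
  assert (1 <= 2 ^ n) by (apply pow_R1_Rle; lra). lra.
Qed.

Lemma triangular_pow2 n : (INR n + 1) * (INR n + 2) / 2 <= 2 * 2 ^ n.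
Proof.
  induction n as [|n IH]; [simpl; lra|].
  destruct n as [|n]; [simpl; lra|]. rewrite (S_INR (S n)), S_INR in *.
  change (2 ^ S (S n)) with (2 * 2 ^ S n). assert (P := pos_INR n). nra.
Qed.

(** The factor n + 1 is absorbed by doubling the ratio. *)
Lemma dcoef1_geometric b B q : geometric b B q -> 0 <= q -> geometric (dcoef1 b) (B * q) (2 * q).
Proof.
  intros Hb Hq n. unfold dcoef1. assert (P := pos_INR n). rewrite Cmod_mult, Cmod_R_nonneg, Rpow_mult_distr by lra.
  apply Rle_trans with (2 ^ n * (B * q ^ S n)); [|right; simpl; ring].
  apply Rmult_le_compat; auto using Cmod_ge_0, INR_pow2; lra.
Qed.

Lemma dcoef2_geometric b B q : geometric b B q -> 0 <= q ->
  geometric (dcoef2 b) (2 * B * q ^ 2) (2 * q).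
Proof.
  intros Hb Hq n. unfold dcoef2. assert (P := pos_INR n). assert (0 <= (INR n + 1) * (INR n + 2) / 2) by nra.
  rewrite Cmod_mult, Cmod_R_nonneg, Rpow_mult_distr by auto.
  apply Rle_trans with (2 * 2 ^ n * (B * q ^ S (S n))); [|right; simpl; ring].
  apply Rmult_le_compat; auto using Cmod_ge_0, triangular_pow2.
Qed.

(** The third order Taylor remainder of the power N + 2. *)
Definition power_remainder (z h : C) (N : nat) : C :=
  ((z + h) ^ S (S N) - z ^ S (S N) - RtoC (INR N + 2) * h * z ^ S N
   - RtoC ((INR N + 1) * (INR N + 2) / 2) * h ^ 2 * z ^ N)%C.

(** The recursion replaces the explicit binomial remainder: each step multiplies by z + h
    and adds one cubic term. *)
Lemma power_remainder_S z h N :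
  power_remainder z h (S N) = ((z + h) * power_remainder z h N
    + RtoC ((INR N + 1) * (INR N + 2) / 2) * h ^ 3 * z ^ N)%C.
Proof.
  unfold power_remainder. rewrite S_INR.
  set (n := INR N). rewrite !Cpow_S.
  replace (RtoC ((n + 1 + 1) * (n + 1 + 2) / 2))
    with (RtoC ((n + 1) * (n + 2) / 2) + RtoC (n + 2))%C.
  2: { rewrite <- RtoC_plus. f_equal. field. }
  replace (RtoC (n + 1 + 2)) with (RtoC (n + 2) + 1)%C.
  2: { rewrite <- RtoC_plus. f_equal. ring. }
  ring.
Qed.

Lemma power_remainder_bound q z h N : 0 <= q -> q * (Cmod z + Cmod h) <= / 4 ->
  q ^ N * Cmod (power_remainder z h N) <= q * Cmod h ^ 3 * (8 * (/ 2) ^ N).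
Proof.
  intros Hq Hx. assert (Z := Cmod_ge_0 z). assert (H := Cmod_ge_0 h).
  assert (H3 : 0 <= q * Cmod h ^ 3) by pos.
  induction N as [|N IH].
  - replace (power_remainder z h 0) with (RtoC 0).
    + rewrite Cmod_0. simpl in *. lra.
    + unfold power_remainder. simpl INR. replace ((0 + 1) * (0 + 2) / 2) with 1 by field.
      replace (0 + 2) with 2 by ring. simpl. ring.
  - rewrite power_remainder_S.
    set (T := (INR N + 1) * (INR N + 2) / 2).
    assert (HT : 0 <= T) by (unfold T; generalize (pos_INR N); nra).
    assert (HT2 : T <= 2 * 2 ^ N) by apply triangular_pow2.
    assert (A1 : q ^ S N * Cmod ((z + h) * power_remainder z h N)
      <= / 4 * (q * Cmod h ^ 3 * (8 * (/ 2) ^ N))).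
    { rewrite Cmod_mult. simpl pow.
      replace (q * q ^ N * (Cmod (z + h) * Cmod (power_remainder z h N)))
        with (q * Cmod (z + h) * (q ^ N * Cmod (power_remainder z h N))) by ring.
      apply Rmult_le_compat; auto.
      - apply Rmult_le_pos; auto using Cmod_ge_0.
      - apply Rmult_le_pos; [now apply pow_le|apply Cmod_ge_0].
      - eapply Rle_trans; [|exact Hx]. apply Rmult_le_compat_l; auto. apply Cmod_triangle. }
    assert (A2 : q ^ S N * Cmod (RtoC T * h ^ 3 * z ^ N)
      <= q * Cmod h ^ 3 * (2 * (/ 2) ^ N)).
    { rewrite !Cmod_mult, !Cmod_pow, Cmod_R_nonneg by auto. simpl pow.
      replace (q * q ^ N * (T * (Cmod h * (Cmod h * (Cmod h * 1))) * Cmod z ^ N))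
        with (q * Cmod h ^ 3 * (T * (q * Cmod z) ^ N)) by (rewrite Rpow_mult_distr; ring).
      apply Rmult_le_compat_l; auto.
      replace (2 * (/ 2) ^ N) with (2 * 2 ^ N * (/ 4) ^ N).
      2: { rewrite Rmult_assoc, <- Rpow_mult_distr. do 2 f_equal. field. }
      apply Rmult_le_compat; auto.
      - apply pow_le. now apply Rmult_le_pos.
      - apply pow_incr. split; [now apply Rmult_le_pos|]. nra. }
    assert (A3 := Cmod_triangle ((z + h) * power_remainder z h N) (RtoC T * h ^ 3 * z ^ N)).
    apply (Rmult_le_compat_l (q ^ S N)) in A3; [|now apply pow_le].
    change ((/ 2) ^ S N) with (/ 2 * (/ 2) ^ N). lra.
Qed.

Lemma psum_taylor b B q z h N : geometric b B q -> 0 <= q -> q * (Cmod z + Cmod h) <= / 4 ->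
  Cmod (psum b (S (S N)) (z + h) - psum b (S (S N)) z - h * psum (dcoef1 b) (S N) z
        - h ^ 2 * psum (dcoef2 b) N z) <= B * q ^ 3 * Cmod h ^ 3 * (16 * (1 - (/ 2) ^ N)).
Proof.
  intros Hb Hq Hx. assert (HB := geometric_ge0 _ _ _ Hb).
  induction N as [|N IH].
  - match goal with |- Cmod ?e <= _ => replace e with (RtoC 0) end.
    + rewrite Cmod_0. simpl. lra.
    + unfold dcoef1. simpl. replace (0 + 1) with 1 by ring. ring.
  - match goal with |- Cmod ?e <= _ => replace e with
      ((psum b (S (S N)) (z + h) - psum b (S (S N)) z - h * psum (dcoef1 b) (S N) z
        - h ^ 2 * psum (dcoef2 b) N z) + b (S (S N)) * power_remainder z h N)%C end.
    2: { unfold power_remainder.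
         change (psum b (S (S (S N))) (z + h))
           with (psum b (S (S N)) (z + h) + b (S (S N)) * (z + h) ^ S (S N))%C.
         change (psum b (S (S (S N))) z) with (psum b (S (S N)) z + b (S (S N)) * z ^ S (S N))%C.
         change (psum (dcoef1 b) (S (S N)) z) with (psum (dcoef1 b) (S N) z
           + RtoC (INR (S N) + 1) * b (S (S N)) * z ^ S N)%C.
         change (psum (dcoef2 b) (S N) z) with (psum (dcoef2 b) N z
           + RtoC ((INR N + 1) * (INR N + 2) / 2) * b (S (S N)) * z ^ N)%C.
         rewrite S_INR. replace (INR N + 1 + 1) with (INR N + 2) by ring. ring. }
    eapply Rle_trans; [apply Cmod_triangle|].
    assert (A := power_remainder_bound q z h N Hq Hx).
    assert (A2 : Cmod (b (S (S N)) * power_remainder z h N)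
      <= B * q ^ 3 * Cmod h ^ 3 * (8 * (/ 2) ^ N)).
    { rewrite Cmod_mult.
      apply Rle_trans with (B * q ^ S (S N) * Cmod (power_remainder z h N)).
      - apply Rmult_le_compat_r; [apply Cmod_ge_0|apply Hb].
      - replace (B * q ^ S (S N) * Cmod (power_remainder z h N))
          with (B * q ^ 2 * (q ^ N * Cmod (power_remainder z h N))) by (simpl; ring).
        replace (B * q ^ 3 * Cmod h ^ 3 * (8 * (/ 2) ^ N))
          with (B * q ^ 2 * (q * Cmod h ^ 3 * (8 * (/ 2) ^ N))) by ring.
        apply Rmult_le_compat_l; auto. apply Rmult_le_pos; auto. now apply pow_le. }
    change ((/ 2) ^ S N) with (/ 2 * (/ 2) ^ N). lra.
Qed.

(** The estimate holds for partial sums with a constant independent of their length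
    and passes to the limit. *)
Theorem pser_taylor b B q z h : geometric b B q -> 0 <= q -> q * (Cmod z + Cmod h) <= / 4 ->
  Cmod (pser b (z + h) - pser b z - h * pser (dcoef1 b) z - h ^ 2 * pser (dcoef2 b) z)
    <= 16 * B * q ^ 3 * Cmod h ^ 3.
Proof.
  intros Hb Hq Hx. assert (HB := geometric_ge0 _ _ _ Hb).
  assert (Z := Cmod_ge_0 z). assert (H := Cmod_ge_0 h).
  assert (Hz : q * Cmod z <= / 4) by nra.
  assert (Hzh : q * Cmod (z + h) <= / 4).
  { eapply Rle_trans; [apply Rmult_le_compat_l, Cmod_triangle; auto|auto]. }
  assert (Hz2 : 2 * q * Cmod z <= / 2) by lra.
  assert (G1 := dcoef1_geometric b B q Hb Hq). assert (G2 := dcoef2_geometric b B q Hb Hq).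
  assert (N1 := geometric_ge0 _ _ _ G1). assert (N2 := geometric_ge0 _ _ _ G2).
  apply (le_of_geometric_error _ _ (2 * B + 2 * B + Cmod h * (2 * (B * q))
    + Cmod h ^ 2 * (2 * (2 * B * q ^ 2)))).
  intros N.
  assert (T1 := pser_tail b B q (z + h) (S (S N)) Hb Hq ltac:(lra)).
  assert (T2 := pser_tail b B q z (S (S N)) Hb Hq ltac:(lra)).
  assert (T3 := pser_tail (dcoef1 b) _ _ z (S N) G1 ltac:(lra) Hz2).
  assert (T4 := pser_tail (dcoef2 b) _ _ z N G2 ltac:(lra) Hz2).
  assert (T5 := psum_taylor b B q z h N Hb Hq Hx).
  match goal with |- Cmod ?e <= _ => replace e with
   ((psum b (S (S N)) (z + h) - psum b (S (S N)) z - h * psum (dcoef1 b) (S N) z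
        - h ^ 2 * psum (dcoef2 b) N z)
    + ((pser b (z + h) - psum b (S (S N)) (z + h)) + - (pser b z - psum b (S (S N)) z)
       + - (h * (pser (dcoef1 b) z - psum (dcoef1 b) (S N) z))
       + - (h ^ 2 * (pser (dcoef2 b) z - psum (dcoef2 b) N z))))%C by ring end.
  eapply Rle_trans; [apply Cmod_triangle|].
  eapply Rle_trans; [apply Rplus_le_compat_l|].
  { eapply Rle_trans; [apply Cmod_triangle|]. eapply Rle_trans; [apply Rplus_le_compat_r, Cmod_triangle|].
    eapply Rle_trans; [apply Rplus_le_compat_r, Rplus_le_compat_r, Cmod_triangle|].
    rewrite !Cmod_opp, !Cmod_mult, Cmod_pow. apply Rle_refl. }
  assert (Hpow : forall x, 0 <= x <= / 2 -> x ^ N <= (/ 2) ^ N /\ x ^ S N <= (/ 2) ^ N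
    /\ x ^ S (S N) <= (/ 2) ^ N).
  { intros x Hx'. assert (E := pow_half_le x N Hx').
    assert (E0 : 0 <= x ^ N) by pos.
    assert (E1 : 0 <= x * x ^ N <= x ^ N) by nra.
    assert (E2 : x * (x * x ^ N) <= x * x ^ N) by nra. simpl. lra. }
  destruct (Hpow (q * Cmod (z + h))) as (_ & _ & U1).
  { split; [apply Rmult_le_pos; auto using Cmod_ge_0|lra]. }
  destruct (Hpow (q * Cmod z)) as (_ & _ & U2); [split; [now apply Rmult_le_pos|lra]|].
  destruct (Hpow (2 * q * Cmod z)) as (U4 & U3 & _); [split; [|lra]; apply Rmult_le_pos; lra|].
  apply (Rmult_le_compat_l (2 * B)) in U1; [|lra].
  apply (Rmult_le_compat_l (2 * B)) in U2; [|lra].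
  apply (Rmult_le_compat_l (2 * (B * q))) in U3; [|lra].
  apply (Rmult_le_compat_l (2 * (2 * B * q ^ 2))) in U4; [|lra].
  assert (V3 := Rle_trans _ _ _ T3 U3). assert (V4 := Rle_trans _ _ _ T4 U4).
  apply (Rmult_le_compat_l (Cmod h)) in V3; auto.
  apply (Rmult_le_compat_l (Cmod h ^ 2)) in V4; [|now apply pow_le].
  assert (0 <= B * q ^ 3 * Cmod h ^ 3 * (/ 2) ^ N) by pos.
  lra.
Qed.

(** * Power series in two variables *)

(** Coefficients, depending on w, of a power series in z: geometric bounds and geometric
    Lipschitz bounds, both uniform in w. *)
Definition analytic_family (g : C -> nat -> C) : Prop :=
  exists B q d, 0 <= q /\ 0 < d /\
    (forall w, Cmod w < d -> geometric (g w) B q) /\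
    (forall w w', Cmod w < d -> Cmod w' < d ->
       geometric (fun n => g w n - g w' n)%C (B * Cmod (w - w')) q).

Lemma dcoef1_sub b c n : (dcoef1 b n - dcoef1 c n)%C = dcoef1 (fun n => b n - c n)%C n.
Proof. unfold dcoef1. ring. Qed.

Lemma dcoef2_sub b c n : (dcoef2 b n - dcoef2 c n)%C = dcoef2 (fun n => b n - c n)%C n.
Proof. unfold dcoef2. ring. Qed.

Lemma analytic_family_dcoef1 g : analytic_family g -> analytic_family (fun w => dcoef1 (g w)).
Proof.
  intros (B & q & d & Hq & Hd & H1 & H2).
  exists (B * q), (2 * q), d. split; [lra|split; [auto|split]].
  - intros w Hw. apply dcoef1_geometric; auto.
  - intros w w' Hw Hw' n. rewrite dcoef1_sub.
    eapply Rle_trans; [apply (dcoef1_geometric _ (B * Cmod (w - w')) q); auto|].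
    right; ring.
Qed.

Lemma analytic_family_dcoef2 g : analytic_family g -> analytic_family (fun w => dcoef2 (g w)).
Proof.
  intros (B & q & d & Hq & Hd & H1 & H2).
  exists (2 * B * q ^ 2), (2 * q), d. split; [lra|split; [auto|split]].
  - intros w Hw. apply dcoef2_geometric; auto.
  - intros w w' Hw Hw' n. rewrite dcoef2_sub.
    eapply Rle_trans; [apply (dcoef2_geometric _ (B * Cmod (w - w')) q); auto|].
    right; ring.
Qed.

Lemma pser_lipschitz b B q w w' : geometric b B q -> 0 <= q ->
  q * Cmod w <= / 12 -> q * Cmod w' <= / 12 ->
  Cmod (pser b w - pser b w') <= 4 * q * B * Cmod (w - w').
Proof.
  intros Hb Hq Hw Hw'. assert (HB := geometric_ge0 _ _ _ Hb).
  set (h := (w - w')%C).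
  assert (Hh : q * Cmod h <= / 6).
  { apply Rle_trans with (q * (Cmod w + Cmod w')); [|lra].
    apply Rmult_le_compat_l; auto. unfold h, Cminus.
    rewrite <- (Cmod_opp w'). apply Cmod_triangle. }
  assert (T := pser_taylor b B q w' h Hb Hq ltac:(lra)).
  replace (w' + h)%C with w in T by (unfold h; ring).
  assert (G1 := dcoef1_geometric b B q Hb Hq). assert (G2 := dcoef2_geometric b B q Hb Hq).
  assert (T1 := pser_bound (dcoef1 b) _ _ w' G1 ltac:(lra) ltac:(lra)).
  assert (T2 := pser_bound (dcoef2 b) _ _ w' G2 ltac:(lra) ltac:(lra)).
  assert (H := Cmod_ge_0 h).
  replace (pser b w - pser b w')%C with
    ((pser b w - pser b w' - h * pser (dcoef1 b) w' - h ^ 2 * pser (dcoef2 b) w')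
      + (h * pser (dcoef1 b) w' + h ^ 2 * pser (dcoef2 b) w'))%C by ring.
  eapply Rle_trans; [apply Cmod_add_le; [exact T|apply Cmod_triangle]|].
  rewrite !Cmod_mult, Cmod_pow.
  apply (Rmult_le_compat_l (Cmod h)) in T1; auto.
  apply (Rmult_le_compat_l (Cmod h ^ 2)) in T2; [|now apply pow_le].
  set (y := Cmod h) in *. set (X := q * B * y).
  assert (HX : 0 <= X) by (unfold X; repeat apply Rmult_le_pos; auto).
  replace (y * (2 * (B * q))) with (2 * X) in T1 by (unfold X; ring).
  replace (y ^ 2 * (2 * (2 * B * q ^ 2))) with (4 * (X * (q * y))) in T2 by (unfold X; ring).
  replace (16 * B * q ^ 3 * y ^ 3) with (16 * (X * (q * y) * (q * y))) by (unfold X; ring).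
  replace (4 * q * B * y) with (4 * X) by (unfold X; ring).
  assert (E0 : 0 <= q * y) by pos.
  assert (E1 : 0 <= X * (q * y) <= X * / 6) by nra.
  assert (E2 : X * (q * y) * (q * y) <= X * / 6 * / 6) by nra.
  lra.
Qed.

Lemma analytic_family_series (c : nat -> nat -> C) B q : 0 <= q ->
  (forall m, geometric (c m) (B * q ^ m) q) -> analytic_family (fun w m => pser (c m) w).
Proof.
  intros Hq H. assert (HB := geometric_ge0 _ _ _ (H 0%nat)). simpl in HB.
  assert (Hd : 0 < / (12 * (q + 1))) by pos.
  assert (Hs : forall w, Cmod w < / (12 * (q + 1)) -> q * Cmod w <= / 12).
  { intros w Hw. apply Rle_trans with ((q + 1) * / (12 * (q + 1))).
    - apply Rmult_le_compat; try lra; apply Cmod_ge_0.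
    - right; field; lra. }
  exists (B * (2 + 4 * q)), q, (/ (12 * (q + 1))).
  assert (P : forall m, 0 <= B * q ^ m) by
    (intros; apply Rmult_le_pos; [lra|now apply pow_le]).
  split; [auto|split; [auto|split]].
  - intros w Hw m. specialize (Hs w Hw).
    eapply Rle_trans; [apply (pser_bound (c m) (B * q ^ m) q); auto; lra|].
    specialize (P m). assert (0 <= B * q ^ m * (4 * q)) by pos. lra.
  - intros w w' Hw Hw' m.
    eapply Rle_trans; [apply (pser_lipschitz (c m) (B * q ^ m) q); auto|].
    specialize (P m). assert (0 <= B * q ^ m * Cmod (w - w')) by pos. lra.
Qed.

(** Expansion in z up to order six whose coefficients are bounded Lipschitz functions
    of w. This is all that the final argument needs to know about the derivatives of
    the coordinates, and unlike convergent double series it is easily seen to be stable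
    under products. *)
Definition order6_in_z (k : C -> C -> C) : Prop :=
  exists (a : C -> nat -> C) K d, 0 <= K /\ 0 < d <= 1 /\
    (forall z w, Cmod z < d -> Cmod w < d -> Cmod (k z w - psum (a w) 6 z) <= K * Cmod z ^ 6) /\
    (forall w n, Cmod w < d -> (n < 6)%nat -> Cmod (a w n) <= K) /\
    (forall w w' n, Cmod w < d -> Cmod w' < d -> (n < 6)%nat ->
       Cmod (a w n - a w' n) <= K * Cmod (w - w')).

Lemma analytic_family_order6_in_z g : analytic_family g -> order6_in_z (fun z w => pser (g w) z).
Proof.
  intros (B & q & d & Hq & Hd & H1 & H2).
  assert (HB : 0 <= B).
  { apply (geometric_ge0 (g (RtoC 0)) B q). apply H1. now rewrite Cmod_0. }
  assert (Hq1 : forall n, (n < 6)%nat -> 0 <= q ^ n <= (1 + q) ^ 6).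
  { intros n Hn. split; [now apply pow_le|].
    apply Rle_trans with ((1 + q) ^ n); [apply pow_incr; lra|].
    apply Rle_pow; [lra|lia]. }
  assert (HBq : 0 <= B * (1 + q) ^ 6) by pos.
  exists g, (2 * B * (1 + q) ^ 6), (Rmin (Rmin d 1) (/ (2 * (q + 1)))).
  assert (M0 : 0 < / (2 * (q + 1))) by pos.
  assert (M1 := Rmin_l (Rmin d 1) (/ (2 * (q + 1)))).
  assert (M2 := Rmin_r (Rmin d 1) (/ (2 * (q + 1)))).
  assert (M3 := Rmin_l d 1). assert (M4 := Rmin_r d 1).
  split; [lra|split; [split; [|lra]; repeat apply Rmin_pos; lra|split; [|split]]].
  - intros z w Hz Hw.
    eapply Rle_trans; [apply (pser_tail _ B q)|]; auto.
    + apply H1. lra.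
    + apply Rle_trans with ((q + 1) * / (2 * (q + 1))).
      * apply Rmult_le_compat; try lra; apply Cmod_ge_0.
      * right; field; lra.
    + rewrite Rpow_mult_distr, <- Rmult_assoc.
      apply Rmult_le_compat_r; [apply pow_le, Cmod_ge_0|].
      apply Rmult_le_compat_l; [lra|]. apply pow_incr; lra.
  - intros w n Hw Hn. eapply Rle_trans; [apply (H1 w); lra|].
    specialize (Hq1 n Hn). assert (B * q ^ n <= B * (1 + q) ^ 6) by nra. lra.
  - intros w w' n Hw Hw' Hn. eapply Rle_trans; [apply (H2 w w'); lra|].
    specialize (Hq1 n Hn). assert (X := Cmod_ge_0 (w - w')).
    assert (E : B * Cmod (w - w') * q ^ n <= B * Cmod (w - w') * (1 + q) ^ 6).
    { apply Rmult_le_compat_l; [now apply Rmult_le_pos|lra]. }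
    assert (0 <= B * Cmod (w - w') * (1 + q) ^ 6) by pos. lra.
Qed.

Lemma sum_n_ge_term (f : nat -> R) m N : (forall n, 0 <= f n) -> (m <= N)%nat ->
  f m <= sum_n f N.
Proof.
  intros Hf. assert (P : forall N, 0 <= sum_n f N).
  { induction N0 as [|k IH]; [rewrite sum_O; auto|].
    rewrite sum_Sn. unfold plus; simpl. specialize (Hf (S k)). lra. }
  induction N as [|N IH]; intros Hm.
  - replace m with 0%nat by lia. rewrite sum_O. lra.
  - rewrite sum_Sn. unfold plus; simpl. destruct (Nat.eq_dec m (S N)) as [->|].
    + specialize (P N). lra.
    + specialize (IH ltac:(lia)). specialize (Hf (S N)). lra.
Qed.

Lemma sum_n_nonneg (f : nat -> R) N : (forall n, 0 <= f n) -> 0 <= sum_n f N.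
Proof.
  intros Hf. eapply Rle_trans; [apply (Hf 0%nat)|]. apply sum_n_ge_term; auto; lia.
Qed.

Lemma double_sum_psum (c : nat -> nat -> C) z w N :
  sum_n (G := C_AbelianMonoid)
    (fun m => sum_n (G := C_AbelianMonoid) (fun n => (c m n * z ^ m * w ^ n)%C) N) N
  = psum (fun m => psum (c m) (S N) w) (S N) z.
Proof.
  rewrite <- sum_n_psum. apply sum_n_ext. intros m.
  assert (E : forall n, (c m n * z ^ m * w ^ n = z ^ m * c m n * w ^ n)%C) by (intros; ring).
  rewrite (sum_n_ext (G := C_AbelianMonoid) _ _ N E), (sum_n_psum (fun n => z ^ m * c m n)%C).
  rewrite psum_scal. exact (Cmult_comm _ _).
Qed.

Lemma psum_sub b c k z : psum (fun n => b n - c n)%C k z = (psum b k z - psum c k z)%C.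
Proof. induction k as [|k IH]; simpl; [ring|rewrite IH; ring]. Qed.

Lemma psum_diff_bound (b b' : nat -> C) L q k z :
  geometric (fun n => b n - b' n)%C L q -> 0 <= q -> q * Cmod z <= / 2 ->
  Cmod (psum b k z - psum b' k z) <= 2 * L.
Proof.
  intros Hb Hq Hz.
  assert (HB := geometric_ge0 _ _ _ Hb).
  replace (psum b k z - psum b' k z)%C with (psum (fun n => b n - b' n)%C (0 + k) z
    - psum (fun n => b n - b' n)%C 0 z)%C.
  - eapply Rle_trans; [apply (psum_increment _ L q); auto|]. simpl.
    assert (P := pow_half_pos k). nra.
  - simpl. rewrite psum_sub. ring.
Qed.

(** Square partial sums and iterated sums have the same limit, because both tails are
    geometrically small. *)
Lemma holomorphic2_double_series f p : holomorphic2_at f p ->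
  exists (c : nat -> nat -> C) B q d, 0 <= q /\ 0 < d /\
    (forall m, geometric (c m) (B * q ^ m) q) /\
    forall x, size2 x < d -> f (shift p x) = pser (fun m => pser (c m) (snd x)) (fst x).
Proof.
  intros (c & r & H). assert (Hr := cond_pos r).
  destruct (H (RtoC (r / 2)) (RtoC (r / 2)) ltac:(rewrite Cmod_R_nonneg; lra)
    ltac:(rewrite Cmod_R_nonneg; lra)) as [[B HB] _].
  set (q := 2 / r).
  assert (Hq : 0 < q) by (apply Rdiv_lt_0_compat; lra).
  assert (Hterm : forall m n, Cmod (c m n) <= B * q ^ m * q ^ n).
  { intros m n. rewrite Cmod_R_nonneg in HB by lra.
    assert (Hpos : forall i j, 0 <= Cmod (c i j) * (r / 2) ^ i * (r / 2) ^ j).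
    { intros i j. repeat apply Rmult_le_pos; try apply Cmod_ge_0; apply pow_le; lra. }
    assert (E : Cmod (c m n) * (r / 2) ^ m * (r / 2) ^ n <= B).
    { eapply Rle_trans; [|apply (HB (m + n)%nat)].
      eapply Rle_trans; [|apply (sum_n_ge_term _ m); [intros; apply sum_n_nonneg; auto|lia]].
      apply (sum_n_ge_term (fun j => Cmod (c m j) * (r / 2) ^ m * (r / 2) ^ j) n); auto; lia. }
    assert (E1 : forall k, (r / 2) ^ k * q ^ k = 1).
    { intros k. rewrite <- Rpow_mult_distr.
      replace (r / 2 * q) with 1 by (unfold q; field; lra). apply pow1. }
    replace (Cmod (c m n)) with (Cmod (c m n) * (r / 2) ^ m * (r / 2) ^ n * (q ^ m * q ^ n)).
    - rewrite (Rmult_assoc B). apply Rmult_le_compat_r; auto.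
      apply Rmult_le_pos; apply pow_le; lra.
    - replace (Cmod (c m n) * (r / 2) ^ m * (r / 2) ^ n * (q ^ m * q ^ n)) with
        (Cmod (c m n) * ((r / 2) ^ m * q ^ m) * ((r / 2) ^ n * q ^ n)) by ring.
      rewrite !E1. ring. }
  assert (Hg : forall m, geometric (c m) (B * q ^ m) q) by pos.
  assert (HB0 := geometric_ge0 _ _ _ (Hg 0%nat)). simpl in HB0.
  exists c, B, q, (Rmin r (/ (2 * q))).
  split; [lra|split; [apply Rmin_pos; auto; apply Rinv_0_lt_compat; lra|split; auto]].
  intros [z w] Hx. unfold size2 in Hx. cbn [fst snd] in *.
  assert (M1 := Rmin_l r (/ (2 * q))). assert (M2 := Rmin_r r (/ (2 * q))).
  assert (Z := Cmod_ge_0 z). assert (W := Cmod_ge_0 w).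
  assert (Hqz : q * Cmod z <= / 2).
  { replace (/ 2) with (q * / (2 * q)) by (field; lra). apply Rmult_le_compat_l; lra. }
  assert (Hqw : q * Cmod w <= / 2).
  { replace (/ 2) with (q * / (2 * q)) by (field; lra). apply Rmult_le_compat_l; lra. }
  destruct (H z w ltac:(lra) ltac:(lra)) as [_ Hlim].
  assert (HG : geometric (fun m => pser (c m) w) (2 * B) q).
  { intros m. rewrite Rmult_assoc. apply (pser_bound (c m) (B * q ^ m) q); auto; lra. }
  set (l := f (shift p (z, w))).
  apply (pser_unique _ (2 * B) q _ _ (8 * B)); auto; try lra.
  intros N.
  (* the square partial sums beyond N approximate the limit *)
  apply (limit_in_disc _ _ _ _ N Hlim). intros n Hn.
  rewrite double_sum_psum.
  replace (psum (fun m => psum (c m) (S n) w) (S n) z - psum (fun m => pser (c m) w) N z)%C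
   with ((psum (fun m => psum (c m) (S n) w) (S n) z - psum (fun m => pser (c m) w) (S n) z)
     + (psum (fun m => pser (c m) w) (S n) z - psum (fun m => pser (c m) w) N z))%C by ring.
  assert (HN : (/ 2) ^ S n <= (/ 2) ^ N).
  { replace (S n) with (N + (S n - N))%nat by lia. rewrite pow_add.
    assert (P := pow_half_pos N). assert (P2 := pow_le1 (/ 2) (S n - N) ltac:(lra)). nra. }
  assert (Hx0 : 0 <= q * Cmod z) by pos.
  assert (Hw0 : 0 <= q * Cmod w) by pos.
  replace (8 * B * (/ 2) ^ N) with (4 * B * (/ 2) ^ N + 4 * B * (/ 2) ^ N) by ring.
  apply Cmod_add_le.
  - eapply Rle_trans; [apply (psum_diff_bound _ _ (2 * B * (/ 2) ^ S n) q); auto; try lra|].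
    + intros m. rewrite <- Cmod_opp.
      replace (- (psum (c m) (S n) w - pser (c m) w))%C with (pser (c m) w - psum (c m) (S n) w)%C by ring.
      eapply Rle_trans; [apply (pser_tail (c m) (B * q ^ m) q); auto; lra|].
      replace (2 * B * (/ 2) ^ S n * q ^ m) with (2 * (B * q ^ m) * (/ 2) ^ S n) by ring.
      apply Rmult_le_compat_l.
      * apply Rmult_le_pos; [lra|]. apply Rmult_le_pos; [lra|apply pow_le; lra].
      * apply pow_incr; lra.
    + replace (2 * (2 * B * (/ 2) ^ S n)) with (4 * B * (/ 2) ^ S n) by ring.
      apply Rmult_le_compat_l; lra.
  - replace (S n) with (N + (S n - N))%nat by lia.
    eapply Rle_trans; [apply (psum_increment _ (2 * B) q); auto; lra|].
    assert (P := pow_half_le (q * Cmod z) N ltac:(lra)).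
    assert (P0 : 0 <= (q * Cmod z) ^ N) by pos.
    assert (P2 := pow_le1 (/ 2) (S n - N) ltac:(lra)).
    replace (2 * (2 * B) * (q * Cmod z) ^ N * (1 - (/ 2) ^ (S n - N)))
      with (4 * B * ((q * Cmod z) ^ N * (1 - (/ 2) ^ (S n - N)))) by ring.
    apply Rmult_le_compat_l; [lra|]. nra.
Qed.

Lemma geometric_mono b B B' q : geometric b B q -> B <= B' -> 0 <= q -> geometric b B' q.
Proof.
  intros H HB Hq n. eapply Rle_trans; [apply H|].
  apply Rmult_le_compat_r; auto. now apply pow_le.
Qed.

(** Expand the coefficients b_m(w + h2) first, then each of the resulting power
    series in z + h1. *)
Lemma pser_taylor_family (c : nat -> nat -> C) B q z w h1 h2 :
  0 <= q -> (forall m, geometric (c m) (B * q ^ m) q) ->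
  q * (Cmod z + Cmod h1) <= / 12 -> q * (Cmod w + Cmod h2) <= / 12 ->
  Cmod h1 <= 1 ->
  let b w m := pser (c m) w in
  let b1 w m := pser (dcoef1 (c m)) w in
  let b2 w m := pser (dcoef2 (c m)) w in
  Cmod (pser (b (w + h2)%C) (z + h1) - pser (b w) z
        - (pser (dcoef1 (b w)) z * h1 + pser (b1 w) z * h2 + pser (dcoef2 (b w)) z * h1 ^ 2
           + pser (dcoef1 (b1 w)) z * h1 * h2 + pser (b2 w) z * h2 ^ 2))
  <= (88 * B * q ^ 3 + 32 * B * q ^ 4) * (Cmod h1 + Cmod h2) ^ 3.
Proof.
  intros Hq Hc Hz Hw H1 b b1 b2.
  assert (HB := geometric_ge0 _ _ _ (Hc 0%nat)). simpl in HB. rewrite Rmult_1_r in HB.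
  assert (A1 := Cmod_ge_0 h1). assert (A2 := Cmod_ge_0 h2).
  assert (Q1 : 0 <= q * Cmod h1) by pos.
  assert (Q2 : 0 <= q * Cmod h2) by pos.
  assert (Qw' : q * Cmod (w + h2) <= / 12).
  { eapply Rle_trans; [apply Rmult_le_compat_l, Cmod_triangle; auto|auto]. }
  assert (Qz' : q * Cmod (z + h1) <= / 12).
  { eapply Rle_trans; [apply Rmult_le_compat_l, Cmod_triangle; auto|auto]. }
  assert (Gb : geometric (b w) (2 * B) q).
  { intros m. rewrite Rmult_assoc. apply (pser_bound (c m) (B * q ^ m) q); auto; lra. }
  assert (Gb1 : geometric (b1 w) (2 * (B * q)) q).
  { intros m. eapply Rle_trans; [apply (pser_bound (dcoef1 (c m)) (B * q ^ m * q) (2 * q)); try lra|].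
    - now apply dcoef1_geometric.
    - right; ring. }
  assert (Gb2 : geometric (b2 w) (2 * (2 * B * q ^ 2)) q).
  { intros m. eapply Rle_trans; [apply (pser_bound (dcoef2 (c m)) (2 * (B * q ^ m) * q ^ 2) (2 * q)); try lra|].
    - now apply dcoef2_geometric.
    - right; ring. }
  set (e := fun m => (b (w + h2)%C m - b w m - h2 * b1 w m - h2 ^ 2 * b2 w m)%C).
  assert (Ge : geometric e (16 * B * q ^ 3 * Cmod h2 ^ 3) q).
  { intros m. unfold e, b, b1, b2. eapply Rle_trans; [apply (pser_taylor (c m) (B * q ^ m) q); auto; lra|].
    right; ring. }
  assert (HE : pser (b (w + h2)%C) (z + h1) = (pser (b w) (z + h1) + (h2 * pser (b1 w) (z + h1)
     + (h2 ^ 2 * pser (b2 w) (z + h1) + pser e (z + h1))))%C).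
  { rewrite (pser_ext _ (fun m => b w m + (h2 * b1 w m + (h2 ^ 2 * b2 w m + e m)))%C).
    2: { intros m. unfold e. ring. }
    assert (S1 := geometric_scal _ _ _ h2 Gb1). assert (S2 := geometric_scal _ _ _ (h2 ^ 2)%C Gb2).
    assert (S3 := geometric_add _ _ _ _ _ S2 Ge). assert (S4 := geometric_add _ _ _ _ _ S1 S3).
    rewrite (pser_add _ _ _ _ _ _ Gb S4), (pser_add _ _ _ _ _ _ S1 S3), (pser_add _ _ _ _ _ _ S2 Ge),
      (pser_scal _ _ _ _ _ Gb1), (pser_scal _ _ _ _ _ Gb2); auto; lra. }
  assert (T0 := pser_taylor _ _ _ z h1 Gb Hq ltac:(lra)).
  assert (T1 := pser_taylor _ _ _ z h1 Gb1 Hq ltac:(lra)).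
  assert (T1' := pser_bound _ _ _ z (dcoef2_geometric _ _ _ Gb1 Hq) ltac:(lra) ltac:(lra)).
  assert (T2 := pser_lipschitz _ _ _ (z + h1) z Gb2 Hq ltac:(lra) ltac:(lra)).
  replace (z + h1 - z)%C with h1 in T2 by ring.
  assert (T3 := pser_bound _ _ _ (z + h1)%C Ge Hq ltac:(lra)).
  rewrite HE.
  match goal with |- Cmod ?x <= _ => replace x with
   ((pser (b w) (z + h1) - pser (b w) z - h1 * pser (dcoef1 (b w)) z - h1 ^ 2 * pser (dcoef2 (b w)) z)
    + h2 * (pser (b1 w) (z + h1) - pser (b1 w) z - h1 * pser (dcoef1 (b1 w)) z - h1 ^ 2 * pser (dcoef2 (b1 w)) z)
    + h2 * h1 ^ 2 * pser (dcoef2 (b1 w)) z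
    + h2 ^ 2 * (pser (b2 w) (z + h1) - pser (b2 w) z) + pser e (z + h1))%C by ring end.
  eapply Rle_trans.
  { apply Cmod_add_le; [apply Cmod_add_le; [apply Cmod_add_le; [apply Cmod_add_le|]|]|].
    - exact T0.
    - rewrite Cmod_mult. apply Rmult_le_compat_l; [auto|exact T1].
    - rewrite !Cmod_mult, Cmod_pow. apply Rmult_le_compat_l; [|exact T1'].
      apply Rmult_le_pos; auto. now apply pow_le.
    - rewrite Cmod_mult, Cmod_pow. apply Rmult_le_compat_l; [now apply pow_le|exact T2].
    - exact T3. }
  set (x := Cmod h1) in *. set (y := Cmod h2) in *. set (V := (x + y) ^ 3).
  assert (X3 : 0 <= x ^ 3) by pos.
  assert (Y3 : 0 <= y ^ 3) by pos.
  assert (X2Y : 0 <= x ^ 2 * y) by pos.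
  assert (XY2 : 0 <= x * y ^ 2) by pos.
  assert (EV : V = x ^ 3 + 3 * (x ^ 2 * y) + 3 * (x * y ^ 2) + y ^ 3) by (unfold V; ring).
  assert (X3Y : x ^ 3 * y <= x ^ 2 * y) by nra.
  assert (C3 : 0 <= B * q ^ 3) by pos.
  assert (C4 : 0 <= B * q ^ 4) by pos.
  assert (K1 : B * q ^ 3 * x ^ 3 <= B * q ^ 3 * V) by nra.
  assert (K2 : B * q ^ 3 * (x ^ 2 * y) <= B * q ^ 3 * V) by nra.
  assert (K3 : B * q ^ 3 * (x * y ^ 2) <= B * q ^ 3 * V) by nra.
  assert (K4 : B * q ^ 3 * y ^ 3 <= B * q ^ 3 * V) by nra.
  assert (K5 : B * q ^ 4 * (x ^ 3 * y) <= B * q ^ 4 * V) by nra.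
  clearbody V. clear - K1 K2 K3 K4 K5. lra.
Qed.

Lemma psum_const_bound (b : nat -> C) K n z : 0 <= K -> Cmod z <= 1 ->
  (forall i, (i < n)%nat -> Cmod (b i) <= K) -> Cmod (psum b n z) <= INR n * K.
Proof.
  intros HK Hz Hb. induction n as [|n IH].
  - simpl. rewrite Cmod_0. lra.
  - rewrite S_INR. simpl psum. eapply Rle_trans; [apply Cmod_triangle|].
    assert (E := pow_le1 (Cmod z) n (conj (Cmod_ge_0 z) Hz)).
    assert (Cmod (b n * z ^ n) <= K * 1).
    { rewrite Cmod_mult, Cmod_pow. apply Rmult_le_compat; auto using Cmod_ge_0; lra. }
    specialize (IH ltac:(intros; apply Hb; lia)). lra.
Qed.

Lemma order6_in_z_bound k : order6_in_z k -> exists K d, 0 <= K /\ 0 < d <= 1 /\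
  (forall z w, Cmod z < d -> Cmod w < d -> Cmod (k z w) <= K) /\
  (forall z w, Cmod z < d -> Cmod w < d ->
     Cmod (k z w - k (RtoC 0) (RtoC 0)) <= K * (Cmod z + Cmod w)).
Proof.
  intros (a & K & d & HK & Hd & H1 & H2 & H3).
  assert (Hpow : forall z, Cmod z < d -> Cmod z ^ 6 <= Cmod z).
  { intros z Hz. assert (Z := Cmod_ge_0 z).
    assert (E := pow_le1 (Cmod z) 5 ltac:(lra)). simpl in *. nra. }
  assert (Hk : forall z w, Cmod z < d -> Cmod w < d -> Cmod (k z w - a w 0%nat) <= 6 * K * Cmod z).
  { intros z w Hz Hw. specialize (H1 z w Hz Hw). specialize (Hpow z Hz).
    assert (Z := Cmod_ge_0 z).
    assert (E : psum (a w) 6 z = (a w 0%nat + z * psum (fun n => a w (S n)) 5 z)%C) by (simpl; ring).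
    assert (B := psum_const_bound (fun n => a w (S n)) K 5 z HK ltac:(lra)
      ltac:(intros; apply H2; auto; lia)). replace (INR 5) with 5 in B by (simpl; ring).
    replace (k z w - a w 0%nat)%C with ((k z w - psum (a w) 6 z)
      + z * psum (fun n => a w (S n)) 5 z)%C by (rewrite E; ring).
    eapply Rle_trans; [apply Cmod_triangle|]. rewrite Cmod_mult.
    apply (Rmult_le_compat_l (Cmod z)) in B; auto.
    apply (Rmult_le_compat_l K) in Hpow; auto. lra. }
  exists (12 * K), d. split; [lra|split; [auto|split]].
  - intros z w Hz Hw. specialize (Hk z w Hz Hw).
    assert (B := H2 w 0%nat Hw ltac:(lia)).
    replace (k z w) with ((k z w - a w 0%nat) + a w 0%nat)%C by ring.
    eapply Rle_trans; [apply Cmod_triangle|]. assert (K * Cmod z <= K * 1) by nra. lra.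
  - intros z w Hz Hw. assert (A := Hk z w Hz Hw).
    assert (Z0 : Cmod (RtoC 0) < d) by (rewrite Cmod_0; lra).
    assert (A0 := Hk (RtoC 0) (RtoC 0) Z0 Z0). rewrite Cmod_0 in A0.
    assert (B := H3 w (RtoC 0) 0%nat Hw Z0 ltac:(lia)).
    replace (w - 0)%C with w in B by ring.
    replace (k z w - k (RtoC 0) (RtoC 0))%C with
     ((k z w - a w 0%nat) + (a w 0%nat - a (RtoC 0) 0%nat)
       + - (k (RtoC 0) (RtoC 0) - a (RtoC 0) 0%nat))%C by ring.
    eapply Rle_trans; [apply Cmod_add_le; [apply Cmod_triangle|rewrite Cmod_opp; apply Rle_refl]|].
    assert (0 <= K * Cmod z) by pos.
    assert (0 <= K * Cmod w) by pos. lra.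
Qed.

(** The function g i j is the Taylor coefficient of bidegree (i, j), i + j = 1 or 2, at
    the displaced point x; the constants are uniform in x. *)
Theorem holomorphic2_taylor f p : holomorphic2_at f p ->
  exists g : nat -> nat -> C -> C -> C, (forall i j, order6_in_z (g i j)) /\
  exists K d, 0 <= K /\ 0 < d <= 1 /\
    (forall i j z w, Cmod z < d -> Cmod w < d -> Cmod (g i j z w) <= K) /\
    forall x h, size2 x < d -> size2 h < d ->
    let D i j := g i j (fst x) (snd x) in
    Cmod (f (shift p (shift x h)) - f (shift p x)
          - (D 1%nat 0%nat * fst h + D 0%nat 1%nat * snd h + D 2%nat 0%nat * fst h ^ 2
             + D 1%nat 1%nat * fst h * snd h + D 0%nat 2%nat * snd h ^ 2))
      <= K * size2 h ^ 3.
Proof.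
  intros H. destruct (holomorphic2_double_series f p H) as (c & B & q & d & Hq & Hd & Hc & Hf).
  assert (HB := geometric_ge0 _ _ _ (Hc 0%nat)). simpl in HB. rewrite Rmult_1_r in HB.
  set (b w m := pser (c m) w).
  set (b1 w m := pser (dcoef1 (c m)) w).
  set (b2 w m := pser (dcoef2 (c m)) w).
  assert (P : forall m, 0 <= q ^ m <= (2 * q) ^ m).
  { intros m. split; [now apply pow_le|]. apply pow_incr; lra. }
  assert (F0 : analytic_family b) by now apply (analytic_family_series c B q).
  assert (F1 : analytic_family b1).
  { apply (analytic_family_series (fun m => dcoef1 (c m)) (B * q) (2 * q)); [lra|].
    intros m. apply geometric_mono with (B * q ^ m * q); [now apply dcoef1_geometric| |lra].
    destruct (P m). replace (B * q ^ m * q) with (B * q * q ^ m) by ring.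
    apply Rmult_le_compat_l; auto. now apply Rmult_le_pos. }
  assert (F2 : analytic_family b2).
  { apply (analytic_family_series (fun m => dcoef2 (c m)) (2 * B * q ^ 2) (2 * q)); [lra|].
    intros m. apply geometric_mono with (2 * (B * q ^ m) * q ^ 2); [now apply dcoef2_geometric| |lra].
    destruct (P m). replace (2 * (B * q ^ m) * q ^ 2) with (2 * B * q ^ 2 * q ^ m) by ring.
    apply Rmult_le_compat_l; auto. apply Rmult_le_pos; [lra|now apply pow_le]. }
  exists (fun i j => match i, j with
    | 1%nat, 0%nat => fun z w => pser (dcoef1 (b w)) z
    | 2%nat, 0%nat => fun z w => pser (dcoef2 (b w)) z
    | 0%nat, 1%nat => fun z w => pser (b1 w) z
    | 1%nat, 1%nat => fun z w => pser (dcoef1 (b1 w)) z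
    | _, _ => fun z w => pser (b2 w) z end).
  assert (R2 := analytic_family_order6_in_z _ F2).
  assert (R1 := analytic_family_order6_in_z _ F1).
  assert (R11 := analytic_family_order6_in_z _ (analytic_family_dcoef1 _ F1)).
  assert (R10 := analytic_family_order6_in_z _ (analytic_family_dcoef1 _ F0)).
  assert (R20 := analytic_family_order6_in_z _ (analytic_family_dcoef2 _ F0)).
  split.
  { intros [|[|[|i]]] [|[|j]]; assumption. }
  destruct (order6_in_z_bound _ R2) as (K2 & d2 & HK2 & Hd2 & B2 & _).
  destruct (order6_in_z_bound _ R1) as (K1 & d1 & HK1 & Hd1 & B1 & _).
  destruct (order6_in_z_bound _ R11) as (K11 & d11 & HK11 & Hd11 & B11 & _).
  destruct (order6_in_z_bound _ R10) as (K10 & d10 & HK10 & Hd10 & B10 & _).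
  destruct (order6_in_z_bound _ R20) as (K20 & d20 & HK20 & Hd20 & B20 & _).
  set (e' := Rmin (Rmin (d / 2) 1) (/ (24 * (q + 1)))).
  set (e := Rmin e' (Rmin d2 (Rmin d1 (Rmin d11 (Rmin d10 d20))))).
  assert (N1 : e <= e' /\ e <= d2 /\ e <= d1 /\ e <= d11 /\ e <= d10 /\ e <= d20).
  { unfold e.
    generalize (Rmin_l e' (Rmin d2 (Rmin d1 (Rmin d11 (Rmin d10 d20)))))
      (Rmin_r e' (Rmin d2 (Rmin d1 (Rmin d11 (Rmin d10 d20)))))
      (Rmin_l d2 (Rmin d1 (Rmin d11 (Rmin d10 d20)))) (Rmin_r d2 (Rmin d1 (Rmin d11 (Rmin d10 d20))))
      (Rmin_l d1 (Rmin d11 (Rmin d10 d20))) (Rmin_r d1 (Rmin d11 (Rmin d10 d20)))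
      (Rmin_l d11 (Rmin d10 d20)) (Rmin_r d11 (Rmin d10 d20)) (Rmin_l d10 d20) (Rmin_r d10 d20).
    lra. }
  set (K0 := 88 * B * q ^ 3 + 32 * B * q ^ 4).
  assert (HK0 : 0 <= K0).
  { assert (0 <= B * q ^ 3) by pos.
    assert (0 <= B * q ^ 4) by pos. unfold K0; lra. }
  exists (K0 + K2 + K1 + K11 + K10 + K20), e.
  assert (M0 : 0 < / (24 * (q + 1))) by pos.
  assert (M1 : e <= Rmin (d / 2) 1) by (apply Rle_trans with e'; [lra|apply Rmin_l]).
  assert (M2 : e <= / (24 * (q + 1))) by (apply Rle_trans with e'; [lra|apply Rmin_r]).
  assert (M3 := Rmin_l (d / 2) 1). assert (He : 0 < e).
  { unfold e. repeat apply Rmin_pos; lra. }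
  split; [lra|split; [lra|split]].
  { intros i j z w Hz Hw.
    specialize (B2 z w ltac:(lra) ltac:(lra)). specialize (B1 z w ltac:(lra) ltac:(lra)).
    specialize (B11 z w ltac:(lra) ltac:(lra)). specialize (B10 z w ltac:(lra) ltac:(lra)).
    specialize (B20 z w ltac:(lra) ltac:(lra)). cbv beta in *.
    destruct i as [|[|[|i]]], j as [|[|j]]; lra. }
  intros [z w] [h1 h2] Hx Hh.
  assert (Hxh := size2_shift (z, w) (h1, h2)).
  rewrite !Hf by lra. unfold size2, shift in *. cbn [fst snd] in *.
  generalize (Cmod_ge_0 z) (Cmod_ge_0 w) (Cmod_ge_0 h1) (Cmod_ge_0 h2). intros.
  assert (Hs : q * (2 * e) <= / 12).
  { apply Rle_trans with ((q + 1) * (2 * / (24 * (q + 1)))); [|right; field; lra].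
    apply Rmult_le_compat; lra. }
  assert (Hs2 : forall s, s <= 2 * e -> q * s <= / 12).
  { intros s Hs3. eapply Rle_trans; [apply Rmult_le_compat_l|]; eauto. }
  eapply Rle_trans; [apply (pser_taylor_family c B q z w h1 h2); auto; try (apply Hs2); lra|].
  apply Rmult_le_compat_r; [apply pow_le; lra|unfold K0; lra].
Qed.

(** * Expansions of order six in the first variable *)

Lemma csum_bound n (f : nat -> C) K : (forall i, (i < n)%nat -> Cmod (f i) <= K) ->
  Cmod (csum n f) <= INR n * K.
Proof.
  intros H. induction n as [|n IH].
  - simpl. rewrite Cmod_0. lra.
  - rewrite S_INR. simpl. eapply Rle_trans; [apply Cmod_triangle|].
    specialize (IH ltac:(intros; apply H; lia)). specialize (H n ltac:(lia)). lra.
Qed.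

Lemma order6_in_z_sub k l : order6_in_z k -> order6_in_z l -> order6_in_z (fun z w => k z w - l z w)%C.
Proof.
  intros (a & K & d & HK & Hd & H1 & H2 & H3) (a' & K' & d' & HK' & Hd' & H1' & H2' & H3').
  assert (M1 := Rmin_l d d'). assert (M2 := Rmin_r d d').
  exists (fun w n => a w n - a' w n)%C, (K + K'), (Rmin d d').
  split; [lra|split; [split; [apply Rmin_pos; lra|lra]|]].
  split; [|split].
  - intros z w Hz Hw. rewrite psum_sub, Rmult_plus_distr_r.
    replace (k z w - l z w - (psum (a w) 6 z - psum (a' w) 6 z))%C with
      ((k z w - psum (a w) 6 z) + - (l z w - psum (a' w) 6 z))%C by ring.
    apply Cmod_add_le; [apply H1|rewrite Cmod_opp; apply H1']; lra.
  - intros w n Hw Hn. unfold Cminus. apply Cmod_add_le; [|rewrite Cmod_opp]; auto;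
      [apply H2|apply H2']; auto; lra.
  - intros w w' n Hw Hw' Hn. rewrite Rmult_plus_distr_r.
    replace (a w n - a' w n - (a w' n - a' w' n))%C with
      ((a w n - a w' n) + - (a' w n - a' w' n))%C by ring.
    apply Cmod_add_le; [apply H3|rewrite Cmod_opp; apply H3']; auto; lra.
Qed.

(** Multiply the two polynomials in z; the terms of degree at least six go into
    the remainder. *)
Lemma order6_in_z_mul k l : order6_in_z k -> order6_in_z l -> order6_in_z (fun z w => k z w * l z w)%C.
Proof.
  intros Hk Hl.
  destruct (order6_in_z_bound _ Hk) as (Bk & dk & HBk & Hdk & Bk1 & _).
  revert Hk Hl.
  intros (a & K & d & HK & Hd & H1 & H2 & H3) (b & L & d' & HL & Hd' & H1' & H2' & H3').
  set (m := Rmin dk (Rmin d d')).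
  assert (M0 : m <= Rmin d d') by apply Rmin_r. assert (M3 : m <= dk) by apply Rmin_l.
  assert (M1 := Rmin_l d d'). assert (M2 := Rmin_r d d').
  assert (HKL : 0 <= K * L) by now apply Rmult_le_pos.
  assert (HBL : 0 <= Bk * L) by now apply Rmult_le_pos.
  assert (Hab : forall w i j, Cmod w < m -> (i < 6)%nat -> (j < 6)%nat ->
    Cmod (a w i * b w j) <= K * L).
  { intros w i j Hw Hi Hj. apply Cmod_mult_le; [apply H2|apply H2']; auto; lra. }
  exists (fun w n => csum (S n) (fun i => a w i * b w (n - i)%nat)%C),
    (25 * (K * L) + Bk * L + 6 * K * L + 12 * (K * L)), m.
  split; [lra|split; [split; [unfold m; repeat apply Rmin_pos; lra|lra]|]].
  split; [|split].
  - intros z w Hz Hw. assert (Z := Cmod_ge_0 z).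
    set (c := fun n => csum (5 - n) (fun i => a w (S (n + i))%nat * b w (5 - i)%nat)%C).
    assert (E : (psum (a w) 6 z * psum (b w) 6 z = z ^ 6 * psum c 5 z +
       psum (fun n => csum (S n) (fun i => a w i * b w (n - i)%nat)%C) 6 z)%C).
    { unfold c. simpl. ring. }
    assert (Hc : Cmod (psum c 5 z) <= INR 5 * (INR 5 * (K * L))).
    { apply psum_const_bound; [apply Rmult_le_pos; auto; apply pos_INR|lra|]. intros i Hi. unfold c.
      eapply Rle_trans; [apply csum_bound; intros j Hj; apply Hab; auto; lia|].
      apply Rmult_le_compat_r; auto. apply le_INR. lia. }
    replace (INR 5) with 5 in Hc by (simpl; ring).
    match goal with |- Cmod ?x <= _ => replace x with
      (z ^ 6 * psum c 5 z + k z w * (l z w - psum (b w) 6 z)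
       + (k z w - psum (a w) 6 z) * psum (b w) 6 z)%C end.
    2: { match goal with |- _ = (_ - ?s)%C => set (S := s) in * end.
         replace S with (psum (a w) 6 z * psum (b w) 6 z - z ^ 6 * psum c 5 z)%C by
           (rewrite E; ring). ring. }
    assert (Hb6 : Cmod (psum (b w) 6 z) <= INR 6 * L).
    { apply psum_const_bound; auto; [lra|]. intros; apply H2'; auto; lra. }
    replace (INR 6) with 6 in Hb6 by (simpl; ring).
    assert (Z6 : 0 <= Cmod z ^ 6) by now apply pow_le.
    assert (G1 := H1 z w ltac:(lra) ltac:(lra)). assert (G2 := H1' z w ltac:(lra) ltac:(lra)).
    assert (G3 := Bk1 z w ltac:(lra) ltac:(lra)).
    eapply Rle_trans.
    { apply Cmod_add_le; [apply Cmod_add_le|].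
      - rewrite Cmod_mult, Cmod_pow. apply Rmult_le_compat_l; [auto|exact Hc].
      - apply Cmod_mult_le; [exact G3|exact G2].
      - apply Cmod_mult_le; [exact G1|exact Hb6]. }
    assert (0 <= K * L * Cmod z ^ 6) by now apply Rmult_le_pos. lra.
  - intros w n Hw Hn.
    eapply Rle_trans; [apply csum_bound; intros j Hj; apply Hab; auto; lia|].
    apply Rle_trans with (6 * (K * L)); [|lra].
    apply Rmult_le_compat_r; auto. replace 6 with (INR 6) by (simpl; ring).
    apply le_INR. lia.
  - intros w w' n Hw Hw' Hn.
    assert (E : forall i, (a w i * b w (n - i)%nat)%C = (a w' i * b w' (n - i)%nat
      + ((a w i - a w' i) * b w (n - i)%nat + a w' i * (b w (n - i)%nat - b w' (n - i)%nat)))%C)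
      by (intros; ring).
    rewrite (csum_ext _ _ _ E), csum_add.
    match goal with |- Cmod ?x <= _ => match x with (?s + ?r - ?s')%C =>
      replace x with r by ring end end.
    assert (X := Cmod_ge_0 (w - w')).
    assert (KX : 0 <= K * L * Cmod (w - w')) by now apply Rmult_le_pos.
    eapply Rle_trans; [apply (csum_bound _ _ (2 * (K * L * Cmod (w - w'))))|].
    + intros i Hi.
      replace (2 * (K * L * Cmod (w - w'))) with
        (K * Cmod (w - w') * L + K * (L * Cmod (w - w'))) by ring.
      apply Cmod_add_le; apply Cmod_mult_le.
      * apply H3; auto; try lra; lia.
      * apply H2'; try lra; lia.
      * apply H2; try lra; lia.
      * apply H3'; auto; try lra; lia.
    + apply Rle_trans with (6 * (2 * (K * L * Cmod (w - w')))).
      * apply Rmult_le_compat_r; [lra|]. replace 6 with (INR 6) by (simpl; ring).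
        apply le_INR. lia.
      * assert (0 <= Bk * L * Cmod (w - w')) by now apply Rmult_le_pos. lra.
Qed.

(** For k = z^n this is (1 - i^n + (-1)^n - (-i)^n) x^n. *)
Definition four_point (k : C -> C -> C) (x : R) (w : C) : C :=
  (k (RtoC x) w - k (Ci * RtoC x) w + k (- RtoC x) w - k (- (Ci * RtoC x)) w)%C.

(** Among the powers z^0, ..., z^5 only z^2 has a nonzero alternating sum, namely 4 x^2. *)
Lemma order6_in_z_four_point k : order6_in_z k -> exists (c : C -> C) K d, 0 <= K /\ 0 < d /\
  (forall x w, 0 < x < d -> Cmod w < d ->
     Cmod (four_point k x w - RtoC 4 * c w * RtoC (x ^ 2)) <= K * x ^ 6) /\
  (forall w w', Cmod w < d -> Cmod w' < d -> Cmod (c w - c w') <= K * Cmod (w - w')).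
Proof.
  intros (a & K & d & HK & Hd & H1 & H2 & H3).
  exists (fun w => a w 2%nat), (4 * K), d. split; [lra|split; [lra|split]].
  - intros x w Hx Hw. unfold four_point.
    set (X := RtoC x).
    assert (HX : Cmod X = x) by (unfold X; apply Cmod_R_nonneg; lra).
    assert (E : (psum (a w) 6 X - psum (a w) 6 (Ci * X) + psum (a w) 6 (- X)
      - psum (a w) 6 (- (Ci * X)) = RtoC 4 * a w 2%nat * RtoC (x ^ 2))%C).
    { rewrite RtoC_pow. fold X. simpl psum.
      assert (C2 : (Ci * Ci = - (1))%C) by (apply injective_projections; simpl; ring).
      generalize (a w 0%nat) (a w 1%nat) (a w 2%nat) (a w 3%nat) (a w 4%nat) (a w 5%nat).
      intros a0 a1 a2 a3 a4 a5.
      transitivity ((RtoC 2 * a2 * X ^ 2 * (1 - Ci * Ci)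
         + RtoC 2 * a4 * X ^ 4 * (1 - (Ci * Ci) * (Ci * Ci))))%C; [simpl; ring|].
      rewrite C2. ring. }
    rewrite <- E.
    assert (N1 : Cmod (Ci * X) = x) by (rewrite Cmod_mult, Cmod_Ci; lra).
    assert (N2 : Cmod (- X) = x) by now rewrite Cmod_opp.
    assert (N3 : Cmod (- (Ci * X)) = x) by now rewrite Cmod_opp.
    assert (G0 := H1 X w ltac:(lra) Hw). assert (G1 := H1 (Ci * X)%C w ltac:(lra) Hw).
    assert (G2 := H1 (- X)%C w ltac:(lra) Hw). assert (G3 := H1 (- (Ci * X))%C w ltac:(lra) Hw).
    rewrite HX in G0. rewrite N1 in G1. rewrite N2 in G2. rewrite N3 in G3.
    match goal with |- Cmod ?y <= _ => replace y with
      ((k X w - psum (a w) 6 X) + - (k (Ci * X)%C w - psum (a w) 6 (Ci * X))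
       + (k (- X)%C w - psum (a w) 6 (- X)) + - (k (- (Ci * X))%C w - psum (a w) 6 (- (Ci * X))))%C
      by ring end.
    replace (4 * K * x ^ 6) with (K * x ^ 6 + K * x ^ 6 + K * x ^ 6 + K * x ^ 6) by ring.
    repeat apply Cmod_add_le; rewrite ?Cmod_opp; auto.
  - intros w w' Hw Hw'. specialize (H3 w w' 2%nat Hw Hw' ltac:(lia)).
    assert (0 <= K * Cmod (w - w')) by (apply Rmult_le_pos; auto using Cmod_ge_0). lra.
Qed.

(** * Support by the tangent hyperplane of a convex image *)

Definition diff (q p : C * C) : C * C := ((fst q - fst p)%C, (snd q - snd p)%C).

Lemma shift_diff p q : shift p (diff q p) = q.
Proof. destruct q; unfold shift, diff; simpl; f_equal; ring. Qed.

Lemma diff_shift p h : diff (shift p h) p = h.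
Proof. destruct h; unfold shift, diff; simpl; f_equal; ring. Qed.

Lemma shift_0 p : shift p (RtoC 0, RtoC 0) = p.
Proof. destruct p; unfold shift; simpl; f_equal; ring. Qed.

Definition lin (a b : C) (h : C * C) : C := (a * fst h + b * snd h)%C.

Lemma lin_bound a b h : Cmod (lin a b h) <= (Cmod a + Cmod b) * size2 h.
Proof.
  unfold lin, size2. eapply Rle_trans; [apply Cmod_triangle|]. rewrite !Cmod_mult.
  generalize (Cmod_ge_0 a) (Cmod_ge_0 b) (Cmod_ge_0 (fst h)) (Cmod_ge_0 (snd h)). nra.
Qed.

Definition taylor2_at (f : C * C -> C) (p : C * C) (c : nat -> nat -> C) : Prop :=
  exists K d, 0 <= K /\ 0 < d <= 1 /\ forall h, size2 h < d ->
    Cmod (f (shift p h) - f p - lin (c 1%nat 0%nat) (c 0%nat 1%nat) h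
          - bform (c 2%nat 0%nat) (c 1%nat 1%nat) (c 0%nat 2%nat) h h) <= K * size2 h ^ 3.

Lemma taylor2_first_order f p c : taylor2_at f p c -> exists K d, 0 <= K /\ 0 < d <= 1 /\
  forall h, size2 h < d ->
    Cmod (f (shift p h) - f p - lin (c 1%nat 0%nat) (c 0%nat 1%nat) h) <= K * size2 h ^ 2.
Proof.
  intros (K & d & HK & Hd & H).
  set (S := Cmod (c 2%nat 0%nat) + Cmod (c 1%nat 1%nat) + Cmod (c 0%nat 2%nat)).
  assert (HS : 0 <= S) by (unfold S; generalize (Cmod_ge_0 (c 2%nat 0%nat))
    (Cmod_ge_0 (c 1%nat 1%nat)) (Cmod_ge_0 (c 0%nat 2%nat)); lra).
  exists (K + S), d. split; [lra|split; auto]. intros h Hh. specialize (H h Hh).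
  assert (B := bform_bound (c 2%nat 0%nat) (c 1%nat 1%nat) (c 0%nat 2%nat) h h). fold S in B.
  assert (E : size2 h ^ 3 <= size2 h ^ 2) by nra.
  apply (Rmult_le_compat_l K) in E; auto.
  set (b := bform _ _ _ h h) in *. set (l := lin _ _ h) in *.
  replace (f (shift p h) - f p - l)%C with ((f (shift p h) - f p - l - b) + b)%C by ring.
  eapply Rle_trans; [apply Cmod_add_le; [exact H|exact B]|]. simpl in *. lra.
Qed.

Lemma holomorphic2_taylor2 f p : holomorphic2_at f p -> exists c, taylor2_at f p c.
Proof.
  intros H. destruct (holomorphic2_taylor f p H) as (g & _ & K & d & HK & Hd & _ & HT).
  exists (fun i j => g i j (RtoC 0) (RtoC 0)), K, d. split; [lra|split; [auto|]].
  intros h Hh. assert (H0 : size2 (RtoC 0, RtoC 0) < d) by (unfold size2; simpl; rewrite Cmod_0; lra).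
  specialize (HT _ h H0 Hh). cbv zeta in HT. rewrite shift_0 in HT. cbn [fst snd] in HT.
  replace (shift (RtoC 0, RtoC 0) h) with h in HT
    by (destruct h; unfold shift; simpl; f_equal; ring).
  eapply Rle_trans; [|exact HT]. right. f_equal. unfold lin, bform. ring.
Qed.

Lemma holomorphic_first_order W Phi p : holomorphic_on W Phi -> W p ->
  exists a b c e K d, 0 <= K /\ 0 < d <= 1 /\ forall h, size2 h < d ->
    size2 (diff (diff (Phi (shift p h)) (Phi p)) (lin a b h, lin c e h)) <= K * size2 h ^ 2.
Proof.
  intros HW Wp. destruct (HW p Wp) as [H1 H2].
  destruct (holomorphic2_taylor2 _ _ H1) as [c1 T1].
  destruct (holomorphic2_taylor2 _ _ H2) as [c2 T2].
  apply taylor2_first_order in T1 as (K & d & HK & Hd & H).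
  apply taylor2_first_order in T2 as (K' & d' & HK' & Hd' & H').
  exists (c1 1%nat 0%nat), (c1 0%nat 1%nat), (c2 1%nat 0%nat), (c2 0%nat 1%nat), (K + K'), (Rmin d d').
  assert (M1 := Rmin_l d d'). assert (M2 := Rmin_r d d').
  split; [lra|split; [split; [apply Rmin_pos; lra|lra]|]]. intros h Hh.
  unfold size2 at 1. unfold diff. cbn [fst snd].
  rewrite Rmult_plus_distr_r. apply Rplus_le_compat; [apply H|apply H']; lra.
Qed.

Lemma size2_triangle x y : size2 x <= size2 (diff x y) + size2 y.
Proof. rewrite <- (shift_diff y x) at 1. eapply Rle_trans; [apply size2_shift|lra]. Qed.

Lemma holomorphic_lipschitz W Phi p : holomorphic_on W Phi -> W p ->
  exists K d, 0 <= K /\ 0 < d /\ forall h, size2 h < d ->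
    size2 (diff (Phi (shift p h)) (Phi p)) <= K * size2 h.
Proof.
  intros HW Wp.
  destruct (holomorphic_first_order W Phi p HW Wp) as (a & b & c & e & K & d & HK & Hd & H).
  set (S := Cmod a + Cmod b + (Cmod c + Cmod e)).
  assert (HS : 0 <= S) by (unfold S; generalize (Cmod_ge_0 a) (Cmod_ge_0 b) (Cmod_ge_0 c)
    (Cmod_ge_0 e); lra).
  exists (K + S), d. split; [lra|split; [lra|]]. intros h Hh. specialize (H h Hh).
  assert (Hn := size2_ge0 h).
  eapply Rle_trans; [apply (size2_triangle _ (lin a b h, lin c e h))|].
  assert (size2 (lin a b h, lin c e h) <= S * size2 h).
  { unfold size2 at 1; cbn [fst snd]. unfold S. rewrite Rmult_plus_distr_r.
    apply Rplus_le_compat; apply lin_bound. }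
  assert (E : size2 h ^ 2 <= size2 h) by nra.
  apply (Rmult_le_compat_l K) in E; auto. lra.
Qed.

Lemma rho_first_order a p : exists K, 0 <= K /\ forall h, size2 h <= 1 ->
  Rabs (rho_M a (shift p h) - rho_M a p - Re (drho a p h)) <= K * size2 h ^ 2.
Proof.
  destruct (rho_taylor a p) as (K & HK & H). exists (2 * K). split; [lra|].
  intros h Hh. destruct (H h Hh) as (_ & H2 & H3). assert (E : size2 h ^ 3 <= size2 h ^ 2) by nra.
  apply (Rmult_le_compat_l K) in E; auto. fold (shift p h) in H3.
  apply Rabs_le_between in H2, H3. apply Rabs_le_between. lra.
Qed.

Lemma rho_lipschitz a p : exists K, 0 <= K /\ forall h, size2 h <= 1 ->
  Rabs (rho_M a (shift p h) - rho_M a p) <= K * size2 h.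
Proof.
  destruct (rho_first_order a p) as (K & HK & H). destruct (drho_bound a p) as (D & HD & H').
  exists (K + D). split; [lra|]. intros h Hh. specialize (H h Hh). specialize (H' h).
  assert (H2 := Rle_trans _ _ _ (re_le_Cmod _) H'). assert (Hn := size2_ge0 h).
  assert (E : size2 h ^ 2 <= size2 h) by nra.
  apply (Rmult_le_compat_l K) in E; auto.
  apply Rabs_le_between in H, H2. apply Rabs_le_between. lra.
Qed.

Lemma rho_normal a p e : rho_M a (shift p (RtoC 0, (0, e))) = rho_M a p - e.
Proof.
  unfold rho_M, shift. destruct p as [z [u v]]. cbn [fst snd].
  replace (z + 0)%C with z by ring. simpl.
  replace (u + 0) with u by ring. unfold Im, Re; simpl. ring.
Qed.

(** If the differential of rho at p were positive on Phi q - Phi p, the segment from Phi p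
    to Phi q would start on the wrong side of M. But it is a limit of segments that join
    Phi q to images of points of the convex side close to p, and those stay in the
    image of that side.

    The sign s selects the side {s rho < 0}; the coefficients b describe the
    differential of Psi at Phi p. *)
Theorem support_inequality a s p U Phi Psi b11 b12 b21 b22 K0 d0 :
  s * s = 1 -> open U -> U p -> holomorphic_on U Phi -> open (image Phi U) ->
  holomorphic_on (image Phi U) Psi -> (forall q, U q -> Psi (Phi q) = q) ->
  0 <= K0 -> 0 < d0 ->
  (forall k, size2 k < d0 ->
     size2 (diff (diff (Psi (shift (Phi p) k)) p) (lin b11 b12 k, lin b21 b22 k)) <= K0 * size2 k ^ 2) ->
  convex_set (image Phi (fun q => U q /\ s * rho_M a q < 0)) -> rho_M a p = 0 ->
  forall q, U q -> s * rho_M a q < 0 ->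
    let k := diff (Phi q) (Phi p) in s * Re (drho a p (lin b11 b12 k, lin b21 b22 k)) <= 0.
Proof.
  intros Hs HU Up HPhi HI HPsi Hinv HK0 Hd0 HB Hconv Hp q Uq Hq k.
  assert (Hs1 : Rabs s = 1).
  { destruct (Rle_lt_dec 0 s); [rewrite Rabs_pos_eq; nra|rewrite Rabs_left; nra]. }
  apply Rnot_lt_le. intros HD. set (Bk := (lin b11 b12 k, lin b21 b22 k)) in *.
  set (D := s * Re (drho a p Bk)) in *.
  assert (Ip : image Phi U (Phi p)) by now exists p.
  destruct (proj1 (locally_shift _ _) (HI _ Ip)) as (dI & HdI & HIm).
  destruct (rho_first_order a p) as (K1 & HK1 & Hrho).
  destruct (drho_bound a p) as (D1 & HD1 & HL).
  set (S := size2 k). assert (HS : 0 <= S) by pos.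
  set (N := size2 Bk + K0 * S ^ 2).
  assert (HS2 : 0 <= S ^ 2) by pos.
  assert (HKS : 0 <= K0 * S ^ 2) by pos.
  assert (HBk : 0 <= size2 Bk) by pos.
  assert (HN : 0 <= N) by (unfold N; lra).
  set (Ct := D1 * (K0 * S ^ 2) + K1 * N ^ 2).
  assert (HCt : 0 <= Ct).
  { unfold Ct. assert (0 <= D1 * (K0 * S ^ 2)) by pos.
    assert (0 <= K1 * N ^ 2) by pos. lra. }
  assert (Hpos : forall x y, 0 <= x -> 0 < y -> 0 <= x / y).
  { intros x y Hx Hy. apply Rmult_le_pos; auto. left. now apply Rinv_0_lt_compat. }
  set (X := 1 + S / d0 + S / dI + N + Ct / D).
  assert (X1 := Hpos S d0 HS Hd0). assert (X2 := Hpos S dI HS HdI). assert (X3 := Hpos Ct D HCt HD).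
  assert (HX : 1 <= X) by (unfold X; lra).
  set (t := / (2 * X)).
  assert (Ht : 0 < t) by (apply Rinv_0_lt_compat; lra).
  assert (HtX : forall x, x <= X -> t * x <= / 2).
  { intros x Hx. apply Rle_trans with (t * X); [apply Rmult_le_compat_l; lra|].
    right. unfold t. field. lra. }
  assert (Ht1 : t <= / 2) by (generalize (HtX 1 HX); lra).
  assert (T0 : t * S < d0).
  { assert (E := HtX (S / d0) ltac:(unfold X; lra)).
    replace (t * S) with (t * (S / d0) * d0) by (field; lra). nra. }
  assert (TI : t * S < dI).
  { assert (E := HtX (S / dI) ltac:(unfold X; lra)).
    replace (t * S) with (t * (S / dI) * dI) by (field; lra). nra. }
  assert (TN : t * N <= / 2) by (apply HtX; unfold X; lra).
  assert (TD : t * Ct < D).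
  { assert (E := HtX (Ct / D) ltac:(unfold X; lra)).
    replace (t * Ct) with (t * (Ct / D) * D) by (field; lra). nra. }
  set (tk := scal2 (RtoC t) k).
  assert (Htk : size2 tk = t * S) by (unfold tk; rewrite size2_scal, Cmod_R_nonneg; auto; lra).
  set (Q := shift (Phi p) tk).
  destruct (HIm tk ltac:(rewrite Htk; auto)) as (q' & Uq' & Eq'). fold Q in Eq'.
  assert (EQ : Psi Q = q') by (rewrite <- Eq'; auto).
  (* by the first order expansion q' lies on the wrong side of the hypersurface *)
  assert (HV : 0 < s * rho_M a q').
  { assert (HB' := HB tk ltac:(rewrite Htk; auto)). fold Q in HB'. rewrite EQ, Htk in HB'.
    set (h := diff q' p) in *.
    replace (lin b11 b12 tk, lin b21 b22 tk) with (scal2 (RtoC t) Bk) in HB'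
      by (unfold Bk, tk, scal2, lin; cbn [fst snd]; f_equal; ring).
    set (e := diff h (scal2 (RtoC t) Bk)) in *.
    assert (Eh : h = shift (scal2 (RtoC t) Bk) e) by (symmetry; apply shift_diff).
    assert (Hh : size2 h <= t * N).
    { rewrite Eh. eapply Rle_trans; [apply size2_shift|].
      rewrite size2_scal, Cmod_R_nonneg by lra. unfold N.
      assert (K0 * (t * S) ^ 2 <= t * (K0 * S ^ 2)).
      { replace (K0 * (t * S) ^ 2) with (t * (t * (K0 * S ^ 2))) by ring.
        apply Rmult_le_compat_l; [lra|]. rewrite <- (Rmult_1_l (K0 * S ^ 2)) at 2.
        apply Rmult_le_compat_r; lra. }
      lra. }
    assert (Hr := Hrho h ltac:(lra)). unfold h in Hr at 1. rewrite shift_diff, Hp in Hr.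
    assert (Ed : drho a p h = (RtoC t * drho a p Bk + drho a p e)%C)
      by (rewrite Eh, drho_shift, drho_scal; auto).
    assert (He : Rabs (Re (drho a p e)) <= D1 * (K0 * (t * S) ^ 2)).
    { eapply Rle_trans; [apply re_le_Cmod|]. eapply Rle_trans; [apply HL|].
      now apply Rmult_le_compat_l. }
    assert (ERe : Re (drho a p h) = t * Re (drho a p Bk) + Re (drho a p e)).
    { rewrite Ed. generalize (drho a p Bk) (drho a p e). intros [? ?] [? ?].
      unfold Re; simpl. ring. }
    assert (Hn2 : K1 * size2 h ^ 2 <= K1 * (t * N) ^ 2).
    { apply Rmult_le_compat_l; auto. apply pow_incr. split; [apply size2_ge0|auto]. }
    assert (Hsx : forall x y, Rabs x <= y -> - y <= s * x).
    { intros x y Hxy. assert (E : Rabs (s * x) <= y) by (rewrite Rabs_mult, Hs1; lra).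
      apply Rabs_le_between in E. lra. }
    apply Hsx in Hr. apply Hsx in He.
    assert (t * t * Ct < t * D) by nra.
    replace (s * rho_M a q') with (s * (rho_M a q' - 0 - Re (drho a p h)) + s * Re (drho a p h))
      by ring.
    rewrite ERe at 2.
    replace (s * (t * Re (drho a p Bk) + Re (drho a p e))) with (t * D + s * Re (drho a p e))
      by (unfold D; ring).
    unfold Ct in *. lra. }
  (* points of the convex set on the segments from Phi q to Phi (p + (0, i s e)) tend to Q
     as e -> 0, so that s rho <= 0 at q' *)
  destruct (proj1 (locally_shift _ _) (HU _ Up)) as (dU & HdU & HUm).
  destruct (holomorphic_lipschitz U Phi p HPhi Up) as (KF & dF & HKF & HdF & HLF).
  assert (IQ : image Phi U Q) by now exists q'.
  destruct (holomorphic_lipschitz _ Psi Q HPsi IQ) as (KG & dG & HKG & HdG & HLG).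
  destruct (rho_lipschitz a q') as (KR & HKR & HLR).
  assert (E0 : s * rho_M a q' = 0); [|lra].
  apply (zero_of_linear_bound _ (KR * (KG * KF))
    (Rmin (Rmin dU dF) (/ (1 + KF / dG + KG * KF)))).
  { assert (Z1 := Hpos KF dG HKF HdG).
    assert (0 <= KG * KF) by pos.
    apply Rmin_pos; [now apply Rmin_pos|]. apply Rinv_0_lt_compat. lra. }
  { apply Rmult_le_pos; auto. now apply Rmult_le_pos. }
  intros e [He0 He].
  assert (Z1 := Hpos KF dG HKF HdG). assert (Z2 : 0 <= KG * KF) by pos.
  assert (M1 := Rmin_l (Rmin dU dF) (/ (1 + KF / dG + KG * KF))).
  assert (M2 := Rmin_r (Rmin dU dF) (/ (1 + KF / dG + KG * KF))).
  assert (M3 := Rmin_l dU dF). assert (M4 := Rmin_r dU dF).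
  assert (HeX : forall x, 0 <= x -> x <= KF / dG + KG * KF -> e * x < 1).
  { intros x Hx0 Hx. apply Rle_lt_trans with (e * (KF / dG + KG * KF)).
    - apply Rmult_le_compat_l; lra.
    - apply Rlt_le_trans with (e * (1 + KF / dG + KG * KF)); [nra|].
      apply Rle_trans with (/ (1 + KF / dG + KG * KF) * (1 + KF / dG + KG * KF)).
      + apply Rmult_le_compat_r; lra.
      + right. field. split; [lra|]. nra. }
  set (n := (RtoC 0, (0, s * e)) : C * C).
  assert (Hn : size2 n = e).
  { unfold size2, n; cbn [fst snd]. rewrite Cmod_0.
    replace ((0, s * e) : C) with (Ci * RtoC (s * e))%C by (apply injective_projections; simpl; ring).
    rewrite Cmod_mult, Cmod_Ci, Cmod_R, Rabs_mult, Hs1, Rabs_pos_eq; lra. }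
  assert (Un : U (shift p n)) by (apply HUm; rewrite Hn; lra).
  assert (Rn : s * rho_M a (shift p n) < 0).
  { unfold n. rewrite rho_normal, Hp. replace (s * (0 - s * e)) with (- (s * s) * e) by ring.
    rewrite Hs. lra. }
  destruct (Hconv (Phi q) (Phi (shift p n)) ltac:(now exists q) ltac:(now exists (shift p n))
    t ltac:(lra)) as (q'' & [Uq'' Rq''] & Eq'').
  set (m := scal2 (RtoC (1 - t)) (diff (Phi (shift p n)) (Phi p))).
  assert (EQm : Phi q'' = shift Q m).
  { rewrite Eq''. unfold Q, tk, m, k, shift, scal2, diff. cbn [fst snd].
    rewrite RtoC_minus. f_equal; ring. }
  assert (Hm : size2 m <= KF * e).
  { unfold m. rewrite size2_scal, Cmod_R_nonneg by lra.
    assert (G := HLF n ltac:(lra)). rewrite Hn in G.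
    assert (G0 := size2_ge0 (diff (Phi (shift p n)) (Phi p))). nra. }
  assert (G1 := HeX (KF / dG) ltac:(auto) ltac:(lra)).
  assert (G2 : size2 m < dG).
  { eapply Rle_lt_trans; [exact Hm|].
    replace (KF * e) with (e * (KF / dG) * dG) by (field; lra). nra. }
  assert (G3 := HLG m G2). rewrite <- EQm, Hinv, EQ in G3 by auto.
  assert (G4 : size2 (diff q'' q') <= KG * KF * e) by nra.
  assert (G5 := HeX (KG * KF) ltac:(auto) ltac:(lra)).
  assert (G6 := HLR (diff q'' q') ltac:(lra)). rewrite shift_diff in G6.
  rewrite Rabs_pos_eq by lra.
  assert (G7 : Rabs (s * (rho_M a q'' - rho_M a q')) <= KR * (KG * KF * e)).
  { rewrite Rabs_mult, Hs1, Rmult_1_l. eapply Rle_trans; [exact G6|].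
    now apply Rmult_le_compat_l. }
  apply Rabs_le_between in G7. lra.
Qed.

(** * The second order condition for convexity *)

Lemma parabola_size x y t : 0 < t <= 1 -> size2 (parabola t x y) <= (size2 x + size2 y) * t.
Proof.
  intros Ht. unfold parabola. eapply Rle_trans; [apply size2_shift|].
  assert (T2 : 0 <= t ^ 2 <= t) by nra.
  rewrite !size2_scal, !Cmod_R_nonneg by lra.
  assert (Y := size2_ge0 y). nra.
Qed.

Lemma taylor2_parabola f p c x y : taylor2_at f p c ->
  exists K d, 0 <= K /\ 0 < d <= 1 /\ forall t, 0 < t < d ->
    let h := parabola t x y in
    Cmod (f (shift p h) - f p - lin (c 1%nat 0%nat) (c 0%nat 1%nat) h
      - RtoC (t ^ 2) * bform (c 2%nat 0%nat) (c 1%nat 1%nat) (c 0%nat 2%nat) x x) <= K * t ^ 3.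
Proof.
  intros (K & d & HK & Hd & H).
  destruct (quad_increment (c 2%nat 0%nat) (c 1%nat 1%nat) (c 0%nat 2%nat) (fun x => x))
    as (D & HD & HQ); auto.
  set (S := size2 x + size2 y).
  assert (X := size2_ge0 x). assert (Y := size2_ge0 y).
  assert (HS : 0 <= S) by (unfold S; lra).
  exists (K * S ^ 3 + D * (size2 x * size2 y + size2 y ^ 2)), (d / (1 + S)).
  assert (HdS : 0 < d / (1 + S) <= d).
  { split; [apply Rdiv_lt_0_compat; lra|]. apply Rmult_le_reg_r with (1 + S); [lra|].
    unfold Rdiv. rewrite Rmult_assoc, Rinv_l by lra. nra. }
  split; [|split; [lra|]].
  { assert (0 <= K * S ^ 3) by pos.
    assert (0 <= D * (size2 x * size2 y + size2 y ^ 2)) by pos.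
    lra. }
  intros t Ht h.
  assert (Hh : size2 h <= S * t) by (apply parabola_size; lra).
  assert (Hhd : size2 h < d).
  { assert (t * (1 + S) < d).
    { apply Rlt_le_trans with (d / (1 + S) * (1 + S)).
      - apply Rmult_lt_compat_r; lra.
      - right; field; lra. }
    lra. }
  specialize (H h Hhd).
  assert (Q := HQ t x (scal2 (RtoC (t ^ 2)) y)). fold (parabola t x y) in Q. fold h in Q.
  assert (T2 : 0 <= t ^ 2) by pos.
  rewrite size2_scal, Cmod_R_nonneg, (Rabs_pos_eq t) in Q by lra.
  set (b := bform _ _ _ h h) in *. set (bx := bform _ _ _ x x) in *.
  replace (f (shift p h) - f p - lin (c 1%nat 0%nat) (c 0%nat 1%nat) h - RtoC (t ^ 2) * bx)%C
    with ((f (shift p h) - f p - lin (c 1%nat 0%nat) (c 0%nat 1%nat) h - b)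
      + (b - RtoC (t ^ 2) * bx))%C by ring.
  rewrite Rmult_plus_distr_r. apply Cmod_add_le.
  - eapply Rle_trans; [exact H|]. rewrite Rmult_assoc, <- Rpow_mult_distr.
    apply Rmult_le_compat_l; auto. apply pow_incr. split; [apply size2_ge0|auto].
  - eapply Rle_trans; [exact Q|]. rewrite (Rmult_assoc D (_ + _)). apply Rmult_le_compat_l; auto.
    assert ((t ^ 2 * size2 y) ^ 2 <= size2 y ^ 2 * t ^ 3) by nra.
    replace ((size2 x * size2 y + size2 y ^ 2) * t ^ 3)
      with (t * size2 x * (t ^ 2 * size2 y) + size2 y ^ 2 * t ^ 3) by ring. lra.
Qed.

Lemma nonneg_of_parabola A K d : 0 < d -> 0 <= K ->
  (forall t, 0 < t < d -> 0 <= t ^ 2 * A + K * t ^ 3) -> 0 <= A.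
Proof.
  intros Hd HK H. apply Rnot_lt_le. intros HA.
  set (t := Rmin (d / 2) (- A / (2 * (K + 1)))).
  assert (T0 : 0 < t).
  { unfold t; apply Rmin_pos; [lra|]. apply Rdiv_lt_0_compat; lra. }
  assert (T1 : t <= d / 2) by apply Rmin_l.
  assert (T2 : t <= - A / (2 * (K + 1))) by apply Rmin_r.
  specialize (H t ltac:(lra)).
  assert ((K + 1) * t <= (K + 1) * (- A / (2 * (K + 1)))) by nra.
  replace ((K + 1) * (- A / (2 * (K + 1)))) with (- A / 2) in * by (field; lra).
  assert (P : 0 < t ^ 2) by pos.
  replace (t ^ 2 * A + K * t ^ 3) with (t ^ 2 * (A + K * t)) in H by ring.
  nra.
Qed.

(** Choose the parabola t x + t^2 y on which the supporting functional is e t^2 + O(t^3)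
    with e > 0. Then s rho >= 0 on it for small t, and the coefficient of t^2 gives the
    claim as e tends to 0. *)
Theorem support_second_order a s p U Phi l1 l2 cf cg x :
  s * s = 1 -> open U -> U p -> rho_M a p = 0 ->
  taylor2_at (fun q => fst (Phi q)) p cf -> taylor2_at (fun q => snd (Phi q)) p cg ->
  (forall h, (l1 * lin (cf 1%nat 0%nat) (cf 0%nat 1%nat) h
              + l2 * lin (cg 1%nat 0%nat) (cg 0%nat 1%nat) h)%C = drho a p h) ->
  (forall q, U q -> s * rho_M a q < 0 -> s * Re (lin l1 l2 (diff (Phi q) (Phi p))) <= 0) ->
  drho a p x = RtoC 0 ->
  0 <= s * (rho_quad a p x
    - Re (l1 * bform (cf 2%nat 0%nat) (cf 1%nat 1%nat) (cf 0%nat 2%nat) x x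
          + l2 * bform (cg 2%nat 0%nat) (cg 1%nat 1%nat) (cg 0%nat 2%nat) x x)%C).
Proof.
  intros Hs HU Up Hp Hf Hg Hl Hsup Hx.
  set (qf := bform (cf 2%nat 0%nat) _ _ x x). set (qg := bform (cg 2%nat 0%nat) _ _ x x).
  set (W := Re (l1 * qf + l2 * qg)%C).
  assert (Hs1 : Rabs s = 1).
  { destruct (Rle_lt_dec 0 s); [rewrite Rabs_pos_eq; nra|rewrite Rabs_left; nra]. }
  apply le_epsilon. intros e He.
  set (y := (RtoC 0, (RtoC (s * e - W) / (RtoC 2 * rho_w a p))%C)).
  assert (Hy : drho a p y = RtoC (s * e - W)).
  { unfold drho, y. cbn [fst snd]. field. apply rho_w_neq0. }
  destruct (taylor2_parabola _ _ _ x y Hf) as (K1 & d1 & HK1 & Hd1 & H1).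
  destruct (taylor2_parabola _ _ _ x y Hg) as (K2 & d2 & HK2 & Hd2 & H2).
  destruct (rho_along_curve a p x y 0 (Rle_refl 0)) as (K3 & d3 & HK3 & Hd3 & H3).
  destruct (proj1 (locally_shift _ _) (HU _ Up)) as (dU & HdU & HUm).
  set (S := size2 x + size2 y).
  assert (HS : 0 <= S) by (unfold S; generalize (size2_ge0 x) (size2_ge0 y); lra).
  set (K4 := Cmod l1 * K1 + Cmod l2 * K2).
  assert (HK4 : 0 <= K4).
  { unfold K4. assert (0 <= Cmod l1 * K1) by pos.
    assert (0 <= Cmod l2 * K2) by pos. lra. }
  set (d := Rmin (Rmin d1 d2) (Rmin d3 (Rmin (dU / (1 + S)) (e / (1 + K4))))).
  assert (Hd : 0 < d).
  { unfold d. repeat apply Rmin_pos; try lra; apply Rdiv_lt_0_compat; lra. }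
  assert (N1 : d <= Rmin d1 d2) by apply Rmin_l.
  assert (N2 : d <= Rmin d3 (Rmin (dU / (1 + S)) (e / (1 + K4)))) by apply Rmin_r.
  assert (N3 := Rmin_l d1 d2). assert (N4 := Rmin_r d1 d2).
  assert (N5 := Rmin_l d3 (Rmin (dU / (1 + S)) (e / (1 + K4)))).
  assert (N6 := Rmin_r d3 (Rmin (dU / (1 + S)) (e / (1 + K4)))).
  assert (N7 := Rmin_l (dU / (1 + S)) (e / (1 + K4))).
  assert (N8 := Rmin_r (dU / (1 + S)) (e / (1 + K4))).
  assert (HA : 0 <= s * (Re (drho a p y) + rho_quad a p x)).
  { apply (nonneg_of_parabola _ K3 d); auto. intros t Ht.
    set (h := parabola t x y).
    specialize (H1 t ltac:(lra)). specialize (H2 t ltac:(lra)).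
    cbv zeta in H1, H2. fold h in H1, H2. fold qf in H1. fold qg in H2.
    assert (T2 : 0 < t ^ 2) by pos.
    assert (Uh : U (shift p h)).
    { apply HUm. eapply Rle_lt_trans; [apply parabola_size; lra|]. fold S.
      assert (t * (1 + S) < dU).
      { apply Rlt_le_trans with (dU / (1 + S) * (1 + S)).
        - apply Rmult_lt_compat_r; lra.
        - right; field; lra. }
      lra. }
    specialize (H3 t (RtoC 0, RtoC 0) ltac:(lra)).
    rewrite shift_0 in H3. fold h in H3. rewrite Hp, Hx in H3.
    replace (Re (RtoC 0)) with 0 in H3 by reflexivity.
    specialize (H3 ltac:(unfold size2; cbn [fst snd]; rewrite Cmod_0; lra)).
    set (T := Re (drho a p y) + rho_quad a p x) in *.
    (* the linear functional is positive at h, so that h is on the other side *)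
    assert (Hpos : 0 < s * Re (lin l1 l2 (diff (Phi (shift p h)) (Phi p)))).
    { set (r1 := (fst (Phi (shift p h)) - fst (Phi p) - lin (cf 1%nat 0%nat) (cf 0%nat 1%nat) h
        - RtoC (t ^ 2) * qf)%C) in *.
      set (r2 := (snd (Phi (shift p h)) - snd (Phi p) - lin (cg 1%nat 0%nat) (cg 0%nat 1%nat) h
        - RtoC (t ^ 2) * qg)%C) in *.
      assert (E : (lin l1 l2 (diff (Phi (shift p h)) (Phi p)) = RtoC (t ^ 2) * RtoC (s * e - W)
        + RtoC (t ^ 2) * (l1 * qf + l2 * qg) + (l1 * r1 + l2 * r2))%C).
      { transitivity (drho a p h + RtoC (t ^ 2) * (l1 * qf + l2 * qg) + (l1 * r1 + l2 * r2))%C.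
        - rewrite <- Hl. unfold r1, r2, diff. unfold lin at 1. cbn [fst snd]. ring.
        - f_equal. f_equal. unfold h, parabola. rewrite drho_shift, !drho_scal, Hx, Hy. ring. }
      rewrite E.
      assert (ER : Re (RtoC (t ^ 2) * RtoC (s * e - W)
        + RtoC (t ^ 2) * (l1 * qf + l2 * qg) + (l1 * r1 + l2 * r2))%C
        = t ^ 2 * (s * e) + Re (l1 * r1 + l2 * r2)%C).
      { transitivity (t ^ 2 * (s * e - W) + t ^ 2 * W + Re (l1 * r1 + l2 * r2)%C); [|ring].
        unfold W. generalize (l1 * qf + l2 * qg)%C (l1 * r1 + l2 * r2)%C (t ^ 2).
        intros [a1 a2] [b1 b2] tt. unfold Re. simpl. ring. }
      rewrite ER.
      assert (HR : Rabs (Re (l1 * r1 + l2 * r2)%C) <= K4 * t ^ 3).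
      { eapply Rle_trans; [apply re_le_Cmod|]. unfold K4. rewrite Rmult_plus_distr_r, !Rmult_assoc.
        apply Cmod_add_le; rewrite Cmod_mult; apply Rmult_le_compat_l; auto using Cmod_ge_0. }
      assert (HR2 : Rabs (s * Re (l1 * r1 + l2 * r2)%C) <= K4 * t ^ 3) by
        (rewrite Rabs_mult, Hs1; lra).
      apply Rabs_le_between in HR2.
      replace (s * (t ^ 2 * (s * e) + Re (l1 * r1 + l2 * r2)%C))
        with (t ^ 2 * ((s * s) * e) + s * Re (l1 * r1 + l2 * r2)%C) by ring.
      rewrite Hs.
      assert (t * (1 + K4) < e).
      { apply Rlt_le_trans with (e / (1 + K4) * (1 + K4)).
        - apply Rmult_lt_compat_r; lra.
        - right; field; lra. }
      replace (K4 * t ^ 3) with (t ^ 2 * (t * K4)) in HR2 by ring.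
      assert (t ^ 2 * (t * K4) < t ^ 2 * e) by nra. lra. }
    assert (Hside : 0 <= s * rho_M a (shift p h)).
    { apply Rnot_lt_le. intros Hlt. specialize (Hsup _ Uh Hlt). lra. }
    assert (H4 : Rabs (s * (rho_M a (shift p h) - 0 - t * 0 - t ^ 2 * T)) <= K3 * t ^ 3) by
      (rewrite Rabs_mult, Hs1; lra).
    apply Rabs_le_between in H4. lra. }
  rewrite Hy in HA. replace (Re (RtoC (s * e - W))) with (s * e - W) in HA by reflexivity.
  replace (s * (s * e - W + rho_quad a p x)) with ((s * s) * e + s * (rho_quad a p x - W)) in HA
    by ring.
  rewrite Hs in HA. lra.
Qed.

(** Take w^2 = - conj X / |X|. *)
Lemma Cmod_le_of_rotations X L :
  (forall w, Cmod w = 1 -> 0 <= Re (w ^ 2 * X)%C + L) -> Cmod X <= L.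
Proof.
  intros H. destruct (Req_dec (Cmod X) 0) as [E|N].
  - specialize (H (RtoC 1) Cmod_1). rewrite (Cmod_eq_0 _ E) in *. rewrite Cmod_0.
    replace (Re (1 ^ 2 * 0)%C) with 0 in H by (unfold Re; simpl; ring). lra.
  - (* a square root of the unit number - conj X / |X| *)
    assert (Hr : forall y : C, Cmod y = 1 -> exists w, Cmod w = 1 /\ (w ^ 2 = y)%C).
    { intros [c d] Hy. assert (E : c * c + d * d = 1).
      { assert (E := Cmod_pow2 (c, d)). rewrite Hy in E. cbn [fst snd] in E. simpl in E. lra. }
      assert (Hc : -1 <= c <= 1) by nra.
      set (u := sqrt ((1 + c) / 2)). set (v := sqrt ((1 - c) / 2)).
      assert (Eu : u * u = (1 + c) / 2) by (apply sqrt_sqrt; lra).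
      assert (Ev : v * v = (1 - c) / 2) by (apply sqrt_sqrt; lra).
      assert (Hu : 0 <= u) by apply sqrt_pos. assert (Hv : 0 <= v) by apply sqrt_pos.
      assert (Huv : 0 <= u * v) by pos.
      assert (Hw : forall w : C, (w ^ 2)%C = (c, d) -> Cmod w = 1).
      { intros w Ew. assert (E2 : Cmod w ^ 2 = 1) by (rewrite <- Cmod_pow, Ew; auto).
        assert (P := Cmod_ge_0 w). simpl in E2. nra. }
      destruct (Rle_lt_dec 0 d) as [Hd|Hd].
      - exists (u, v). assert (Ew : (((u, v) : C) ^ 2)%C = (c, d)).
        { apply injective_projections; simpl; [nra|]. assert (2 * (u * v) = d) by nra. lra. }
        auto.
      - exists (u, Ropp v). assert (Ew : (((u, Ropp v) : C) ^ 2)%C = (c, d)).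
        { apply injective_projections; simpl; [nra|]. assert (2 * (u * v) = - d) by nra. lra. }
        auto. }
    assert (P : 0 < Cmod X) by (generalize (Cmod_ge_0 X); lra).
    assert (Nz : RtoC (Cmod X) <> RtoC 0) by (intros E; apply RtoC_inj in E; lra).
    destruct (Hr (- Cconj X / RtoC (Cmod X))%C) as (w & Hw & Ew).
    { rewrite Cmod_div, Cmod_opp, Cmod_conj, Cmod_R_nonneg by pos. field; lra. }
    specialize (H w Hw). rewrite Ew in H.
    replace (- Cconj X / RtoC (Cmod X) * X)%C with (RtoC (- Cmod X)) in H.
    + replace (Re (RtoC (- Cmod X))) with (- Cmod X) in H by reflexivity. lra.
    + transitivity (- (X * Cconj X) / RtoC (Cmod X))%C; [|field; auto].
      rewrite <- Cmod2_conj, RtoC_opp, RtoC_pow. field. auto.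
Qed.

(** * The condition in terms of the coordinate map *)

Lemma lin_eq0 a b K d : 0 <= K -> 0 < d ->
  (forall h, size2 h < d -> Cmod (lin a b h) <= K * size2 h ^ 2) -> a = RtoC 0 /\ b = RtoC 0.
Proof.
  intros HK Hd H.
  assert (Hz : forall c : C, (forall t, 0 < t < d -> Cmod c * t <= K * t ^ 2) -> c = RtoC 0).
  { intros c Hc. apply Cmod_eq_0. apply (zero_of_linear_bound _ K d); auto. intros t Ht.
    specialize (Hc t Ht). rewrite Rabs_pos_eq by apply Cmod_ge_0.
    apply Rmult_le_reg_r with t; [lra|]. simpl in Hc. lra. }
  split; apply Hz; intros t Ht.
  - specialize (H (RtoC t, RtoC 0)). unfold size2, lin in H. cbn [fst snd] in H.
    rewrite Cmod_0, Cmod_R_nonneg, Rplus_0_r in H by lra. specialize (H ltac:(lra)).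
    replace (a * t + b * 0)%C with (a * RtoC t)%C in H by ring.
    rewrite Cmod_mult, Cmod_R_nonneg in H by lra. exact H.
  - specialize (H (RtoC 0, RtoC t)). unfold size2, lin in H. cbn [fst snd] in H.
    rewrite Cmod_0, Cmod_R_nonneg, Rplus_0_l in H by lra. specialize (H ltac:(lra)).
    replace (a * 0 + b * t)%C with (b * RtoC t)%C in H by ring.
    rewrite Cmod_mult, Cmod_R_nonneg in H by lra. exact H.
Qed.

(** One row of the identity D Psi . D Phi = Id, from the first order expansions at p and
    at Phi p. *)
Lemma inverse_row (U : C * C -> Prop) Phi (psi : C * C -> C) p cf cg b1 b2 e1 e2 K0 d0 :
  open U -> U p ->
  taylor2_at (fun q => fst (Phi q)) p cf -> taylor2_at (fun q => snd (Phi q)) p cg ->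
  0 <= K0 -> 0 < d0 ->
  (forall k, size2 k < d0 ->
     Cmod (psi (shift (Phi p) k) - psi (Phi p) - lin b1 b2 k) <= K0 * size2 k ^ 2) ->
  (forall q, U q -> (psi (Phi q) - psi (Phi p))%C = lin e1 e2 (diff q p)) ->
  (b1 * cf 1%nat 0%nat + b2 * cg 1%nat 0%nat)%C = e1 /\
  (b1 * cf 0%nat 1%nat + b2 * cg 0%nat 1%nat)%C = e2.
Proof.
  intros HU Up Hf Hg HK0 Hd0 HB Hpsi.
  destruct (taylor2_first_order _ _ _ Hf) as (K1 & d1 & HK1 & Hd1 & H1).
  destruct (taylor2_first_order _ _ _ Hg) as (K2 & d2 & HK2 & Hd2 & H2).
  destruct (proj1 (locally_shift _ _) (HU _ Up)) as (dU & HdU & HUm).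
  set (S1 := Cmod (cf 1%nat 0%nat) + Cmod (cf 0%nat 1%nat)).
  set (S2 := Cmod (cg 1%nat 0%nat) + Cmod (cg 0%nat 1%nat)).
  assert (HS1 : 0 <= S1) by (unfold S1; generalize (Cmod_ge_0 (cf 1%nat 0%nat))
    (Cmod_ge_0 (cf 0%nat 1%nat)); lra).
  assert (HS2 : 0 <= S2) by (unfold S2; generalize (Cmod_ge_0 (cg 1%nat 0%nat))
    (Cmod_ge_0 (cg 0%nat 1%nat)); lra).
  set (T := S1 + S2 + K1 + K2). assert (HT : 0 <= T) by (unfold T; lra).
  assert (B1 := Cmod_ge_0 b1). assert (B2 := Cmod_ge_0 b2).
  set (L := K0 * T ^ 2 + Cmod b1 * K1 + Cmod b2 * K2).
  assert (HL : 0 <= L).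
  { unfold L. assert (0 <= K0 * T ^ 2) by pos.
    assert (0 <= Cmod b1 * K1) by pos.
    assert (0 <= Cmod b2 * K2) by pos. lra. }
  set (d := Rmin (Rmin d1 d2) (Rmin dU (d0 / (1 + T)))).
  assert (Hd : 0 < d).
  { unfold d. repeat apply Rmin_pos; try lra. apply Rdiv_lt_0_compat; lra. }
  assert (N1 : d <= Rmin d1 d2) by apply Rmin_l.
  assert (N2 : d <= Rmin dU (d0 / (1 + T))) by apply Rmin_r.
  assert (N3 := Rmin_l d1 d2). assert (N4 := Rmin_r d1 d2).
  assert (N5 := Rmin_l dU (d0 / (1 + T))). assert (N6 := Rmin_r dU (d0 / (1 + T))).
  destruct (lin_eq0 (b1 * cf 1%nat 0%nat + b2 * cg 1%nat 0%nat - e1)%C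
    (b1 * cf 0%nat 1%nat + b2 * cg 0%nat 1%nat - e2)%C L d HL Hd) as [E1 E2].
  - intros h Hh. assert (Hn := size2_ge0 h).
    specialize (H1 h ltac:(lra)). specialize (H2 h ltac:(lra)). cbv beta in H1, H2.
    assert (Uh : U (shift p h)) by (apply HUm; lra).
    specialize (Hpsi _ Uh). rewrite diff_shift in Hpsi.
    set (k := diff (Phi (shift p h)) (Phi p)).
    assert (Ek : shift (Phi p) k = Phi (shift p h)) by apply shift_diff.
    assert (L1 := lin_bound (cf 1%nat 0%nat) (cf 0%nat 1%nat) h). fold S1 in L1.
    assert (L2 := lin_bound (cg 1%nat 0%nat) (cg 0%nat 1%nat) h). fold S2 in L2.
    set (l1 := lin (cf 1%nat 0%nat) (cf 0%nat 1%nat) h) in *.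
    set (l2 := lin (cg 1%nat 0%nat) (cg 0%nat 1%nat) h) in *.
    set (r1 := (fst (Phi (shift p h)) - fst (Phi p) - l1)%C) in *.
    set (r2 := (snd (Phi (shift p h)) - snd (Phi p) - l2)%C) in *.
    assert (E : size2 h ^ 2 <= size2 h) by nra.
    assert (F1 := Rmult_le_compat_l _ _ _ HK1 E). assert (F2 := Rmult_le_compat_l _ _ _ HK2 E).
    assert (Hk : size2 k <= T * size2 h).
    { unfold size2 at 1. unfold k, diff. cbn [fst snd].
      replace (fst (Phi (shift p h)) - fst (Phi p))%C with (l1 + r1)%C by (unfold r1; ring).
      replace (snd (Phi (shift p h)) - snd (Phi p))%C with (l2 + r2)%C by (unfold r2; ring).
      generalize (Cmod_triangle l1 r1) (Cmod_triangle l2 r2). unfold T. lra. }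
    assert (Hkd : size2 k < d0).
    { assert (size2 h * (1 + T) < d0).
      { apply Rlt_le_trans with (d0 / (1 + T) * (1 + T)).
        - apply Rmult_lt_compat_r; lra.
        - right; field; lra. }
      lra. }
    specialize (HB k Hkd). rewrite Ek, Hpsi in HB.
    match goal with |- Cmod ?x <= _ =>
      replace x with (- (lin e1 e2 h - lin b1 b2 k) + - (b1 * r1) + - (b2 * r2))%C end.
    2: { unfold r1, r2, l1, l2, k, diff, lin. cbn [fst snd]. ring. }
    unfold L. rewrite !Rmult_plus_distr_r. repeat apply Cmod_add_le; rewrite Cmod_opp.
    + eapply Rle_trans; [exact HB|]. rewrite Rmult_assoc, <- Rpow_mult_distr.
      apply Rmult_le_compat_l; auto. apply pow_incr. split; [apply size2_ge0|auto].
    + rewrite Cmod_mult, Rmult_assoc. now apply Rmult_le_compat_l.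
    + rewrite Cmod_mult, Rmult_assoc. now apply Rmult_le_compat_l.
  - split; [rewrite <- (Cplus_0_r e1), <- E1|rewrite <- (Cplus_0_r e2), <- E2]; ring.
Qed.

Lemma size2_diff_fst x y e : size2 (diff x y) <= e -> Cmod (fst x - fst y) <= e.
Proof. unfold size2, diff; cbn [fst snd]. generalize (Cmod_ge_0 (snd x - snd y)). lra. Qed.

Lemma size2_diff_snd x y e : size2 (diff x y) <= e -> Cmod (snd x - snd y) <= e.
Proof. unfold size2, diff; cbn [fst snd]. generalize (Cmod_ge_0 (fst x - fst y)). lra. Qed.

(** The functional (l1, l2) is the differential 2 d' rho composed with D Psi. The first two
    equations determine it from the first derivatives of Phi, without
    reference to Psi. *)
Theorem convexifiable_condition a s p U Phi Psi cf cg :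
  s * s = 1 -> open U -> U p -> holomorphic_on U Phi -> open (image Phi U) ->
  holomorphic_on (image Phi U) Psi -> (forall q, U q -> Psi (Phi q) = q) ->
  convex_set (image Phi (fun q => U q /\ s * rho_M a q < 0)) -> rho_M a p = 0 ->
  taylor2_at (fun q => fst (Phi q)) p cf -> taylor2_at (fun q => snd (Phi q)) p cg ->
  (cf 1%nat 0%nat * cg 0%nat 1%nat - cf 0%nat 1%nat * cg 1%nat 0%nat)%C <> RtoC 0 /\
  exists l1 l2,
    (l1 * cf 1%nat 0%nat + l2 * cg 1%nat 0%nat)%C = (RtoC 2 * rho_z a p)%C /\
    (l1 * cf 0%nat 1%nat + l2 * cg 0%nat 1%nat)%C = (RtoC 2 * rho_w a p)%C /\
    forall x, drho a p x = RtoC 0 ->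
      0 <= s * (rho_quad a p x
        - Re (l1 * bform (cf 2%nat 0%nat) (cf 1%nat 1%nat) (cf 0%nat 2%nat) x x
              + l2 * bform (cg 2%nat 0%nat) (cg 1%nat 1%nat) (cg 0%nat 2%nat) x x)%C).
Proof.
  intros Hs HU Up HPhi HI HPsi Hinv Hconv Hp Hf Hg.
  assert (Ip : image Phi U (Phi p)) by now exists p.
  destruct (holomorphic_first_order _ Psi (Phi p) HPsi Ip)
    as (b11 & b12 & b21 & b22 & K & d & HK & Hd & HB).
  rewrite Hinv in HB by auto.
  destruct (inverse_row U Phi (fun q => fst (Psi q)) p cf cg b11 b12 (RtoC 1) (RtoC 0) K d)
    as [A1 A2]; auto; try lra.
  { intros k Hk. rewrite Hinv by auto. apply HB in Hk. now apply size2_diff_fst in Hk. }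
  { intros q Uq. rewrite !Hinv by auto. unfold lin, diff; cbn [fst snd]. ring. }
  destruct (inverse_row U Phi (fun q => snd (Psi q)) p cf cg b21 b22 (RtoC 0) (RtoC 1) K d)
    as [A3 A4]; auto; try lra.
  { intros k Hk. rewrite Hinv by auto. apply HB in Hk. now apply size2_diff_snd in Hk. }
  { intros q Uq. rewrite !Hinv by auto. unfold lin, diff; cbn [fst snd]. ring. }
  split.
  - intros E.
    assert (E1 : ((b11 * b22 - b12 * b21)
      * (cf 1%nat 0%nat * cg 0%nat 1%nat - cf 0%nat 1%nat * cg 1%nat 0%nat))%C = RtoC 1).
    { transitivity ((b11 * cf 1%nat 0%nat + b12 * cg 1%nat 0%nat)
        * (b21 * cf 0%nat 1%nat + b22 * cg 0%nat 1%nat)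
       - (b11 * cf 0%nat 1%nat + b12 * cg 0%nat 1%nat)
        * (b21 * cf 1%nat 0%nat + b22 * cg 1%nat 0%nat))%C; [ring|].
      rewrite A1, A2, A3, A4. ring. }
    rewrite E in E1.
    assert (E2 : RtoC 1 = RtoC 0) by (rewrite <- E1; ring). apply RtoC_inj in E2. lra.
  - set (l1 := (RtoC 2 * (rho_z a p * b11 + rho_w a p * b21))%C).
    set (l2 := (RtoC 2 * (rho_z a p * b12 + rho_w a p * b22))%C).
    assert (R1 : (l1 * cf 1%nat 0%nat + l2 * cg 1%nat 0%nat)%C = (RtoC 2 * rho_z a p)%C).
    { transitivity (RtoC 2 * (rho_z a p * (b11 * cf 1%nat 0%nat + b12 * cg 1%nat 0%nat)
        + rho_w a p * (b21 * cf 1%nat 0%nat + b22 * cg 1%nat 0%nat)))%C; [unfold l1, l2; ring|].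
      rewrite A1, A3. ring. }
    assert (R2 : (l1 * cf 0%nat 1%nat + l2 * cg 0%nat 1%nat)%C = (RtoC 2 * rho_w a p)%C).
    { transitivity (RtoC 2 * (rho_z a p * (b11 * cf 0%nat 1%nat + b12 * cg 0%nat 1%nat)
        + rho_w a p * (b21 * cf 0%nat 1%nat + b22 * cg 0%nat 1%nat)))%C; [unfold l1, l2; ring|].
      rewrite A2, A4. ring. }
    exists l1, l2. split; [auto|split; [auto|]]. intros x Hx.
    apply (support_second_order a s p U Phi l1 l2 cf cg x); auto.
    + intros h. transitivity ((l1 * cf 1%nat 0%nat + l2 * cg 1%nat 0%nat) * fst h
        + (l1 * cf 0%nat 1%nat + l2 * cg 0%nat 1%nat) * snd h)%C; [unfold lin; ring|].
      rewrite R1, R2. unfold drho. ring.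
    + intros q Uq Hq.
      assert (E := support_inequality a s p U Phi Psi b11 b12 b21 b22 K d Hs HU Up HPhi HI HPsi
        Hinv HK (proj1 Hd) HB Hconv Hp q Uq Hq). cbv zeta in E.
      replace (lin l1 l2 (diff (Phi q) (Phi p))) with
        (drho a p (lin b11 b12 (diff (Phi q) (Phi p)), lin b21 b22 (diff (Phi q) (Phi p)))); auto.
      unfold drho, l1, l2, lin; cbn [fst snd]. ring.
Qed.

Lemma rho_quad_scal a p w x : Cmod w = 1 ->
  rho_quad a p (scal2 w x) = Re (w ^ 2 * hess_hol a p x)%C + levi a p x.
Proof.
  intros Hw. unfold rho_quad. f_equal.
  - f_equal. unfold hess_hol, scal2; cbn [fst snd]; cbv zeta. ring.
  - unfold levi, scal2; cbn [fst snd]; cbv zeta. rewrite !Cmod_mult, Hw, !Rmult_1_l.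
    f_equal. f_equal. rewrite Cmult_conj. f_equal.
    transitivity (Fzu a (fst p) (Re (snd p)) * fst x * Cconj (snd x) * (w * Cconj w))%C; [ring|].
    rewrite <- Cmod2_conj, Hw, ?RtoC_pow, ?pow1, ?Cpow_1_l. ring.
Qed.

Lemma bform_scal c1 c2 c3 w x :
  bform c1 c2 c3 (scal2 w x) (scal2 w x) = (w ^ 2 * bform c1 c2 c3 x x)%C.
Proof. unfold bform, scal2; cbn [fst snd]. ring. Qed.

Lemma Cmod_sub_le x y u v : Cmod x <= u -> Cmod y <= v -> Cmod (x - y) <= u + v.
Proof. intros. unfold Cminus. apply Cmod_add_le; auto. now rewrite Cmod_opp. Qed.

(** Multiplying the second order condition by J clears the denominators of (l1, l2).
    All terms with a factor F_z, tau or F_u are errors; what remains is J F_zz - i N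
    on one side and J F_zzbar on the other. *)
Lemma support_estimate a p (cf cg : nat -> nat -> C) K l1 l2 :
  0 <= a <= 2 -> Cmod (fst p) <= 1 -> Rabs (Re (snd p)) <= 1 ->
  0 <= K -> (forall i j, Cmod (cf i j) <= K) -> (forall i j, Cmod (cg i j) <= K) ->
  (l1 * cf 1%nat 0%nat + l2 * cg 1%nat 0%nat)%C = (RtoC 2 * rho_z a p)%C ->
  (l1 * cf 0%nat 1%nat + l2 * cg 0%nat 1%nat)%C = (RtoC 2 * rho_w a p)%C ->
  (forall x, drho a p x = RtoC 0 ->
      0 <= rho_quad a p x
        - Re (l1 * bform (cf 2%nat 0%nat) (cf 1%nat 1%nat) (cf 0%nat 2%nat) x x
              + l2 * bform (cg 2%nat 0%nat) (cg 1%nat 1%nat) (cg 0%nat 2%nat) x x)%C) ->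
  18 * (Cmod (fst p) * weight (fst p) (Re (snd p))) <= 1 ->
  let z := fst p in let u := Re (snd p) in
  let J := (cf 1%nat 0%nat * cg 0%nat 1%nat - cf 0%nat 1%nat * cg 1%nat 0%nat)%C in
  let N := (cf 1%nat 0%nat * cg 2%nat 0%nat - cg 1%nat 0%nat * cf 2%nat 0%nat)%C in
  Cmod (J * Fzz a z u - Ci * N)
    <= Cmod J * Fzzb a z u + 100000 * K ^ 2 * (Cmod z * weight z u + Rabs (Fu a z u)).
Proof.
  intros Ha Hz Hu HK Hf Hg R1 R2 Hx Hsm z u J N.
  set (tau := tangent_slope a p). set (x := (RtoC 1, tau)).
  assert (Htx : drho a p x = RtoC 0) by (apply tangent_slope_spec; unfold x; simpl; fold tau; ring).
  set (qf := bform (cf 2%nat 0%nat) (cf 1%nat 1%nat) (cf 0%nat 2%nat) x x) in *.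
  set (qg := bform (cg 2%nat 0%nat) (cg 1%nat 1%nat) (cg 0%nat 2%nat) x x) in *.
  set (X := (hess_hol a p x - (l1 * qf + l2 * qg))%C).
  assert (HX : Cmod X <= levi a p x).
  { apply Cmod_le_of_rotations. intros w Hw.
    assert (E : drho a p (scal2 w x) = RtoC 0) by (rewrite drho_scal, Htx; ring).
    specialize (Hx _ E). rewrite rho_quad_scal, !bform_scal in Hx by auto.
    fold qf qg in Hx.
    replace (Re (w ^ 2 * X)%C) with (Re (w ^ 2 * hess_hol a p x)%C
      - Re (l1 * (w ^ 2 * qf) + l2 * (w ^ 2 * qg))%C); [lra|].
    transitivity (Re (w ^ 2 * hess_hol a p x - (l1 * (w ^ 2 * qf) + l2 * (w ^ 2 * qg)))%C);
      [reflexivity|]. f_equal. unfold X. ring. }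
  destruct (tangent_second_order a p Ha Hz Hu) as [T1 T2]. cbv zeta in T1, T2.
  fold tau x z u in T1, T2.
  assert (T3 := tangent_slope_bound a p Ha). fold tau z u in T3.
  assert (T4 := Fz_bound a z u Ha). change (Fz a z u) with (rho_z a p) in T4.
  set (e := Cmod z * weight z u) in *.
  assert (He : 0 <= e) by (apply Rmult_le_pos; [apply Cmod_ge_0|apply weight_ge0]).
  replace (18 * Cmod z * weight z u) with (18 * e) in T3 by (unfold e; ring).
  replace (9 * Cmod z * weight z u) with (9 * e) in T4 by (unfold e; ring).
  change (18 * e <= 1) in Hsm.
  assert (HT : Cmod tau <= 1) by lra.
  assert (HT0 := Cmod_ge_0 tau).
  assert (Hbf : forall c : nat -> nat -> C, (forall i j, Cmod (c i j) <= K) ->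
    Cmod (bform (c 2%nat 0%nat) (c 1%nat 1%nat) (c 0%nat 2%nat) x x - c 2%nat 0%nat) <= K * (36 * e)).
  { intros c Hc. replace (bform (c 2%nat 0%nat) (c 1%nat 1%nat) (c 0%nat 2%nat) x x - c 2%nat 0%nat)%C
      with ((c 1%nat 1%nat + c 0%nat 2%nat * tau) * tau)%C by
      (unfold bform, x; cbn [fst snd]; ring).
    replace (K * (36 * e)) with ((K + K * 1) * (18 * e)) by ring.
    apply Cmod_mult_le; auto. apply Cmod_add_le; auto. apply Cmod_mult_le; auto. }
  assert (Hqf := Hbf cf Hf). assert (Hqg := Hbf cg Hg). fold qf in Hqf. fold qg in Hqg.
  assert (Hke : K * (36 * e) <= K * 2) by (apply Rmult_le_compat_l; lra).
  assert (Bqf : Cmod qf <= K * 3).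
  { replace qf with ((qf - cf 2%nat 0%nat) + cf 2%nat 0%nat)%C by ring.
    eapply Rle_trans; [apply Cmod_add_le; [exact Hqf|apply Hf]|lra]. }
  assert (Bqg : Cmod qg <= K * 3).
  { replace qg with ((qg - cg 2%nat 0%nat) + cg 2%nat 0%nat)%C by ring.
    eapply Rle_trans; [apply Cmod_add_le; [exact Hqg|apply Hg]|lra]. }
  assert (BJ : Cmod J <= K * K + K * K) by (apply Cmod_sub_le; apply Cmod_mult_le; auto).
  assert (EJ1 : (J * l1)%C = (RtoC 2 * rho_z a p * cg 0%nat 1%nat
     - RtoC 2 * rho_w a p * cg 1%nat 0%nat)%C) by (rewrite <- R1, <- R2; unfold J; ring).
  assert (EJ2 : (J * l2)%C = (RtoC 2 * rho_w a p * cf 1%nat 0%nat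
     - RtoC 2 * rho_z a p * cf 0%nat 1%nat)%C) by (rewrite <- R1, <- R2; unfold J; ring).
  assert (Ew : (RtoC 2 * rho_w a p)%C = (RtoC (Fu a z u) + Ci)%C).
  { unfold rho_w. fold z u. apply injective_projections; simpl; field. }
  assert (E : (J * Fzz a z u - Ci * N)%C = (J * X - (J * (hess_hol a p x - Fzz a z u)
     - RtoC 2 * rho_z a p * (cg 0%nat 1%nat * qf - cf 0%nat 1%nat * qg)
     + RtoC (Fu a z u) * (cg 1%nat 0%nat * qf - cf 1%nat 0%nat * qg)
     + Ci * (cg 1%nat 0%nat * (qf - cf 2%nat 0%nat) - cf 1%nat 0%nat * (qg - cg 2%nat 0%nat))))%C).
  { transitivity (J * hess_hol a p x - J * l1 * qf - J * l2 * qg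
      - (J * (hess_hol a p x - Fzz a z u)
     - RtoC 2 * rho_z a p * (cg 0%nat 1%nat * qf - cf 0%nat 1%nat * qg)
     + RtoC (Fu a z u) * (cg 1%nat 0%nat * qf - cf 1%nat 0%nat * qg)
     + Ci * (cg 1%nat 0%nat * (qf - cf 2%nat 0%nat) - cf 1%nat 0%nat * (qg - cg 2%nat 0%nat))))%C;
      [|unfold X; ring].
    rewrite EJ1, EJ2, Ew. unfold N. ring. }
  rewrite E.
  eapply Rle_trans.
  { apply Cmod_sub_le; [|apply Cmod_add_le; [apply Cmod_add_le; [apply Cmod_sub_le|]|]].
    - rewrite Cmod_mult. apply Rmult_le_compat_l; [apply Cmod_ge_0|exact HX].
    - apply Cmod_mult_le; [exact BJ|exact T1].
    - apply Cmod_mult_le.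
      + rewrite Cmod_mult, Cmod_R_nonneg by lra. apply Rmult_le_compat_l; [lra|exact T4].
      + apply Cmod_sub_le; apply Cmod_mult_le; [apply Hg|exact Bqf|apply Hf|exact Bqg].
    - apply Cmod_mult_le; [rewrite Cmod_R; apply Rle_refl|].
      apply Cmod_sub_le; apply Cmod_mult_le; [apply Hg|exact Bqf|apply Hf|exact Bqg].
    - apply Cmod_mult_le; [rewrite Cmod_Ci; apply Rle_refl|].
      apply Cmod_sub_le; apply Cmod_mult_le; [apply Hg|exact Hqf|apply Hf|exact Hqg]. }
  apply Rabs_le_between in T2.
  assert (HJ0 := Cmod_ge_0 J).
  assert (G1 : Cmod J * levi a p x <= Cmod J * Fzzb a z u + (K * K + K * K) * (20000 * e)).
  { apply Rle_trans with (Cmod J * Fzzb a z u + Cmod J * (20000 * e)).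
    - rewrite <- Rmult_plus_distr_l. apply Rmult_le_compat_l; lra.
    - apply Rplus_le_compat_l. apply Rmult_le_compat_r; lra. }
  assert (HF := Rabs_pos (Fu a z u)). set (f := Rabs (Fu a z u)) in *.
  assert (K2 : 0 <= K * K) by now apply Rmult_le_pos.
  assert (P1 : 0 <= K * K * e) by now apply Rmult_le_pos.
  assert (P2 : 0 <= K * K * f) by now apply Rmult_le_pos.
  simpl. lra.
Qed.

(** * Neither side is convexifiable *)

Lemma shift_origin q : shift origin q = q.
Proof. destruct q; unfold shift, origin; simpl; f_equal; ring. Qed.

Lemma holomorphic2_taylor_origin f : holomorphic2_at f origin ->
  exists g K d, (forall i j, order6_in_z (g i j)) /\ 0 <= K /\ 0 < d <= 1 /\
    (forall i j z w, Cmod z < d -> Cmod w < d -> Cmod (g i j z w) <= K) /\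
    forall p, size2 p < d -> taylor2_at f p (fun i j => g i j (fst p) (snd p)).
Proof.
  intros H. destruct (holomorphic2_taylor f origin H) as (g & Hg & K & d & HK & Hd & HB & HT).
  exists g, K, d. split; [auto|split; [auto|split; [auto|split; [auto|]]]].
  intros p Hp. exists K, d. split; [auto|split; [auto|]]. intros h Hh.
  specialize (HT p h Hp Hh). cbv zeta in HT. rewrite !shift_origin in HT.
  eapply Rle_trans; [|exact HT]. right. f_equal. unfold lin, bform. ring.
Qed.

(** Adding the second order conditions for (1, tau) and its multiple by i cancels all
    complex quadratic terms and gives L <= 0 at a strongly pseudoconvex point. *)
Lemma outer_side_not_convex a U Phi : 3 / 5 < a < 9 / 5 ->
  local_coordinates origin U Phi ->
  ~ convex_set (image Phi (fun q => U q /\ -1 * rho_M a q < 0)).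
Proof.
  intros Ha (HU & U0 & HPhi & HI & Psi & HPsi & Hinv) Hconv.
  destruct (holomorphic2_taylor_origin _ (proj1 (HPhi _ U0))) as (gf & Kf & df & _ & _ & Hdf & _ & Tf).
  destruct (holomorphic2_taylor_origin _ (proj2 (HPhi _ U0))) as (gg & Kg & dg & _ & _ & Hdg & _ & Tg).
  destruct (proj1 (locally_shift _ _) (HU _ U0)) as (dU & HdU & HUm).
  destruct (levi_pos a Ha) as (dL & HdL & HL).
  set (d := Rmin (Rmin df dg) (Rmin dU dL)).
  assert (N1 : d <= Rmin df dg) by apply Rmin_l. assert (N2 : d <= Rmin dU dL) by apply Rmin_r.
  assert (N3 := Rmin_l df dg). assert (N4 := Rmin_r df dg).
  assert (N5 := Rmin_l dU dL). assert (N6 := Rmin_r dU dL).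
  assert (Hd : 0 < d) by (unfold d; repeat apply Rmin_pos; lra).
  set (e := d / 3). set (p := (RtoC e, (0, e ^ 8)) : C * C).
  assert (He : 0 < e) by (unfold e; lra).
  assert (He1 : e <= 1) by (unfold e; lra).
  assert (Ce : Cmod (RtoC e) = e) by (apply Cmod_R_nonneg; lra).
  assert (Hp : size2 p <= 2 * e).
  { unfold size2, p. cbn [fst snd]. rewrite Ce.
    replace ((0, e ^ 8) : C) with (Ci * RtoC (e ^ 8))%C by (apply injective_projections; simpl; ring).
    rewrite Cmod_mult, Cmod_Ci, Cmod_R_nonneg by (apply pow_le; lra).
    replace (e ^ 8) with (e * e ^ 7) by ring. generalize (pow_le1 e 7 ltac:(lra)). nra. }
  assert (Hpd : size2 p < d) by (unfold e in *; lra).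
  assert (Up : U p) by (rewrite <- (shift_origin p); apply HUm; lra).
  assert (Rp : rho_M a p = 0).
  { unfold rho_M, p, F. cbn [fst snd]. rewrite Ce. unfold Re, Im. cbn [fst snd]. simpl. ring. }
  destruct (convexifiable_condition a (-1) p U Phi Psi _ _ ltac:(lra) HU Up HPhi HI HPsi Hinv
    Hconv Rp (Tf p ltac:(lra)) (Tg p ltac:(lra))) as (_ & l1 & l2 & _ & _ & Hx).
  set (x := (RtoC 1, tangent_slope a p)).
  assert (Htx : drho a p x = RtoC 0) by (apply tangent_slope_spec; unfold x; simpl; ring).
  assert (H1 := Hx x Htx).
  assert (H2 := Hx (scal2 Ci x) ltac:(rewrite drho_scal, Htx; ring)).
  rewrite !bform_scal in H2.
  assert (E := rho_quad_rotate a p x).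
  assert (Hlevi : 0 < levi a p x).
  { apply HL; unfold p; cbn [fst snd].
    - rewrite Ce. unfold e in *; lra.
    - replace (Re ((0, e ^ 8) : C)) with 0 by reflexivity. rewrite Rabs_R0; lra.
    - unfold weight. rewrite Ce. replace (Re ((0, e ^ 8) : C)) with 0 by reflexivity.
      generalize (pow_lt e 6 He). simpl; lra. }
  set (qf := bform (gf 2%nat 0%nat _ _) _ _ x x) in *.
  set (qg := bform (gg 2%nat 0%nat _ _) _ _ x x) in *.
  replace (Re (l1 * (Ci ^ 2 * qf) + l2 * (Ci ^ 2 * qg))%C) with (- Re (l1 * qf + l2 * qg)%C) in H2.
  2: { replace (l1 * (Ci ^ 2 * qf) + l2 * (Ci ^ 2 * qg))%C with (- (l1 * qf + l2 * qg))%C.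
       - reflexivity.
       - assert (C2 : (Ci ^ 2 = - (1))%C) by (apply injective_projections; simpl; ring).
         rewrite C2. ring. }
  lra.
Qed.

(** At points with z^2 = x^2 or z^2 = - x^2 the fourth power is x^4, so F and F_zzbar do not
    see the sign, and F_zz is odd in it. *)
Lemma square_point a x u (z : C) s : 0 < x -> s * s = 1 -> Cmod z = x ->
  (z ^ 2)%C = RtoC (s * x ^ 2) ->
  F a z u = x ^ 8 + (1 + a) * x ^ 6 * u ^ 2 + x ^ 2 * u ^ 8 /\
  Fzzb a z u = 16 * x ^ 6 + (9 + 5 * a) * x ^ 4 * u ^ 2 + u ^ 8 /\
  Fu a z u = 2 * (1 + a) * x ^ 6 * u + 8 * x ^ 2 * u ^ 7 /\
  Fzz a z u = RtoC (s * (12 * x ^ 6 + (6 + 10 * a) * x ^ 4 * u ^ 2)).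
Proof.
  intros Hx Hs Hz H2.
  assert (H4 : (z ^ 4)%C = RtoC (x ^ 4)).
  { replace (z ^ 4)%C with (z ^ 2 * z ^ 2)%C by ring. rewrite H2, <- RtoC_mult. f_equal.
    replace (s * x ^ 2 * (s * x ^ 2)) with ((s * s) * x ^ 4) by ring. rewrite Hs. ring. }
  assert (Hb : (z * Cconj z)%C = RtoC (x ^ 2)) by (rewrite <- Cmod2_conj, Hz; apply eq_sym; auto using RtoC_pow).
  assert (Hc2 : (Cconj z ^ 2)%C = RtoC (s * x ^ 2)) by (rewrite <- Cpow_conj, H2; apply Cconj_R).
  unfold F, Fzzb, Fu, Fzz. rewrite H4, Hz.
  replace (Re (RtoC (x ^ 4))) with (x ^ 4) by reflexivity.
  split; [ring|split; [ring|split; [ring|]]].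
  transitivity (RtoC 12 * (z * Cconj z) ^ 2 * Cconj z ^ 2
    + (RtoC 6 * (z * Cconj z) * Cconj z ^ 2 + RtoC (10 * a) * (z * Cconj z) * z ^ 2) * RtoC (u ^ 2))%C;
    [ring|].
  rewrite Hb, Hc2, H2. rewrite <- !RtoC_mult, <- ?RtoC_pow, <- ?RtoC_mult, <- ?RtoC_plus,
    <- ?RtoC_mult, <- ?RtoC_plus. f_equal. ring.
Qed.

(** The values of F, of F_zz up to sign and of F_zzbar at z = x, ix, -x, -ix, and a
    bound for the error terms there. *)
Definition F_on_axes (a x u : R) : R := x ^ 8 + (1 + a) * x ^ 6 * u ^ 2 + x ^ 2 * u ^ 8.
Definition Fzz_on_axes (a x u : R) : R := 12 * x ^ 6 + (6 + 10 * a) * x ^ 4 * u ^ 2.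
Definition Fzzb_on_axes (a x u : R) : R := 16 * x ^ 6 + (9 + 5 * a) * x ^ 4 * u ^ 2 + u ^ 8.
Definition error_on_axes (a x u : R) : R :=
  x * (x ^ 6 + x ^ 4 * u ^ 2 + u ^ 8) + (2 * (1 + a) * x ^ 6 * u + 8 * x ^ 2 * u ^ 7).

(** The four points lie over the same w, so the alternating sum of the support
    estimates involves N only through its four-point sum. *)
Lemma four_point_estimate a U Phi : 3 / 5 < a < 9 / 5 ->
  local_coordinates origin U Phi ->
  convex_set (image Phi (fun q => U q /\ 1 * rho_M a q < 0)) ->
  exists (N : C -> C -> C) (J0 : C) K d, order6_in_z N /\ J0 <> RtoC 0 /\ 0 <= K /\ 0 < d <= 1 /\
    forall x u, 0 < x -> 0 < u -> x + u + 5 * x ^ 2 < d ->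
      let w := (u, F_on_axes a x u) : C in
      Cmod (RtoC 4 * J0 * RtoC (Fzz_on_axes a x u) - Ci * four_point N x w)
        <= 4 * (Cmod J0 * Fzzb_on_axes a x u +
          K * ((x + Cmod w) * (Fzz_on_axes a x u + Fzzb_on_axes a x u) + error_on_axes a x u)).
Proof.
  intros Ha (HU & U0 & HPhi & HI & Psi & HPsi & Hinv) Hconv.
  destruct (holomorphic2_taylor_origin _ (proj1 (HPhi _ U0)))
    as (gf & Kf & df & Rf & HKf & Hdf & Bf & Tf).
  destruct (holomorphic2_taylor_origin _ (proj2 (HPhi _ U0)))
    as (gg & Kg & dg & Rg & HKg & Hdg & Bg & Tg).
  destruct (proj1 (locally_shift _ _) (HU _ U0)) as (dU & HdU & HUm).
  set (J := fun z w => (gf 1%nat 0%nat z w * gg 0%nat 1%nat z w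
    - gf 0%nat 1%nat z w * gg 1%nat 0%nat z w)%C).
  set (N := fun z w => (gf 1%nat 0%nat z w * gg 2%nat 0%nat z w
    - gg 1%nat 0%nat z w * gf 2%nat 0%nat z w)%C).
  assert (RJ : order6_in_z J) by (apply order6_in_z_sub; apply order6_in_z_mul; auto).
  assert (RN : order6_in_z N) by (apply order6_in_z_sub; apply order6_in_z_mul; auto).
  destruct (order6_in_z_bound J RJ) as (KJ & dJ & HKJ & HdJ & _ & LJ).
  assert (R0 : rho_M a origin = 0).
  { unfold rho_M, origin, F, Re, Im. cbn [fst snd]. rewrite Cmod_0. simpl. ring. }
  assert (S0 : size2 origin = 0) by (unfold size2, origin; cbn [fst snd]; rewrite Cmod_0; ring).
  destruct (convexifiable_condition a 1 origin U Phi Psi _ _ ltac:(lra) HU U0 HPhi HI HPsi Hinv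
    Hconv R0 (Tf origin ltac:(lra)) (Tg origin ltac:(lra))) as (HJ0 & _).
  set (J0 := J (RtoC 0) (RtoC 0)). change (J0 <> RtoC 0) in HJ0.
  set (Km := Kf + Kg).
  assert (HKm : 0 <= Km ^ 2) by nra.
  set (d := Rmin (Rmin (Rmin df dg) (Rmin dU dJ)) (/ 54)).
  assert (N0 : d <= Rmin (Rmin df dg) (Rmin dU dJ)) by apply Rmin_l.
  assert (N1 := Rmin_l (Rmin df dg) (Rmin dU dJ)). assert (N2 := Rmin_r (Rmin df dg) (Rmin dU dJ)).
  assert (N3 := Rmin_l df dg). assert (N4 := Rmin_r df dg).
  assert (N5 := Rmin_l dU dJ). assert (N6 := Rmin_r dU dJ).
  assert (N7 : d <= / 54) by apply Rmin_r.
  assert (Hd : 0 < d) by (unfold d; repeat apply Rmin_pos; lra).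
  exists N, J0, (KJ + 100000 * Km ^ 2), d.
  split; [auto|split; [auto|split; [lra|split; [lra|]]]].
  intros x u Hx Hu Hxu w.
  assert (Hx2 : 0 < x ^ 2) by pos.
  (* the same value w at the four points, where z ^ 4 = x ^ 4 *)
  assert (Hpt : forall (z : C) s, s * s = 1 -> Cmod z = x -> (z ^ 2)%C = RtoC (s * x ^ 2) ->
    Cmod w <= u + 5 * x ^ 2 /\
    Cmod (J0 * RtoC (Fzz_on_axes a x u) - RtoC s * (Ci * N z w)) <= Cmod J0 * Fzzb_on_axes a x u
      + (KJ + 100000 * Km ^ 2) *
        ((x + Cmod w) * (Fzz_on_axes a x u + Fzzb_on_axes a x u) + error_on_axes a x u)).
  { intros z s Hs Hz Hz2.
    destruct (square_point a x u z s Hx Hs Hz Hz2) as (EF & EL & EU & EZ).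
    assert (Hw : Cmod w <= u + 5 * x ^ 2).
    { replace w with (RtoC u + Ci * RtoC (F_on_axes a x u))%C by (apply injective_projections; simpl; ring).
      apply Cmod_add_le; [rewrite Cmod_R_nonneg; lra|].
      rewrite Cmod_mult, Cmod_Ci, Cmod_R, Rmult_1_l. unfold F_on_axes. rewrite <- EF, <- Hz.
      apply F_bound; try lra. rewrite Rabs_pos_eq; lra. }
    split; auto.
    set (p := (z, w)).
    assert (Hp : size2 p < d) by (unfold size2, p; cbn [fst snd]; lra).
    assert (Hzd : Cmod z < d) by lra. assert (Hwd : Cmod w < d) by pos.
    assert (Up : U p) by (rewrite <- (shift_origin p); apply HUm; lra).
    assert (Rp : rho_M a p = 0).
    { unfold rho_M, p, w, Re, Im. cbn [fst snd]. rewrite EF. unfold F_on_axes. ring. }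
    destruct (convexifiable_condition a 1 p U Phi Psi _ _ ltac:(lra) HU Up HPhi HI HPsi Hinv
      Hconv Rp (Tf p ltac:(lra)) (Tg p ltac:(lra))) as (_ & l1 & l2 & R1 & R2 & Hxt).
    assert (Hwt := weight_ge0 z u).
    assert (Hwt3 : weight z u <= 3) by (apply weight_le3; [lra|rewrite Rabs_pos_eq; lra]).
    assert (Hxw : x * weight z u <= / 54 * 3) by nra.
    assert (Bf' : forall i j, Cmod (gf i j z w) <= Km).
    { intros i j. generalize (Bf i j z w ltac:(lra) ltac:(lra)). unfold Km; lra. }
    assert (Bg' : forall i j, Cmod (gg i j z w) <= Km).
    { intros i j. generalize (Bg i j z w ltac:(lra) ltac:(lra)). unfold Km; lra. }
    assert (Hest := support_estimate a p (fun i j => gf i j z w) (fun i j => gg i j z w) Km l1 l2).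
    specialize (Hest ltac:(lra)).
    specialize (Hest ltac:(change (Cmod z <= 1); lra)).
    specialize (Hest ltac:(change (Rabs u <= 1); rewrite Rabs_pos_eq; lra)).
    specialize (Hest ltac:(unfold Km; lra) Bf' Bg' R1 R2).
    specialize (Hest ltac:(intros y Hy; specialize (Hxt y Hy); rewrite Rmult_1_l in Hxt; exact Hxt)).
    unfold p in Hest. cbn [fst snd] in Hest. replace (Re w) with u in Hest by reflexivity.
    cbv zeta in Hest. fold (J z w) in Hest. fold (N z w) in Hest.
    specialize (Hest ltac:(rewrite Hz; lra)).
    assert (EW : Cmod z * weight z u + Rabs (Fu a z u) = error_on_axes a x u).
    { rewrite EU, Rabs_pos_eq.
      - unfold weight, error_on_axes. rewrite Hz. ring.
      - assert (0 <= x ^ 6 * u) by pos.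
        assert (0 <= x ^ 2 * u ^ 7) by pos. nra. }
    rewrite EW, EZ, EL in Hest. fold (Fzz_on_axes a x u) in Hest. fold (Fzzb_on_axes a x u) in Hest.
    assert (HJ : Cmod (J z w - J0) <= KJ * (x + Cmod w)) by (rewrite <- Hz; apply LJ; lra).
    assert (HT4 : 0 <= Fzz_on_axes a x u).
    { unfold Fzz_on_axes. nra. }
    assert (HL4 : 0 <= Fzzb_on_axes a x u).
    { unfold Fzzb_on_axes. nra. }
    assert (HE4 : 0 <= error_on_axes a x u).
    { rewrite <- EW. generalize (Rabs_pos (Fu a z u)). rewrite Hz.
      assert (0 <= x * weight z u) by pos. lra. }
    assert (Hs1 : Cmod (RtoC s) = 1).
    { rewrite Cmod_R. destruct (Rle_lt_dec 0 s); [rewrite Rabs_pos_eq; nra|rewrite Rabs_left; nra]. }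
    replace (J0 * RtoC (Fzz_on_axes a x u) - RtoC s * (Ci * N z w))%C with
      (RtoC s * (J z w * RtoC (s * Fzz_on_axes a x u) - Ci * N z w)
       - (J z w - J0) * RtoC (Fzz_on_axes a x u))%C.
    2: { rewrite RtoC_mult.
         replace (RtoC s * (J z w * (RtoC s * RtoC (Fzz_on_axes a x u)) - Ci * N z w))%C with
           (RtoC (s * s) * J z w * RtoC (Fzz_on_axes a x u) - RtoC s * (Ci * N z w))%C
           by (rewrite RtoC_mult; ring). rewrite Hs. ring. }
    eapply Rle_trans.
    { apply Cmod_sub_le.
      - rewrite Cmod_mult, Hs1, Rmult_1_l. exact Hest.
      - apply Cmod_mult_le; [exact HJ|rewrite Cmod_R_nonneg; [apply Rle_refl|auto]]. }
    assert (HJz : Cmod (J z w) <= Cmod J0 + KJ * (x + Cmod w)).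
    { replace (J z w) with (J0 + (J z w - J0))%C by ring. apply Cmod_add_le; [lra|auto]. }
    apply (Rmult_le_compat_r (Fzzb_on_axes a x u)) in HJz; auto.
    assert (G1 : 0 <= KJ * error_on_axes a x u) by pos.
    assert (G2 : 0 <= Km ^ 2 * ((x + Cmod w) * (Fzz_on_axes a x u + Fzzb_on_axes a x u))) by pos.
    lra. }
  assert (C2 : (Ci ^ 2 = - (1))%C) by (apply injective_projections; simpl; ring).
  assert (NX : Cmod (RtoC x) = x) by (apply Cmod_R_nonneg; lra).
  assert (NiX : Cmod (Ci * RtoC x) = x) by (rewrite Cmod_mult, Cmod_Ci, NX; ring).
  assert (SX : (RtoC x ^ 2)%C = RtoC (1 * x ^ 2)) by (rewrite Rmult_1_l; apply eq_sym, RtoC_pow).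
  assert (SiX : ((Ci * RtoC x) ^ 2)%C = RtoC (-1 * x ^ 2)).
  { rewrite Cpow_mult_l, C2, <- RtoC_pow. apply injective_projections; simpl; ring. }
  destruct (Hpt (RtoC x) 1 ltac:(lra) NX SX) as [_ P0].
  destruct (Hpt (Ci * RtoC x)%C (-1) ltac:(lra) NiX SiX) as [_ P1].
  destruct (Hpt (- RtoC x)%C 1 ltac:(lra) ltac:(now rewrite Cmod_opp)
    ltac:(rewrite <- SX; ring)) as [_ P2].
  destruct (Hpt (- (Ci * RtoC x))%C (-1) ltac:(lra) ltac:(now rewrite Cmod_opp)
    ltac:(rewrite <- SiX; ring)) as [_ P3].
  set (T := RtoC (Fzz_on_axes a x u)) in *.
  set (B := Cmod J0 * Fzzb_on_axes a x u + _) in *.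
  replace (RtoC (-1)) with (- (1))%C in * by (apply injective_projections; simpl; ring).
  replace (RtoC 4 * J0 * T - Ci * four_point N x w)%C with
    ((J0 * T - 1 * (Ci * N (RtoC x) w)) + (J0 * T - - (1) * (Ci * N (Ci * RtoC x)%C w))
     + (J0 * T - 1 * (Ci * N (- RtoC x)%C w)) + (J0 * T - - (1) * (Ci * N (- (Ci * RtoC x))%C w)))%C
    by (unfold four_point; ring).
  replace (4 * B) with (B + B + B + B) by ring.
  apply Cmod_add_le; [apply Cmod_add_le; [apply Cmod_add_le|]|]; auto.
Qed.

(** With u = t^4, the points x = t^6 bound the coefficient of z^2 in N by t^20, and the
    points x = t^5 then compare 6 + 10a with 9 + 5a. *)
Lemma inner_side_not_convex a U Phi : 3 / 5 < a < 9 / 5 ->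
  local_coordinates origin U Phi ->
  ~ convex_set (image Phi (fun q => U q /\ 1 * rho_M a q < 0)).
Proof.
  intros Ha HPhi Hconv.
  destruct (four_point_estimate a U Phi Ha HPhi Hconv) as (N & J0 & K & d & RN & HJ0 & HK & Hd & H).
  destruct (order6_in_z_four_point N RN) as (c & Kc & dc & HKc & Hdc & Hc & Lc).
  set (A := Cmod J0). assert (HA : 0 < A) by now apply Cmod_gt_0.
  set (C1 := 4 * 38 * A + 4 * (36 * A + 535 * K) + Kc).
  assert (HC1 : 0 <= C1) by (unfold C1; lra).
  set (C2 := 4 * (17 * A + 535 * K) + 4 * (C1 + 10 * Kc) + Kc).
  assert (E0 : 4 * A * (5 * a - 3) = 0).
  2: { assert (0 < A * (5 * a - 3)) by pos. lra. }
  apply (zero_of_linear_bound _ C2 (Rmin d dc / 8)).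
  { generalize (Rmin_pos d dc). lra. }
  { unfold C2; lra. }
  intros t [Ht0 Ht].
  assert (M1 := Rmin_l d dc). assert (M2 := Rmin_r d dc).
  assert (Ht1 : t <= 1) by lra.
  assert (Pw : forall m n, (n <= m)%nat -> 0 <= t ^ m <= t ^ n).
  { intros m n Hmn. split; [apply pow_le; lra|].
    replace m with (n + (m - n))%nat by lia. rewrite pow_add.
    generalize (pow_le1 t (m - n) ltac:(lra)) (pow_le t n ltac:(lra)). nra. }
  set (u := t ^ 4). set (x := t ^ 5). set (y := t ^ 6).
  assert (Hu : 0 < u) by (apply pow_lt; auto). assert (Hx : 0 < x) by (apply pow_lt; auto).
  assert (Hy : 0 < y) by (apply pow_lt; auto).
  assert (Hut : u <= t) by (generalize (Pw 4%nat 1%nat ltac:(lia)); unfold u; simpl; lra).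
  assert (Hxt : x <= u) by (generalize (Pw 5%nat 4%nat ltac:(lia)); unfold u, x; lra).
  assert (Hyt : y <= u) by (generalize (Pw 6%nat 4%nat ltac:(lia)); unfold u, y; lra).
  assert (Hx2 : x ^ 2 <= x) by nra.
  assert (Hy2 : y ^ 2 <= y) by nra.
  assert (Px := H x u Hx Hu ltac:(lra)). assert (Py := H y u Hy Hu ltac:(lra)).
  cbv zeta in Px, Py. set (wx := (u, F_on_axes a x u) : C) in *. set (wy := (u, F_on_axes a y u) : C) in *.
  (* all quantities are polynomials in t at the two scales *)
  assert (ETx : Fzz_on_axes a x u = 12 * t ^ 30 + (6 + 10 * a) * t ^ 28)
    by (unfold Fzz_on_axes, x, u; ring).
  assert (ELx : Fzzb_on_axes a x u = 16 * t ^ 30 + (9 + 5 * a) * t ^ 28 + t ^ 32)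
    by (unfold Fzzb_on_axes, x, u; ring).
  assert (EEx : error_on_axes a x u = t ^ 35 + t ^ 33 + t ^ 37 + 2 * (1 + a) * t ^ 34 + 8 * t ^ 38)
    by (unfold error_on_axes, x, u; ring).
  assert (EFx : F_on_axes a x u = t ^ 40 + (1 + a) * t ^ 38 + t ^ 42) by (unfold F_on_axes, x, u; ring).
  assert (ETy : Fzz_on_axes a y u = 12 * t ^ 36 + (6 + 10 * a) * t ^ 32)
    by (unfold Fzz_on_axes, y, u; ring).
  assert (ELy : Fzzb_on_axes a y u = 16 * t ^ 36 + (9 + 5 * a) * t ^ 32 + t ^ 32)
    by (unfold Fzzb_on_axes, y, u; ring).
  assert (EEy : error_on_axes a y u = t ^ 42 + t ^ 38 + t ^ 38 + 2 * (1 + a) * t ^ 40 + 8 * t ^ 40)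
    by (unfold error_on_axes, y, u; ring).
  assert (EFy : F_on_axes a y u = t ^ 48 + (1 + a) * t ^ 44 + t ^ 44) by (unfold F_on_axes, y, u; ring).
  assert (Q30 := Pw 30%nat 28%nat ltac:(lia)). assert (Q32 := Pw 32%nat 30%nat ltac:(lia)).
  assert (Q33 := Pw 33%nat 32%nat ltac:(lia)). assert (Q34 := Pw 34%nat 33%nat ltac:(lia)).
  assert (Q35 := Pw 35%nat 34%nat ltac:(lia)). assert (Q36 := Pw 36%nat 35%nat ltac:(lia)).
  assert (Q37 := Pw 37%nat 36%nat ltac:(lia)). assert (Q38 := Pw 38%nat 37%nat ltac:(lia)).
  assert (Q40 := Pw 40%nat 38%nat ltac:(lia)). assert (Q42 := Pw 42%nat 40%nat ltac:(lia)).
  assert (Q44 := Pw 44%nat 42%nat ltac:(lia)). assert (Q48 := Pw 48%nat 44%nat ltac:(lia)).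
  assert (Q20 := Pw 38%nat 20%nat ltac:(lia)). assert (Q4 := Pw 38%nat 4%nat ltac:(lia)).
  assert (Qa : forall m, 0 <= t ^ m -> 0 <= a * t ^ m <= 9 / 5 * t ^ m)
    by (intros; split; [apply Rmult_le_pos|apply Rmult_le_compat_r]; lra).
  assert (Qa28 := Qa 28%nat ltac:(lra)). assert (Qa32 := Qa 32%nat ltac:(lra)).
  assert (Qa34 := Qa 34%nat ltac:(lra)). assert (Qa38 := Qa 38%nat ltac:(lra)).
  assert (Qa40 := Qa 40%nat ltac:(lra)). assert (Qa44 := Qa 44%nat ltac:(lra)).
  assert (Hw : forall f, 0 <= f <= 5 * t ^ 38 -> Cmod ((u, f) : C) <= 6 * t ^ 4).
  { intros f Hf. replace ((u, f) : C) with (RtoC u + Ci * RtoC f)%C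
      by (apply injective_projections; simpl; ring).
    eapply Rle_trans; [apply Cmod_triangle|].
    rewrite Cmod_mult, Cmod_Ci, !Cmod_R_nonneg by lra. unfold u; lra. }
  assert (Wx : Cmod wx <= 6 * t ^ 4) by (apply Hw; rewrite EFx; lra).
  assert (Wy : Cmod wy <= 6 * t ^ 4) by (apply Hw; rewrite EFy; lra).
  assert (Wx0 := Cmod_ge_0 wx). assert (Wy0 := Cmod_ge_0 wy).
  fold u in Wx, Wy.
  assert (Bx : (x + Cmod wx) * (Fzz_on_axes a x u + Fzzb_on_axes a x u)
    + error_on_axes a x u <= 535 * t ^ 30).
  { assert ((x + Cmod wx) * (Fzz_on_axes a x u + Fzzb_on_axes a x u) <= (7 * t ^ 4) * (74 * t ^ 28)).
    { apply Rmult_le_compat; fold u; lra. }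
    replace (7 * t ^ 4 * (74 * t ^ 28)) with (518 * t ^ 32) in * by ring. lra. }
  assert (By : (y + Cmod wy) * (Fzz_on_axes a y u + Fzzb_on_axes a y u)
    + error_on_axes a y u <= 535 * t ^ 32).
  { assert ((y + Cmod wy) * (Fzz_on_axes a y u + Fzzb_on_axes a y u) <= 7 * (74 * t ^ 32)).
    { apply Rmult_le_compat; lra. }
    lra. }
  apply (Rmult_le_compat_l K) in Bx; auto. apply (Rmult_le_compat_l K) in By; auto.
  assert (ALx : A * Fzzb_on_axes a x u <= A * ((9 + 5 * a) * t ^ 28 + 17 * t ^ 30)) by nra.
  assert (ALy : A * Fzzb_on_axes a y u <= A * (36 * t ^ 32)) by nra.
  fold A in Px, Py.
  assert (Dx := Hc x wx ltac:(lra) ltac:(lra)). assert (Dy := Hc y wy ltac:(lra) ltac:(lra)).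
  assert (Nn : forall f v, Cmod (RtoC 4 * c f * RtoC v) = 4 * Cmod (c f) * Rabs v).
  { intros f v. rewrite !Cmod_mult, !Cmod_R, (Rabs_pos_eq 4) by lra. ring. }
  assert (NT : forall v, 0 <= v -> Cmod (RtoC 4 * J0 * RtoC v) = 4 * A * v).
  { intros v Hv. rewrite !Cmod_mult, !Cmod_R_nonneg by lra. reflexivity. }
  (* the coefficient of z ^ 2 is negligible *)
  assert (Cy : Cmod (c wy) <= C1 * t ^ 20).
  { set (D := four_point N y wy) in *.
    assert (G1 : Cmod (RtoC 4 * c wy * RtoC (y ^ 2)) <= 4 * A * Fzz_on_axes a y u
       + 4 * (A * Fzzb_on_axes a y u +
         K * ((y + Cmod wy) * (Fzz_on_axes a y u + Fzzb_on_axes a y u) + error_on_axes a y u))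
       + Kc * y ^ 6).
    { replace (RtoC 4 * c wy * RtoC (y ^ 2))%C with
        (- Ci * (RtoC 4 * J0 * RtoC (Fzz_on_axes a y u))
         + Ci * (RtoC 4 * J0 * RtoC (Fzz_on_axes a y u) - Ci * D)
         + - (D - RtoC 4 * c wy * RtoC (y ^ 2)))%C.
      2: { assert (CC : (Ci * Ci = - (1))%C) by (apply injective_projections; simpl; ring).
           transitivity (- (Ci * Ci) * D - (D - RtoC 4 * c wy * RtoC (y ^ 2)))%C; [ring|].
           rewrite CC. ring. }
      apply Cmod_add_le; [apply Cmod_add_le|].
      - rewrite Cmod_mult, Cmod_opp, Cmod_Ci, Rmult_1_l. right. apply NT. rewrite ETy; lra.
      - rewrite Cmod_mult, Cmod_Ci, Rmult_1_l. exact Py.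
      - rewrite Cmod_opp. exact Dy. }
    rewrite Nn, Rabs_pos_eq in G1 by pos.
    assert (EA : A * Fzz_on_axes a y u <= A * (38 * t ^ 32)) by (apply Rmult_le_compat_l; lra).
    assert (EK : Kc * y ^ 6 <= Kc * t ^ 32).
    { apply Rmult_le_compat_l; auto. replace (y ^ 6) with (t ^ 36) by (unfold y; ring). lra. }
    apply Rmult_le_reg_r with (t ^ 12); [apply pow_lt; auto|].
    replace (y ^ 2) with (t ^ 12) in G1 by (unfold y; ring).
    replace (C1 * t ^ 20 * t ^ 12) with (C1 * t ^ 32) by ring.
    assert (0 <= Cmod (c wy) * t ^ 12) by pos.
    unfold C1. lra. }
  assert (Cx : Cmod (c wx) <= (C1 + 10 * Kc) * t ^ 20).
  { replace (c wx) with (c wy + (c wx - c wy))%C by ring.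
    rewrite Rmult_plus_distr_r. apply Cmod_add_le; auto.
    eapply Rle_trans; [apply Lc; lra|].
    replace (10 * Kc * t ^ 20) with (Kc * (10 * t ^ 20)) by ring.
    apply Rmult_le_compat_l; auto.
    replace (wx - wy)%C with (Ci * (RtoC (F_on_axes a x u) + - RtoC (F_on_axes a y u)))%C
      by (apply injective_projections; simpl; ring).
    rewrite Cmod_mult, Cmod_Ci, Rmult_1_l.
    eapply Rle_trans; [apply Cmod_triangle|].
    rewrite Cmod_opp, !Cmod_R_nonneg by pos. rewrite EFx, EFy. lra. }
  assert (G2 : 4 * A * Fzz_on_axes a x u <= 4 * (A * Fzzb_on_axes a x u +
     K * ((x + Cmod wx) * (Fzz_on_axes a x u + Fzzb_on_axes a x u)
     + error_on_axes a x u)) + (Kc * x ^ 6 + 4 * Cmod (c wx) * x ^ 2)).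
  { set (D := four_point N x wx) in *.
    rewrite <- NT by pos.
    replace (RtoC 4 * J0 * RtoC (Fzz_on_axes a x u))%C with
      ((RtoC 4 * J0 * RtoC (Fzz_on_axes a x u) - Ci * D)
       + Ci * ((D - RtoC 4 * c wx * RtoC (x ^ 2)) + RtoC 4 * c wx * RtoC (x ^ 2)))%C by ring.
    apply Cmod_add_le; auto. rewrite Cmod_mult, Cmod_Ci, Rmult_1_l.
    apply Cmod_add_le; auto. rewrite Nn, Rabs_pos_eq by pos. lra. }
  replace (x ^ 6) with (t ^ 30) in G2 by (unfold x; ring).
  replace (x ^ 2) with (t ^ 10) in G2 by (unfold x; ring).
  assert (G3 : Cmod (c wx) * t ^ 10 <= (C1 + 10 * Kc) * t ^ 30).
  { replace ((C1 + 10 * Kc) * t ^ 30) with ((C1 + 10 * Kc) * t ^ 20 * t ^ 10) by ring.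
    apply Rmult_le_compat_r; [apply pow_le; lra|auto]. }
  assert (G4 : A * Fzz_on_axes a x u >= A * ((6 + 10 * a) * t ^ 28)).
  { apply Rle_ge, Rmult_le_compat_l; lra. }
  rewrite Rabs_pos_eq by pos.
  apply Rmult_le_reg_r with (t ^ 28); [apply pow_lt; auto|].
  assert (G5 : C2 * t ^ 30 <= C2 * t * t ^ 28).
  { replace (C2 * t ^ 30) with (C2 * t * t ^ 28 * t) by ring.
    assert (0 <= C2 * t * t ^ 28).
    { apply Rmult_le_pos; [apply Rmult_le_pos; [unfold C2|]; lra|lra]. }
    rewrite <- (Rmult_1_r (C2 * t * t ^ 28)) at 2. apply Rmult_le_compat_l; lra. }
  unfold C2 in *. lra.
Qed.

Theorem not_locally_convexifiable a : 3 / 5 < a < 9 / 5 ->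
  ~ locally_convexifiable (rho_M a) origin.
Proof.
  assert (Hext : forall A B : C * C -> Prop, (forall q, A q <-> B q) -> convex_set A -> convex_set B).
  { intros A B E H p q Bp Bq t Ht. apply E. apply H; auto; now apply E. }
  intros Ha (U & Phi & HPhi & [H|H]).
  - apply (inner_side_not_convex a U Phi Ha HPhi). revert H. apply Hext. intros q.
    split; intros (r & [Ur Hr] & E); exists r; repeat split; auto; lra.
  - apply (outer_side_not_convex a U Phi Ha HPhi). revert H. apply Hext. intros q.
    split; intros (r & [Ur Hr] & E); exists r; repeat split; auto; lra.
Qed.

(** * Polynomial shears and the model at the origin *)

Lemma psum_stable (b : nat -> C) k N z : (forall n, (k <= n)%nat -> b n = RtoC 0) ->
  (k <= N)%nat -> psum b N z = psum b k z.
Proof.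
  intros Hb Hk. induction N as [|N IH]; [now replace k with 0%nat by lia|].
  destruct (Nat.eq_dec k (S N)) as [->|]; auto.
  simpl. rewrite IH, Hb by lia. ring.
Qed.

Lemma sum_n_stable (f : nat -> R) k N : (forall n, (k < n)%nat -> f n = 0) -> (k <= N)%nat ->
  sum_n f N = sum_n f k.
Proof.
  intros Hf Hk. induction N as [|N IH]; [now replace k with 0%nat by lia|].
  destruct (Nat.eq_dec k (S N)) as [->|]; auto.
  rewrite sum_Sn, IH, Hf by lia. apply Rplus_0_r.
Qed.

Lemma quadratic_holomorphic2 z0 w0 A B D E p :
  holomorphic2_at (fun q => A + B * (fst q - z0) + D * (snd q - w0) + E * (fst q - z0) ^ 2)%C p.
Proof.
  set (f := fun q : C * C => (A + B * (fst q - z0) + D * (snd q - w0) + E * (fst q - z0) ^ 2)%C).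
  set (c := fun m n => match m, n with
    | 0%nat, 0%nat => f p
    | 1%nat, 0%nat => (B + RtoC 2 * E * (fst p - z0))%C
    | 0%nat, 1%nat => D
    | 2%nat, 0%nat => E
    | _, _ => RtoC 0 end).
  assert (Cn : forall m n, (2 <= n)%nat -> c m n = RtoC 0).
  { intros m n Hn. destruct n as [|[|n]]; try lia. now destruct m as [|[|[|m]]]. }
  assert (Cm : forall m n, (3 <= m)%nat -> c m n = RtoC 0).
  { intros m n Hm. now destruct m as [|[|[|m]]]; try lia. }
  exists c, (mkposreal 1 Rlt_0_1). intros h1 h2 _ _. split.
  - set (g := fun m n => Cmod (c m n) * Cmod h1 ^ m * Cmod h2 ^ n).
    assert (Hg : forall m n, 0 <= g m n).
    { intros m n. unfold g. repeat apply Rmult_le_pos; try apply pow_le; apply Cmod_ge_0. }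
    set (s := fun N => sum_n (fun m => sum_n (fun n => g m n) N) N).
    assert (Hs : forall N, 0 <= s N) by (intros; repeat (apply sum_n_nonneg; intros); auto).
    exists (s 0%nat + s 1%nat + s 2%nat). intros N. change (s N <= s 0%nat + s 1%nat + s 2%nat).
    assert (S0 := Hs 0%nat). assert (S1 := Hs 1%nat). assert (S2 := Hs 2%nat).
    destruct N as [|[|N]]; [lra|lra|].
    replace (s (S (S N))) with (s 2%nat); [lra|]. unfold s.
    rewrite (sum_n_stable _ 2 (S (S N))).
    + apply sum_n_ext. intros m.
      rewrite (sum_n_stable _ 1 (S (S N))), (sum_n_stable _ 1 2); auto; try lia;
        intros n Hn; unfold g; rewrite Cn, Cmod_0 by lia; ring.
    + intros m Hm. rewrite (sum_n_stable _ 0 (S (S N))); try lia.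
      * rewrite sum_O. unfold g. rewrite Cm, Cmod_0 by lia. ring.
      * intros n _. unfold g. rewrite Cm, Cmod_0 by lia. ring.
    + lia.
  - apply filterlim_C. intros e He. exists 2%nat. intros N HN.
    rewrite double_sum_psum.
    rewrite (psum_stable _ 3).
    + assert (Ei : forall m, psum (c m) (S N) h2 = psum (c m) 2 h2)
        by (intros m; apply psum_stable; auto; lia).
      unfold psum at 1. rewrite !Ei. unfold c, psum.
      match goal with |- Cmod ?x < _ => replace x with (RtoC 0) end.
      * now rewrite Cmod_0.
      * unfold f; cbn [fst snd]. simpl. ring.
    + intros m Hm. rewrite (psum_stable _ 0); [reflexivity| |lia]. intros n _. now apply Cm.
    + lia.
Qed.

(** For c <> 0 a polynomial coordinate change centered at p; it serves for both models. *)
Definition shear (p : C * C) (b c e : C) (q : C * C) : C * C :=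
  ((fst q - fst p)%C,
   (b * (fst q - fst p) + c * (snd q - snd p) + e * (fst q - fst p) ^ 2)%C).

Definition unshear (p : C * C) (b c e : C) (q : C * C) : C * C :=
  shift p (fst q, ((snd q - b * fst q - e * fst q ^ 2) / c)%C).

Lemma unshear_shear p b c e q : c <> RtoC 0 -> unshear p b c e (shear p b c e q) = q.
Proof.
  intros Hc. destruct q as [z w]. unfold unshear, shear, shift; cbn [fst snd].
  f_equal; [ring|field; auto].
Qed.

Lemma shear_unshear p b c e q : c <> RtoC 0 -> shear p b c e (unshear p b c e q) = q.
Proof.
  intros Hc. destruct q as [z w]. unfold unshear, shear, shift; cbn [fst snd].
  f_equal; [ring|field; auto].
Qed.

Lemma holomorphic2_ext f g p : (forall q, f q = g q) -> holomorphic2_at f p -> holomorphic2_at g p.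
Proof.
  intros H. now rewrite (FunctionalExtensionality.functional_extensionality f g H).
Qed.

Lemma shear_holomorphic p b c e W : holomorphic_on W (shear p b c e).
Proof.
  intros q _. split; cbn [shear fst snd].
  - eapply holomorphic2_ext; [|apply (quadratic_holomorphic2 (fst p) (snd p) (RtoC 0) (RtoC 1)
      (RtoC 0) (RtoC 0))]. intros r; cbv beta; ring.
  - eapply holomorphic2_ext; [|apply (quadratic_holomorphic2 (fst p) (snd p) (RtoC 0) b c e)].
    intros r; cbv beta; ring.
Qed.

Lemma unshear_holomorphic p b c e W : c <> RtoC 0 -> holomorphic_on W (unshear p b c e).
Proof.
  intros Hc q _. split; cbn [unshear shift fst snd].
  - eapply holomorphic2_ext; [|apply (quadratic_holomorphic2 (RtoC 0) (RtoC 0) (fst p) (RtoC 1)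
      (RtoC 0) (RtoC 0))]. intros r; cbv beta; ring.
  - eapply holomorphic2_ext; [|apply (quadratic_holomorphic2 (RtoC 0) (RtoC 0) (snd p) (- b / c)%C
      (RtoC 1 / c)%C (- e / c)%C)]. intros r; cbv beta; field; auto.
Qed.

Lemma shear_coordinates p b c e U : c <> RtoC 0 -> open U -> U p ->
  local_coordinates p U (shear p b c e).
Proof.
  intros Hc HU Up. split; [auto|split; [auto|split; [apply shear_holomorphic|split]]].
  - intros q (r & Ur & Eq). apply locally_shift.
    destruct (proj1 (locally_shift _ _) (HU _ Ur)) as (dU & HdU & HUm).
    destruct (holomorphic_lipschitz (fun _ => True) (unshear p b c e) q
      (unshear_holomorphic p b c e _ Hc) I) as (K & d & HK & Hd & H).
    assert (Er : unshear p b c e q = r) by (rewrite <- Eq; now apply unshear_shear).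
    rewrite Er in H.
    exists (Rmin d (dU / (1 + K))).
    split; [apply Rmin_pos; auto; apply Rdiv_lt_0_compat; lra|].
    intros h Hh. assert (M1 := Rmin_l d (dU / (1 + K))). assert (M2 := Rmin_r d (dU / (1 + K))).
    exists (unshear p b c e (shift q h)). split; [|now apply shear_unshear].
    rewrite <- (shift_diff r (unshear p b c e (shift q h))). apply HUm.
    eapply Rle_lt_trans; [apply H; lra|]. assert (Hn := size2_ge0 h).
    assert (size2 h * (1 + K) < dU).
    { apply Rlt_le_trans with (dU / (1 + K) * (1 + K)).
      - apply Rmult_lt_compat_r; lra.
      - right; field; lra. }
    lra.
  - exists (unshear p b c e). split; [now apply unshear_holomorphic|].
    intros q _. now apply unshear_shear.
Qed.

Lemma shear_center p b c e : shear p b c e p = (RtoC 0, RtoC 0).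
Proof. unfold shear. f_equal; ring. Qed.

Lemma sum_n_m_Re_zero (f : nat -> R) m n : (forall k, f k = 0) -> sum_n_m f m n = 0.
Proof.
  intros H. rewrite (sum_n_m_ext _ (fun _ => 0) m n H), sum_n_m_const. apply Rmult_0_r.
Qed.

Lemma model_function_radial k a0 z : model_function k a0 (fun _ => RtoC 0) z = a0 * Cmod z ^ k.
Proof.
  unfold model_function. rewrite sum_n_m_Re_zero; [ring|].
  intros j. replace (RtoC 0 * z ^ j)%C with (RtoC 0) by ring. unfold Re; simpl. ring.
Qed.

Theorem model_origin a : 0 <= a <= 2 -> model_at (rho_M a) origin 8 (fun z => Cmod z ^ 8).
Proof.
  intros Ha. split; [now apply finite_type_8|split].
  - exists 1, (fun _ => RtoC 0). split; [lra|]. intros z. rewrite model_function_radial. ring.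
  - exists (fun _ => True), (shear origin (RtoC 0) (RtoC 1) (RtoC 0)), (F a).
    assert (E : forall q, shear origin (RtoC 0) (RtoC 1) (RtoC 0) q = q).
    { intros [z w]. unfold shear, origin; cbn [fst snd]. f_equal; ring. }
    split; [|split; [apply shear_center|split]].
    + apply shear_coordinates; auto.
      * intros H; apply RtoC_inj in H; lra.
      * intros q _. apply locally_shift. exists 1. split; [lra|auto].
    + intros q _. rewrite E. cbv zeta. unfold rho_M. split; split; lra.
    + intros eps Heps. exists (Rmin 1 (eps / 4)). split; [apply Rmin_pos; lra|].
      intros z u Hz Hu. assert (M1 := Rmin_l 1 (eps / 4)). assert (M2 := Rmin_r 1 (eps / 4)).
      eapply Rle_trans; [apply F_le_pow; auto; lra|].
      assert (P2 : 0 <= Cmod z ^ 2 <= 1) by (apply pow_le1; split; [apply Cmod_ge_0|lra]).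
      assert (P8 : 0 <= Cmod z ^ 8) by (apply pow_le, Cmod_ge_0).
      rewrite <- (Rabs_pos_eq (u ^ 2)), <- RPow_abs by (apply (pow_even_ge0 u 1)).
      assert (U0 := Rabs_pos u).
      assert (Rabs u ^ 2 <= eps / 4 * Rabs u) by (simpl; nra).
      assert (0 <= Rabs u ^ 2) by (apply pow_le; auto).
      assert (4 * Cmod z ^ 2 * Rabs u ^ 2 <= 4 * Rabs u ^ 2) by nra.
      assert (0 <= eps * Cmod z ^ 8) by (apply Rmult_le_pos; lra). lra.
Qed.

Lemma Cmod_convex z1 z2 t : 0 <= t <= 1 ->
  Cmod (RtoC t * z1 + (1 - RtoC t) * z2) <= t * Cmod z1 + (1 - t) * Cmod z2.
Proof.
  intros Ht. rewrite <- RtoC_minus. eapply Rle_trans; [apply Cmod_triangle|].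
  rewrite !Cmod_mult, !Cmod_R_nonneg by lra. lra.
Qed.

(** By induction; the step is the Chebyshev inequality for x, y and their n-th powers. *)
Lemma pow_convex x y t n : 0 <= x -> 0 <= y -> 0 <= t <= 1 ->
  (t * x + (1 - t) * y) ^ n <= t * x ^ n + (1 - t) * y ^ n.
Proof.
  intros Hx Hy Ht. induction n as [|n IH]; [simpl; lra|].
  assert (0 <= t * x + (1 - t) * y).
  { assert (0 <= t * x) by (apply Rmult_le_pos; lra).
    assert (0 <= (1 - t) * y) by (apply Rmult_le_pos; lra). lra. }
  simpl. eapply Rle_trans; [apply Rmult_le_compat_l; [auto|exact IH]|].
  (* Chebyshev: x and x ^ n are ordered in the same way *)
  assert (C : 0 <= (x - y) * (x ^ n - y ^ n)).
  { destruct (Rle_dec x y) as [L|L].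
    - assert (x ^ n <= y ^ n) by (apply pow_incr; lra). nra.
    - assert (y ^ n <= x ^ n) by (apply pow_incr; lra). nra. }
  assert (0 <= t * (1 - t)) by nra.
  assert (0 <= t * (1 - t) * ((x - y) * (x ^ n - y ^ n))) by (apply Rmult_le_pos; auto).
  nra.
Qed.

Lemma radial_convex_model c n : 0 <= c -> convex_model (fun z => c * Cmod z ^ n).
Proof.
  intros Hc [z1 w1] [z2 w2] H1 H2 t Ht. cbn [fst snd] in *.
  assert (A := Cmod_convex z1 z2 t Ht).
  assert (B : Cmod (RtoC t * z1 + (1 - RtoC t) * z2) ^ n
    <= t * Cmod z1 ^ n + (1 - t) * Cmod z2 ^ n).
  { eapply Rle_trans; [apply pow_incr; split; [apply Cmod_ge_0|exact A]|].
    apply pow_convex; auto using Cmod_ge_0. }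
  apply (Rmult_le_compat_l c) in B; auto.
  replace (Im (RtoC t * w1 + (1 - RtoC t) * w2)%C) with (t * Im w1 + (1 - t) * Im w2).
  2: { destruct w1, w2. unfold Im; simpl. ring. }
  destruct (Req_dec t 0) as [->|]; [lra|].
  assert (t * (c * Cmod z1 ^ n) < t * Im w1) by (apply Rmult_lt_compat_l; lra).
  assert ((1 - t) * (c * Cmod z2 ^ n) <= (1 - t) * Im w2) by (apply Rmult_le_compat_l; lra).
  lra.
Qed.

(** * Solving for the graph *)

(** Existence by the intermediate value theorem, uniqueness by monotonicity in v. The
    expansion first gives |v| <= B (|z|^2 + |u|) for the solution, and inserting this
    into the remainder gives the o-estimate. *)
Lemma implicit_graph (f : C -> R -> R -> R) L K d : 0 < L -> 0 <= K -> 0 < d <= 1 ->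
  (forall z u v, Cmod z < d -> Rabs u < d -> Rabs v < d ->
     Rabs (f z u v - (L * Cmod z ^ 2 - v)) <=
       K * (Cmod z * (Rabs u + Rabs v) + (Rabs u + Rabs v) ^ 2 + Cmod z ^ 3)) ->
  (forall z u v1 v2, Cmod z < d -> Rabs u < d -> Rabs v1 < d -> Rabs v2 < d -> v1 < v2 ->
     f z u v2 < f z u v1) ->
  (forall z u, continuity (f z u)) ->
  exists G r r', 0 < r <= d /\ 0 < r' <= d /\
    (forall z u v, Cmod z < r' -> Rabs u < r' -> Rabs v < r ->
       (f z u v = 0 <-> v = G z u) /\ (f z u v < 0 <-> v > G z u)) /\
    (forall eps, 0 < eps -> exists delta, 0 < delta /\
       forall z u, Cmod z < delta -> Rabs u < delta ->
         Rabs (G z u - L * Cmod z ^ 2) <= eps * (Cmod z ^ 2 + Rabs u)).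
Proof.
  intros HL HK Hd H1 H2 H3.
  set (r := Rmin (d / 2) (/ (16 * (K + 1)))).
  assert (R0 : 0 < / (16 * (K + 1))) by (apply Rinv_0_lt_compat; lra).
  assert (R1 : r <= d / 2) by apply Rmin_l.
  assert (R2 : r <= / (16 * (K + 1))) by apply Rmin_r.
  assert (Hr : 0 < r) by (unfold r; apply Rmin_pos; lra).
  assert (RK : K * r <= / 16).
  { apply Rle_trans with ((K + 1) * / (16 * (K + 1))); [|right; field; lra].
    apply Rmult_le_compat; lra. }
  set (r' := r / (8 * (1 + L + 5 * K))).
  assert (Hr' : 0 < r') by (apply Rdiv_lt_0_compat; lra).
  assert (R3 : r' * (1 + L + 5 * K) <= r / 8).
  { right. unfold r'. field. lra. }
  assert (RL : 0 <= r' * L) by (apply Rmult_le_pos; lra).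
  assert (RK' : 0 <= r' * K) by (apply Rmult_le_pos; lra).
  assert (R4 : r' <= r / 8) by lra.
  assert (Hsol : forall z u, Cmod z < r' -> Rabs u < r' -> exists v, Rabs v < r /\ f z u v = 0).
  { intros z u Hz Hu. assert (Z := Cmod_ge_0 z). assert (U := Rabs_pos u).
    assert (Hend : forall v, Rabs v = r / 2 ->
      Rabs (f z u v - (L * Cmod z ^ 2 - v)) <= r' * (4 * K) + r / 16).
    { intros v Hv. eapply Rle_trans; [apply H1; lra|]. rewrite Hv.
      assert (A1 : Cmod z * (Rabs u + r / 2) <= r' * 1) by (apply Rmult_le_compat; lra).
      assert (A2 : (Rabs u + r / 2) ^ 2 <= 2 * r' + r ^ 2 / 2).
      { assert (Rabs u ^ 2 <= r' * 1) by (simpl; rewrite Rmult_1_r; apply Rmult_le_compat; lra).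
        assert (0 <= (Rabs u - r / 2) ^ 2) by (apply (pow_even_ge0 _ 1)). simpl in *. lra. }
      assert (A3 : Cmod z ^ 3 <= r' * 1).
      { simpl. apply Rmult_le_compat; try lra; nra. }
      assert (A4 : K * (r ^ 2 / 2) <= r / 32).
      { replace (K * (r ^ 2 / 2)) with (K * r * (r / 2)) by (simpl; field).
        apply Rle_trans with (/ 16 * (r / 2)); [apply Rmult_le_compat_r; lra|lra]. }
      assert (A5 := Rmult_le_compat_l _ _ _ HK A1). assert (A6 := Rmult_le_compat_l _ _ _ HK A2).
      assert (A7 := Rmult_le_compat_l _ _ _ HK A3). lra. }
    assert (AZ : 0 <= L * Cmod z ^ 2 <= r' * L).
    { split; [apply Rmult_le_pos; [lra|now apply pow_le]|].
      rewrite (Rmult_comm r'). apply Rmult_le_compat_l; [lra|]. simpl. nra. }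
    assert (E1 := Hend (- (r / 2)) ltac:(rewrite Rabs_Ropp, Rabs_pos_eq; lra)).
    assert (E2 := Hend (r / 2) ltac:(rewrite Rabs_pos_eq; lra)).
    apply Rabs_le_between in E1, E2.
    destruct (IVT (fun v => - f z u v) (- (r / 2)) (r / 2)) as (v & Hv & Ev); try lra.
    - apply continuity_opp, H3.
    - exists v. split; [apply Rabs_lt_between; lra|lra]. }
  set (G := fun z u => epsilon (inhabits 0) (fun v => Rabs v < r /\ f z u v = 0)).
  assert (HG : forall z u, Cmod z < r' -> Rabs u < r' -> Rabs (G z u) < r /\ f z u (G z u) = 0).
  { intros z u Hz Hu. apply (epsilon_spec (inhabits 0) (fun v => Rabs v < r /\ f z u v = 0)).
    now apply Hsol. }
  exists G, r, r'. split; [lra|split; [lra|split]].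
  - intros z u v Hz Hu Hv. destruct (HG z u Hz Hu) as [G1 G2].
    destruct (Rtotal_order v (G z u)) as [C|[C|C]].
    + assert (E := H2 z u v (G z u) ltac:(lra) ltac:(lra) ltac:(lra) ltac:(lra) C). split; split; lra.
    + rewrite C, G2. split; split; lra.
    + assert (E := H2 z u (G z u) v ltac:(lra) ltac:(lra) ltac:(lra) ltac:(lra) C). split; split; lra.
  - intros eps Heps. set (B := 2 * L + 6 * K).
    assert (HB : 0 <= B) by (unfold B; lra).
    set (T := (1 + K) * ((B + 2) + 2 * (B + 1) ^ 2)).
    assert (HB2 : 0 <= (B + 1) ^ 2) by (apply pow_le; lra).
    assert (HT : 0 < T) by (unfold T; apply Rmult_lt_0_compat; lra).
    exists (Rmin r' (eps / T)). split; [apply Rmin_pos; auto; now apply Rdiv_lt_0_compat|].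
    intros z u Hz Hu. assert (M1 := Rmin_l r' (eps / T)). assert (M2 := Rmin_r r' (eps / T)).
    destruct (HG z u ltac:(lra) ltac:(lra)) as [G1 G2].
    assert (E := H1 z u (G z u) ltac:(lra) ltac:(lra) ltac:(lra)). rewrite G2 in E.
    replace (0 - (L * Cmod z ^ 2 - G z u)) with (G z u - L * Cmod z ^ 2) in E by ring.
    assert (Z := Cmod_ge_0 z). assert (U := Rabs_pos u). assert (V := Rabs_pos (G z u)).
    set (x := Cmod z) in *. set (y := Rabs u) in *. set (g := Rabs (G z u)) in *.
    set (m := Rmin r' (eps / T)) in *.
    assert (X2 : 0 <= x ^ 2) by now apply pow_le.
    set (Q := x ^ 2 + y) in *. assert (HQ : 0 <= Q) by (unfold Q; lra).
    (* a priori bound of the solution *)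
    assert (Hg : g <= B * Q).
    { assert (E0 : g <= L * x ^ 2 + K * (x * (y + g) + (y + g) ^ 2 + x ^ 3)).
      { assert (E' := Rabs_triang (G z u - L * x ^ 2) (L * x ^ 2)).
        replace (G z u - L * x ^ 2 + L * x ^ 2) with (G z u) in E' by ring. fold g in E'.
        rewrite (Rabs_pos_eq (L * x ^ 2)) in E' by (apply Rmult_le_pos; lra). lra. }
      assert (E1 : x * (y + g) + (y + g) ^ 2 + x ^ 3 <= 3 * Q + 3 * r * g).
      { assert (x * y <= 1 * y) by (apply Rmult_le_compat_r; lra).
        assert (x * g <= r * g) by (apply Rmult_le_compat_r; lra).
        assert (x ^ 3 <= x ^ 2) by (simpl; nra).
        assert (y ^ 2 <= y) by (simpl; nra).
        assert (y * g <= / 2 * r * g).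
        { apply Rmult_le_compat_r; lra. }
        assert (g * g <= r * g) by (apply Rmult_le_compat_r; lra).
        unfold Q. replace ((y + g) ^ 2) with (y ^ 2 + 2 * (y * g) + g * g) by ring. lra. }
      apply (Rmult_le_compat_l K) in E1; auto.
      assert (E2 : K * r * g <= / 16 * g) by (apply Rmult_le_compat_r; lra).
      assert (E3 : L * x ^ 2 <= L * Q) by (apply Rmult_le_compat_l; unfold Q; lra).
      assert (0 <= K * Q) by now apply Rmult_le_pos. assert (0 <= L * Q) by (apply Rmult_le_pos; lra).
      unfold B. lra. }
    assert (Hw : y + g <= (B + 1) * Q) by (unfold Q in *; lra).
    assert (HQm : Q <= 2 * m).
    { unfold Q. assert (x ^ 2 <= x) by (simpl; nra). lra. }
    assert (F1 : x * (y + g) <= m * ((B + 1) * Q)) by (apply Rmult_le_compat; lra).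
    assert (F2 : (y + g) ^ 2 <= 2 * (B + 1) ^ 2 * m * Q).
    { apply Rle_trans with (((B + 1) * Q) ^ 2); [apply pow_incr; lra|].
      replace (((B + 1) * Q) ^ 2) with ((B + 1) ^ 2 * (Q * Q)) by ring.
      replace (2 * (B + 1) ^ 2 * m * Q) with ((B + 1) ^ 2 * (2 * m * Q)) by ring.
      apply Rmult_le_compat_l; auto. now apply Rmult_le_compat_r. }
    assert (F3 : x ^ 3 <= m * Q).
    { replace (x ^ 3) with (x * x ^ 2) by ring. apply Rmult_le_compat; unfold Q; lra. }
    eapply Rle_trans; [exact E|].
    apply Rle_trans with ((1 + K) * (m * Q * (B + 2 + 2 * (B + 1) ^ 2))).
    + apply Rmult_le_compat; try lra.
      assert (0 <= x * (y + g)) by (apply Rmult_le_pos; lra).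
      assert (0 <= (y + g) ^ 2) by (apply pow_le; lra).
      assert (0 <= x ^ 3) by now apply pow_le. lra.
    + replace ((1 + K) * (m * Q * (B + 2 + 2 * (B + 1) ^ 2))) with (m * T * Q) by (unfold T; ring).
      apply Rmult_le_compat_r; auto.
      apply Rle_trans with (eps / T * T); [apply Rmult_le_compat_r; lra|right; field; lra].
Qed.

(** The difference quotient of F in u, as a polynomial. Its continuity makes the
    monotonicity in v uniform near p. *)
Definition Fquot (a x y u1 u2 : R) : R :=
  let s := x * x + y * y in let d := x * x + - 1 * (y * y) in
  (s * s * s + a * s * (d * d + -4 * (x * x * (y * y)))) * (u1 + u2)
  + s * ((u1 + u2) * ((u1 * u1 + u2 * u2) * (u1 * u1 * (u1 * u1) + u2 * u2 * (u2 * u2)))).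

Lemma Fquot_spec a z u1 u2 :
  F a z u2 - F a z u1 = (u2 - u1) * Fquot a (fst z) (snd z) u1 u2.
Proof. rewrite !F_real. unfold Freal, Fquot. ring. Qed.

Lemma Fquot_continuous a z u : exists K, 0 <= K /\ forall h : C * C, size2 h <= 1 ->
  Rabs (Fquot a (fst z + Re (fst h)) (snd z + Im (fst h)) (u + Re (snd h)) (u + Im (snd h))
        - Fu a z u) <= K * size2 h.
Proof.
  assert (J : exists c l q, jet2 (fun h => Fquot a (fst z + Re (fst h)) (snd z + Im (fst h))
    (u + Re (snd h)) (u + Im (snd h))) c l q /\ c = Fu a z u).
  { eexists _, _, _. split.
    - unfold Fquot; cbv zeta.
      repeat first [ apply jet2_coordinates | apply jet2_const | apply jet2_add | apply jet2_mul ].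
    - rewrite Fu_real. unfold FU. field. }
  destruct J as (c & l & q & (K & HK & H) & ->). exists (3 * K). split; [lra|].
  intros h Hh. destruct (H h Hh) as (A1 & A2 & A3). assert (Hn := size2_ge0 h).
  assert (E2 : size2 h ^ 2 <= size2 h) by (simpl; nra).
  assert (E3 : size2 h ^ 3 <= size2 h) by (simpl in *; nra).
  apply (Rmult_le_compat_l K) in E2, E3; auto.
  apply Rabs_le_between in A1, A2, A3. apply Rabs_le_between. lra.
Qed.

(** * Normal form and model at a strongly pseudoconvex point *)

(** The shear with these coefficients has second component - i (2 d' rho(h) + A h1^2),
    whose imaginary part is minus the pluriharmonic part of rho up to terms
    that the model neglects. *)
Definition normal_b (a : R) (p : C * C) : C := (- (RtoC 2 * Ci * rho_z a p))%C.
Definition normal_c (a : R) (p : C * C) : C := (- (RtoC 2 * Ci * rho_w a p))%C.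
Definition normal_e (a : R) (p : C * C) : C :=
  (- (Ci * hess_hol a p (RtoC 1, tangent_slope a p)))%C.

Definition normal_inv (a : R) (p : C * C) : C * C -> C * C :=
  unshear p (normal_b a p) (normal_c a p) (normal_e a p).

Lemma Ci_neq0 : Ci <> RtoC 0.
Proof. intros E. injection E. lra. Qed.

Lemma normal_c_neq0 a p : normal_c a p <> RtoC 0.
Proof.
  unfold normal_c. intros E. apply (rho_w_neq0 a p).
  apply (Cmult_eq_0 (- (RtoC 2 * Ci))%C); [|rewrite <- E; ring].
  intros E2. injection E2. lra.
Qed.

(** The deviation of the second coordinate from the complex tangent line. *)
Definition normal_s (a : R) (p : C * C) (z w : C) : C :=
  ((w - normal_e a p * z ^ 2) / normal_c a p)%C.

Lemma normal_inv_shift a p z w :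
  normal_inv a p (z, w) = shift p (z, (tangent_slope a p * z + normal_s a p z w)%C).
Proof.
  assert (H1 := rho_w_neq0 a p). assert (H2 := Ci_neq0).
  unfold normal_inv, unshear, normal_s. cbn [fst snd]. do 2 f_equal.
  unfold tangent_slope, normal_b, normal_c. field. repeat split; auto.
Qed.

Lemma normal_s_bound a p : exists K, 0 <= K /\ forall z w,
  Cmod (normal_s a p z w) <= K * (Cmod w + Cmod z ^ 2).
Proof.
  assert (H := proj1 (Cmod_gt_0 _) (normal_c_neq0 a p)).
  assert (He := Cmod_ge_0 (normal_e a p)).
  exists ((1 + Cmod (normal_e a p)) / Cmod (normal_c a p)).
  split; [apply Rmult_le_pos; [lra|left; now apply Rinv_0_lt_compat]|].
  intros z w. unfold normal_s. rewrite Cmod_div by apply normal_c_neq0.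
  unfold Rdiv. rewrite Rmult_assoc, (Rmult_comm (/ _)), <- Rmult_assoc.
  apply Rmult_le_compat_r; [left; now apply Rinv_0_lt_compat|].
  assert (E : Cmod (w - normal_e a p * z ^ 2) <= Cmod w + Cmod (normal_e a p) * Cmod z ^ 2).
  { unfold Cminus. eapply Rle_trans; [apply Cmod_triangle|].
    rewrite Cmod_opp, Cmod_mult, Cmod_pow. lra. }
  assert (W := Cmod_ge_0 w). nra.
Qed.

Lemma drho_normal a p z w :
  drho a p (z, (tangent_slope a p * z + normal_s a p z w)%C)
  = (Ci * w - hess_hol a p (RtoC 1, tangent_slope a p) * z ^ 2)%C.
Proof.
  assert (H1 := rho_w_neq0 a p). assert (H2 := Ci_neq0).
  assert (C2 : (Ci * Ci = - (1))%C) by (apply injective_projections; simpl; ring).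
  unfold drho, normal_s, normal_e, normal_c. cbn [fst snd].
  set (d := hess_hol _ _ _).
  transitivity ((- (w - - (Ci * d) * z ^ 2) / Ci)%C).
  - unfold tangent_slope. field. split; auto.
  - replace (Ci * w - d * z ^ 2)%C with ((Ci * Ci * w - Ci * d * z ^ 2) / Ci)%C by (field; auto).
    rewrite C2. field. auto.
Qed.

Lemma square_sum x y : (x + y) ^ 2 <= 2 * (x ^ 2 + y ^ 2).
Proof. assert (H := pow_even_ge0 (x - y) 1). simpl in *. lra. Qed.

Lemma cube_sum x y : 0 <= x -> 0 <= y -> (x + y) ^ 3 <= 4 * (x ^ 3 + y ^ 3).
Proof.
  intros Hx Hy. assert (H := pow_even_ge0 (x - y) 1).
  assert (0 <= (x + y) * (x - y) ^ 2) by pos.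
  simpl in *. lra.
Qed.

Lemma normal_model a p : rho_M a p = 0 -> exists K d, 0 <= K /\ 0 < d <= / 2 /\
  forall z u v, Cmod z < d -> Rabs u < d -> Rabs v < d ->
    Rabs (rho_M a (normal_inv a p (z, (u, v)))
          - (levi a p (RtoC 1, tangent_slope a p) * Cmod z ^ 2 - v))
      <= K * (Cmod z * (Rabs u + Rabs v) + (Rabs u + Rabs v) ^ 2 + Cmod z ^ 3).
Proof.
  intros Hp.
  destruct (rho_taylor a p) as (K1 & HK1 & HT).
  destruct (rho_quad_increment a p) as (D & HD & HQ).
  destruct (normal_s_bound a p) as (C0 & HC0 & HS).
  set (tau := tangent_slope a p) in *. set (t1 := 1 + Cmod tau).
  assert (Ht1 : 1 <= t1) by (unfold t1; generalize (Cmod_ge_0 tau); lra).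
  exists (D * (t1 * C0 + 2 * C0 ^ 2) + 4 * K1 * (t1 + C0) ^ 3), (/ (4 * (1 + t1 + C0))).
  assert (P2 : 0 <= C0 ^ 2) by pos.
  assert (P3 : 0 <= (t1 + C0) ^ 3) by pos.
  split; [|split; [split|]].
  { assert (0 <= D * (t1 * C0 + 2 * C0 ^ 2)) by pos.
    assert (0 <= K1 * (t1 + C0) ^ 3) by pos. lra. }
  { apply Rinv_0_lt_compat; lra. }
  { apply Rinv_le_contravar; lra. }
  intros z u v Hz Hu Hv. set (d := / (4 * (1 + t1 + C0))) in *.
  assert (Hd : d * (4 * (1 + t1 + C0)) = 1) by (unfold d; field; lra).
  assert (Z := Cmod_ge_0 z). assert (U := Rabs_pos u). assert (V := Rabs_pos v).
  set (w := (u, v) : C).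
  assert (Hw : Cmod w <= Rabs u + Rabs v).
  { replace w with (RtoC u + Ci * RtoC v)%C by (apply injective_projections; simpl; ring).
    eapply Rle_trans; [apply Cmod_triangle|]. rewrite Cmod_mult, Cmod_Ci, !Cmod_R. lra. }
  set (W := Rabs u + Rabs v) in *. assert (HW : 0 <= W) by (unfold W; lra).
  set (s := normal_s a p z w).
  assert (Hs : Cmod s <= C0 * (W + Cmod z ^ 2)).
  { eapply Rle_trans; [apply HS|]. apply Rmult_le_compat_l; lra. }
  rewrite normal_inv_shift. fold tau s. set (h := (z, (tau * z + s)%C)).
  set (x := scal2 z (RtoC 1, tau)).
  assert (Eh : h = shift (scal2 (RtoC 1) x) (RtoC 0, s)).
  { unfold h, x, shift, scal2; cbn [fst snd]. f_equal; ring. }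
  set (Y := Cmod z) in *.
  assert (Hx : size2 x = Y * t1).
  { unfold x. rewrite size2_scal. unfold size2, t1; cbn [fst snd]. now rewrite Cmod_1. }
  assert (Hs0 : size2 (RtoC 0, s) = Cmod s).
  { unfold size2; cbn [fst snd]. rewrite Cmod_0. ring. }
  assert (d1 : d <= / 8) by nra.
  assert (Y2 : 0 <= Y ^ 2 <= Y) by nra.
  assert (Y4 : Y ^ 4 <= Y ^ 3) by nra.
  assert (W3 : W ^ 3 <= W ^ 2).
  { replace (W ^ 3) with (W * W ^ 2) by ring. assert (W <= 1) by (unfold W; lra). nra. }
  assert (Hs' : Cmod s <= C0 * (W + Y)) by nra.
  assert (Hn : size2 h <= (t1 + C0) * (Y + W)).
  { unfold size2, h; cbn [fst snd]. fold Y.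
    assert (E := Cmod_triangle (tau * z) s). rewrite Cmod_mult in E. fold Y in E.
    assert (0 <= t1 * W) by pos. unfold t1 in *. lra. }
  assert (Hn1 : size2 h <= 1).
  { eapply Rle_trans; [exact Hn|].
    apply Rle_trans with ((t1 + C0) * (3 * d)); [apply Rmult_le_compat_l; unfold W; lra|]. nra. }
  destruct (HT h Hn1) as (_ & _ & H3). fold (shift p h) (rho_quad a p h) in H3. rewrite Hp in H3.
  assert (Q := HQ 1 x (RtoC 0, s)). rewrite <- Eh, Hx, Hs0, Rabs_R1 in Q.
  assert (Ed : Re (drho a p h) = - v - Re (hess_hol a p (RtoC 1, tau) * z ^ 2)%C).
  { unfold h, s, tau. rewrite drho_normal. generalize (hess_hol a p (RtoC 1, tangent_slope a p) * z ^ 2)%C.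
    intros [c1 c2]. unfold w, Re; simpl. ring. }
  assert (Ex : rho_quad a p x = Re (hess_hol a p (RtoC 1, tau) * z ^ 2)%C
     + levi a p (RtoC 1, tau) * Y ^ 2).
  { unfold rho_quad. f_equal.
    - f_equal. unfold hess_hol, x, scal2; cbn [fst snd]; cbv zeta. ring.
    - replace x with (z, (tau * z)%C) by (unfold x, scal2; cbn [fst snd]; f_equal; ring).
      rewrite levi_scal. fold Y. ring. }
  replace (rho_M a (shift p h) - (levi a p (RtoC 1, tau) * Y ^ 2 - v)) with
    ((rho_M a (shift p h) - 0 - Re (drho a p h) - rho_quad a p h)
      + (rho_quad a p h - 1 ^ 2 * rho_quad a p x)) by pos.
  eapply Rle_trans; [apply Rabs_triang|].
  assert (G1 : K1 * size2 h ^ 3 <= 4 * K1 * (t1 + C0) ^ 3 * (W ^ 2 + Y ^ 3)).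
  { apply Rle_trans with (K1 * ((t1 + C0) * (Y + W)) ^ 3).
    - apply Rmult_le_compat_l; auto. apply pow_incr. split; [apply size2_ge0|auto].
    - rewrite Rpow_mult_distr.
      replace (4 * K1 * (t1 + C0) ^ 3 * (W ^ 2 + Y ^ 3))
        with (K1 * ((t1 + C0) ^ 3 * (4 * (W ^ 2 + Y ^ 3)))) by ring.
      apply Rmult_le_compat_l; auto. apply Rmult_le_compat_l; auto.
      assert (E3 := cube_sum Y W Z HW). lra. }
  assert (G2 : D * (1 * (Y * t1) * Cmod s + Cmod s ^ 2)
    <= D * (t1 * C0 + 2 * C0 ^ 2) * (Y * W + W ^ 2 + Y ^ 3)).
  { rewrite (Rmult_assoc D (t1 * C0 + 2 * C0 ^ 2)). apply Rmult_le_compat_l; auto.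
    assert (Yt : 0 <= Y * t1) by pos.
    assert (A1 := Rmult_le_compat_l _ _ _ Yt Hs).
    assert (A2 : Cmod s ^ 2 <= (C0 * (W + Y ^ 2)) ^ 2) by
      (apply pow_incr; split; [apply Cmod_ge_0|auto]).
    assert (A3 : (C0 * (W + Y ^ 2)) ^ 2 <= C0 ^ 2 * (2 * W ^ 2 + 2 * Y ^ 3)).
    { rewrite Rpow_mult_distr. apply Rmult_le_compat_l; auto.
      assert (E2 := square_sum W (Y ^ 2)). replace ((Y ^ 2) ^ 2) with (Y ^ 4) in E2 by ring. lra. }
    assert (A4 : 0 <= t1 * C0 * W ^ 2) by pos.
    assert (A5 : 0 <= C0 ^ 2 * (Y * W)) by pos.
    replace (Y * t1 * (C0 * (W + Y ^ 2))) with (t1 * C0 * (Y * W + Y ^ 3)) in A1 by ring.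
    lra. }
  assert (0 <= 4 * K1 * (t1 + C0) ^ 3 * (Y * W)) by pos.
  lra.
Qed.

(** Moving v by a real amount moves the original w along the w-component of the normal
    to M at p. *)
Lemma normal_inv_vertical a p z u v1 v2 :
  let k := / (1 + Fu a (fst p) (Re (snd p)) ^ 2) in
  Re (snd (normal_inv a p (z, (u, v2)))) - Re (snd (normal_inv a p (z, (u, v1))))
    = - (v2 - v1) * Fu a (fst p) (Re (snd p)) * k /\
  Im (snd (normal_inv a p (z, (u, v2)))) - Im (snd (normal_inv a p (z, (u, v1))))
    = (v2 - v1) * k.
Proof.
  intros k. set (f := Fu a (fst p) (Re (snd p))) in *.
  assert (Hf : 0 < 1 + f ^ 2) by nra.
  assert (E : (snd (normal_inv a p (z, (u, v2))) - snd (normal_inv a p (z, (u, v1))))%C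
    = (- (v2 - v1) * f * k, (v2 - v1) * k)).
  { rewrite !normal_inv_shift. unfold shift, normal_s. cbn [fst snd].
    transitivity ((((u, v2) : C) - ((u, v1) : C)) / normal_c a p)%C; [field; apply normal_c_neq0|].
    assert (Ec : (normal_c a p * (((- (v2 - v1) * f * k)%R, ((v2 - v1) * k)%R) : C))%C
      = (((u, v2) : C) - ((u, v1) : C))%C).
    { unfold normal_c, rho_w. fold f. unfold k.
      apply injective_projections; simpl; field; simpl in Hf; lra. }
    rewrite <- Ec. field. apply normal_c_neq0. }
  split.
  - exact (f_equal fst E).
  - exact (f_equal snd E).
Qed.

(** In the new coordinates the derivative of rho in v is close to -1; the difference
    quotient of F replaces the derivative. *)
Lemma normal_monotone a p : exists d, 0 < d /\
  forall z u v1 v2, Cmod z < d -> Rabs u < d -> Rabs v1 < d -> Rabs v2 < d -> v1 < v2 ->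
    rho_M a (normal_inv a p (z, (u, v2))) < rho_M a (normal_inv a p (z, (u, v1))).
Proof.
  destruct (normal_s_bound a p) as (C0 & HC0 & HS).
  destruct (Fquot_continuous a (fst p) (Re (snd p))) as (K & HK & HF).
  set (f := Fu a (fst p) (Re (snd p))) in *.
  set (tau := tangent_slope a p) in *. set (t1 := 1 + Cmod tau).
  assert (Ht1 : 1 <= t1) by (unfold t1; generalize (Cmod_ge_0 tau); lra).
  assert (Hf := Rabs_pos f).
  set (X := 1 + K * (1 + Rabs f)).
  assert (HX : 1 <= X) by (unfold X; assert (0 <= K * (1 + Rabs f)) by pos; lra).
  set (S := 1 + 6 * (t1 + C0)). assert (HS0 : 1 <= S) by (unfold S; lra).
  set (d := / (2 * S * X)).
  assert (HSX : 1 <= S * X) by nra.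
  assert (Hd : 0 < d) by (apply Rinv_0_lt_compat; lra).
  assert (HdS : d * S * X = / 2) by (unfold d; field; lra).
  exists d. split; auto. intros z u v1 v2 Hz Hu Hv1 Hv2 Hv.
  assert (Z := Cmod_ge_0 z).
  assert (Hsize : forall v, Rabs v < d ->
     Rabs (Re (snd (normal_inv a p (z, (u, v)))) - Re (snd p)) <= 3 * (t1 + C0) * d).
  { intros v Hvd. rewrite normal_inv_shift. unfold shift; cbn [fst snd]. fold tau.
    set (w := (u, v) : C).
    assert (Hw : Cmod w <= 2 * d).
    { replace w with (RtoC u + Ci * RtoC v)%C by (apply injective_projections; simpl; ring).
      eapply Rle_trans; [apply Cmod_triangle|]. rewrite Cmod_mult, Cmod_Ci, !Cmod_R. lra. }
    replace (Re (snd p + (tau * z + normal_s a p z w))%C - Re (snd p))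
      with (Re (tau * z + normal_s a p z w)%C).
    2: { generalize (tau * z + normal_s a p z w)%C. intros [c1 c2]. unfold Re; simpl. ring. }
    eapply Rle_trans; [apply re_le_Cmod|]. eapply Rle_trans; [apply Cmod_triangle|].
    rewrite Cmod_mult.
    assert (E := HS z w). assert (Z2 : Cmod z ^ 2 <= d) by nra.
    assert (C0 * (Cmod w + Cmod z ^ 2) <= C0 * (3 * d)) by nra.
    assert (Cmod tau * Cmod z <= Cmod tau * d) by (apply Rmult_le_compat_l; [apply Cmod_ge_0|lra]).
    assert (0 <= Cmod tau * d) by pos.
    unfold t1. lra. }
  assert (S1 := Hsize v1 Hv1). assert (S2 := Hsize v2 Hv2).
  destruct (normal_inv_vertical a p z u v1 v2) as [E1 E2]. fold f in E1, E2.
  assert (Hf2 : 0 < 1 + f ^ 2) by nra.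
  set (k := / (1 + f ^ 2)) in *. assert (Hk : 0 < k) by now apply Rinv_0_lt_compat.
  set (q1 := normal_inv a p (z, (u, v1))) in *. set (q2 := normal_inv a p (z, (u, v2))) in *.
  assert (Ez : forall q, fst (normal_inv a p (z, q)) = (fst p + z)%C).
  { intros q. now rewrite normal_inv_shift. }
  assert (ER : rho_M a q2 - rho_M a q1
    = (Re (snd q2) - Re (snd q1)) * Fquot a (fst (fst p + z)%C) (snd (fst p + z)%C)
        (Re (snd q1)) (Re (snd q2)) - (Im (snd q2) - Im (snd q1))).
  { rewrite <- Fquot_spec. unfold rho_M, q1, q2. rewrite !Ez. ring. }
  clearbody q1 q2.
  set (h := (z, (Re (snd q1) - Re (snd p), Re (snd q2) - Re (snd p))) : C * C).
  assert (Hh : size2 h <= S * d).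
  { unfold size2, h; cbn [fst snd].
    replace ((Re (snd q1) - Re (snd p), Re (snd q2) - Re (snd p)) : C) with
      (RtoC (Re (snd q1) - Re (snd p)) + Ci * RtoC (Re (snd q2) - Re (snd p)))%C
      by (apply injective_projections; simpl; ring).
    assert (E := Cmod_triangle (RtoC (Re (snd q1) - Re (snd p)))
      (Ci * RtoC (Re (snd q2) - Re (snd p)))).
    rewrite Cmod_mult, Cmod_Ci, !Cmod_R in E. unfold S. lra. }
  assert (HSd : 0 <= S * d) by pos.
  assert (HSd1 : S * d <= / 2) by nra.
  assert (G := HF h ltac:(lra)). unfold h in G at 1. unfold h in G at 1. unfold h in G at 1.
  unfold h in G at 1. cbn [fst snd] in G.
  replace (Re (snd p) + Re ((Re (snd q1) - Re (snd p), Re (snd q2) - Re (snd p)) : C))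
    with (Re (snd q1)) in G by (unfold Re; simpl; ring).
  replace (Re (snd p) + Im ((Re (snd q1) - Re (snd p), Re (snd q2) - Re (snd p)) : C))
    with (Re (snd q2)) in G by (unfold Re, Im; simpl; ring).
  change (fst (fst p) + Re z) with (fst (fst p + z)%C) in G.
  change (snd (fst p) + Im z) with (snd (fst p + z)%C) in G.
  set (D := Fquot _ _ _ _ _) in *.
  assert (GK : Rabs (f * (D - f)) <= / 2).
  { rewrite Rabs_mult. apply Rle_trans with (Rabs f * (K * (S * d))).
    - apply Rmult_le_compat_l; auto. eapply Rle_trans; [exact G|]. apply Rmult_le_compat_l; auto.
    - rewrite <- HdS. replace (Rabs f * (K * (S * d))) with (d * S * (K * Rabs f)) by ring.
      apply Rmult_le_compat_l; [lra|]. unfold X. lra. }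
  apply Rabs_le_between in GK.
  assert (E3 : rho_M a q2 - rho_M a q1 = - ((v2 - v1) * k * (1 + f ^ 2 + f * (D - f)))) by nra.
  assert (0 < (v2 - v1) * k * (1 + f ^ 2 + f * (D - f))).
  { apply Rmult_lt_0_compat; [apply Rmult_lt_0_compat; lra|].
    generalize (pow_even_ge0 f 1); simpl Nat.mul; lra. }
  lra.
Qed.

Lemma Freal_continuity a x y b c e f :
  continuity (fun v => Freal a x y (b + c * v) - (e + f * v)).
Proof.
  intros v. apply derivable_continuous_pt, ex_derive_Reals_0. unfold Freal. auto_derive. auto.
Qed.

Lemma normal_continuity a p z u : continuity (fun v => rho_M a (normal_inv a p (z, (u, v)))).
Proof.
  set (q0 := normal_inv a p (z, (u, 0))).
  set (f := Fu a (fst p) (Re (snd p))). set (k := / (1 + f ^ 2)).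
  intros v.
  apply (continuity_pt_ext (fun v => Freal a (fst (fst p + z)%C) (snd (fst p + z)%C)
     (Re (snd q0) + - f * k * v) - (Im (snd q0) + k * v))).
  - intros t. rewrite rho_real.
    destruct (normal_inv_vertical a p z u 0 t) as [E1 E2]. fold f k q0 in E1, E2.
    assert (Ez : fst (normal_inv a p (z, (u, t))) = (fst p + z)%C) by now rewrite normal_inv_shift.
    rewrite Ez. f_equal.
    + f_equal. unfold Re in E1 |- *. lra.
    + unfold Im in E2 |- *. lra.
  - apply Freal_continuity.
Qed.

Lemma open_shear_box p b c e r r' : open (fun q =>
  Cmod (fst (shear p b c e q)) < r' /\ Rabs (Re (snd (shear p b c e q))) < r' /\
  Rabs (Im (snd (shear p b c e q))) < r).
Proof.
  intros q (H1 & H2 & H3). apply locally_shift.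
  destruct (holomorphic_lipschitz (fun _ => True) (shear p b c e) q (shear_holomorphic p b c e _) I)
    as (K & d & HK & Hd & H).
  set (Q := shear p b c e q) in *.
  set (m := Rmin (r' - Cmod (fst Q)) (Rmin (r' - Rabs (Re (snd Q))) (r - Rabs (Im (snd Q))))).
  assert (Hm : 0 < m) by (unfold m; repeat apply Rmin_pos; lra).
  assert (M1 : m <= r' - Cmod (fst Q)) by apply Rmin_l.
  assert (M2 : m <= Rmin (r' - Rabs (Re (snd Q))) (r - Rabs (Im (snd Q)))) by apply Rmin_r.
  assert (M3 := Rmin_l (r' - Rabs (Re (snd Q))) (r - Rabs (Im (snd Q)))).
  assert (M4 := Rmin_r (r' - Rabs (Re (snd Q))) (r - Rabs (Im (snd Q)))).
  exists (Rmin d (m / (1 + K))).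
  split; [apply Rmin_pos; auto; apply Rdiv_lt_0_compat; lra|].
  intros h Hh. assert (N1 := Rmin_l d (m / (1 + K))). assert (N2 := Rmin_r d (m / (1 + K))).
  assert (Hn := size2_ge0 h).
  assert (Hlt : size2 (diff (shear p b c e (shift q h)) Q) < m).
  { eapply Rle_lt_trans; [apply H; lra|].
    assert (size2 h * (1 + K) < m).
    { apply Rlt_le_trans with (m / (1 + K) * (1 + K)).
      - apply Rmult_lt_compat_r; lra.
      - right; field; lra. }
    lra. }
  set (Q' := shear p b c e (shift q h)) in *. unfold size2, diff in Hlt. cbn [fst snd] in Hlt.
  generalize (Cmod_ge_0 (fst Q' - fst Q)) (Cmod_ge_0 (snd Q' - snd Q))
    (re_le_Cmod (snd Q' - snd Q)) (Rabs_im_le (snd Q' - snd Q)). intros A1 A2 A3 A4.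
  replace (Re (snd Q' - snd Q)%C) with (Re (snd Q') - Re (snd Q)) in A3 by reflexivity.
  replace (Im (snd Q' - snd Q)%C) with (Im (snd Q') - Im (snd Q)) in A4 by reflexivity.
  repeat split.
  - replace (fst Q') with (fst Q' - fst Q + fst Q)%C by ring.
    eapply Rle_lt_trans; [apply Cmod_triangle|lra].
  - replace (Re (snd Q')) with (Re (snd Q') - Re (snd Q) + Re (snd Q)) by ring.
    eapply Rle_lt_trans; [apply Rabs_triang|lra].
  - replace (Im (snd Q')) with (Im (snd Q') - Im (snd Q) + Im (snd Q)) by ring.
    eapply Rle_lt_trans; [apply Rabs_triang|lra].
Qed.

Theorem model_strongly_pseudoconvex a p : rho_M a p = 0 ->
  0 < levi a p (RtoC 1, tangent_slope a p) ->
  model_at (rho_M a) p 2 (fun z => levi a p (RtoC 1, tangent_slope a p) * Cmod z ^ 2).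
Proof.
  intros Hp HL. set (L := levi a p (RtoC 1, tangent_slope a p)) in *.
  split; [now apply finite_type_2|split].
  - exists L, (fun _ => RtoC 0). split; auto. intros z. now rewrite model_function_radial.
  - destruct (normal_model a p Hp) as (K & d1 & HK & Hd1 & H1).
    destruct (normal_monotone a p) as (d2 & Hd2 & H2).
    assert (M1 := Rmin_l d1 d2). assert (M2 := Rmin_r d1 d2).
    assert (M3 : 0 < Rmin d1 d2) by pos.
    destruct (implicit_graph (fun z u v => rho_M a (normal_inv a p (z, (u, v)))) L K (Rmin d1 d2))
      as (G & r & r' & Hr & Hr' & HG & Hest); auto; try lra.
    + intros z u v Hz Hu Hv. apply H1; lra.
    + intros z u v1 v2 Hz Hu Hv1 Hv2 Hv. apply H2; lra.
    + intros z u. apply normal_continuity.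
    + set (Phi := shear p (normal_b a p) (normal_c a p) (normal_e a p)).
      exists (fun q => Cmod (fst (Phi q)) < r' /\ Rabs (Re (snd (Phi q))) < r' /\
        Rabs (Im (snd (Phi q))) < r), Phi, G.
      assert (Ep : Phi p = (RtoC 0, RtoC 0)) by apply shear_center.
      split; [|split; [auto|split; [|exact Hest]]].
      * apply shear_coordinates; [apply normal_c_neq0|apply open_shear_box|].
        fold Phi. rewrite Ep. unfold Re, Im; cbn [fst snd]. rewrite Cmod_0; simpl.
        rewrite Rabs_R0. lra.
      * intros q (U1 & U2 & U3). cbv zeta.
        assert (E := HG _ _ _ U1 U2 U3).
        replace (normal_inv a p (fst (Phi q), (Re (snd (Phi q)), Im (snd (Phi q))))) with q in E;
          auto.
        replace (fst (Phi q), (Re (snd (Phi q)), Im (snd (Phi q)))) with (Phi q)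
          by auto.
        symmetry. apply unshear_shear, normal_c_neq0.
Qed.

(** * The theorem *)

Theorem mainTheorem3 (a : R) (ha : 3 / 5 < a < 9 / 5) :
  locally origin (fun p => M a p -> pseudoconvex_at (rho_M a) p) /\
  ~ locally_convexifiable (rho_M a) origin /\
  model_at (rho_M a) origin 8 (fun z => Cmod z ^ 8) /\
  convex_model (fun z => Cmod z ^ 8) /\
  locally origin (fun p => M a p -> p <> origin ->
    strongly_pseudoconvex_at (rho_M a) p /\
    exists P : C -> R, model_at (rho_M a) p 2 P /\ convex_model P).
Proof.
  destruct (levi_pos a ha) as (d & Hd & HL).
  assert (Hlevi : forall h, size2 h < d -> M a (shift origin h) -> shift origin h <> origin ->
    0 < levi a (shift origin h) (RtoC 1, tangent_slope a (shift origin h))).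
  { intros h Hh HM Hp. rewrite shift_origin in *.
    generalize (Cmod_ge_0 (fst h)) (Cmod_ge_0 (snd h)) (re_le_Cmod (snd h)).
    unfold size2 in Hh. intros. apply HL; try lra. now apply weight_pos with a. }
  assert (Hstrong : forall p, 0 < levi a p (RtoC 1, tangent_slope a p) ->
    strongly_pseudoconvex_at (rho_M a) p).
  { intros p Hp t Ht Hnz. apply complex_tangent_rho in Ht. rewrite levi_form_rho.
    rewrite levi_tangent by auto. apply Rmult_lt_0_compat; auto. apply pow_lt, Cmod_gt_0.
    intros E. apply Hnz. apply tangent_slope_spec in Ht. destruct t as [t1 t2]. cbn [fst snd] in *.
    rewrite Ht, E. f_equal. ring. }
  assert (Horigin : forall t, levi_form (rho_M a) origin t = 0).
  { intros t. rewrite levi_form_rho. unfold levi, Fzzb, Fzu, Fuu, origin. cbn [fst snd]. cbv zeta.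
    rewrite Cmod_0. replace (Re (RtoC 0)) with 0 by reflexivity.
    destruct t as [[t1 t2] [t3 t4]]. unfold Re; simpl. field. }
  split; [|split; [now apply not_locally_convexifiable|split; [|split]]].
  - apply locally_shift. exists d. split; [lra|]. intros h Hh HM.
    destruct (excluded_middle_informative (shift origin h = origin)) as [->|N].
    + intros t _. rewrite Horigin. lra.
    + intros t Ht. rewrite levi_form_rho. rewrite levi_tangent by now apply complex_tangent_rho.
      apply Rmult_le_pos; [apply pow_le, Cmod_ge_0|]. left. auto.
  - apply model_origin. lra.
  - intros p q Hp Hq t Ht.
    assert (E := radial_convex_model 1 8 ltac:(lra) p q ltac:(lra) ltac:(lra) t Ht).
    cbv beta in E. lra.
  - apply locally_shift. exists d. split; [lra|]. intros h Hh HM N.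
    split; [auto|]. eexists. split.
    + apply model_strongly_pseudoconvex; auto. unfold rho_M. unfold M in HM. lra.
    + apply radial_convex_model. left. auto.
Qed.
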